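(* Let $n\ge 1$, let $a_1,\dots,a_n>0$ with $a_i\neq 1$ for all $i$, and let $v$ denote the number of distinct values in the set $\{a_1,\dots,a_n\}$. Let $f:\mathbb{R}^n\to\mathbb{R}$ be mixed homogeneous of degree $(a_1,\dots,a_n)$, and let $g$ be a nonnegative locally integrable function on $\mathbb{R}^n$ that is mixed homogeneous of degree $(\rho a_1,\dots,\rho a_n)$ on $\mathbb{R}^n\setminus\{0\}$ for some $\rho\in\mathbb{R}$. Call $\phi$ admissible for $g$ if it satisfies the conditions given in the context, and for admissible $\phi$ let $$T(\lambda_0,\lambda_1,\dots,\lambda_n)=\int_{\mathbb{R}^n}e^{i\lambda_0 f(x_1,\dots,x_n)+i\lambda_1x_1+\dots+i\lambda_nx_n}\,\phi(x_1,\dots,x_n)\,dx_1\cdots dx_n .$$ Below, constants depend only on the objects in their subscripts (and on $n$, $a_1,\dots,a_n$, $\rho$); in particular they do not depend on the admissible $\phi$ or on $\lambda=(\lambda_0,\dots,\lambda_n)\in\mathbb{R}^{n+1}$. (a) Let $\mu_g$ denote the measure $|g(x_1,\dots,x_n)|\,dx_1\cdots dx_n$. Suppose $\epsilon>0$ is such that for some $B_{f,g,\epsilon}>0$, for all $t>0$ one has $$\mu_g(\{x\in[-1,1]^n:|f(x)|<t\})\le B_{f,g,\epsilon}\,t^{\epsilon}.\qquad(\ast)$$ If $\epsilon\neq\frac1{v+1}$, there exists $C_{f,g,\epsilon}>0$ such that for all admissible $\phi$ and all $\lambda$, $$|T(\lambda_0,\lambda_1,\dots,\lambda_n)|\le C_{f,g,\epsilon}(1+|\lambda_0|)^{-\min(\epsilon,\frac1{v+1})}.$$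 If $\epsilon=\frac1{v+1}$, the same holds with an additional factor of $\ln(2+|\lambda_0|)$ on the right-hand side. Conversely, suppose $0<\eta<1$ is such that for all admissible $\phi$ one has an estimate $$|T(\lambda_0,\lambda_1,\dots,\lambda_n)|\le C_{f,g,\eta}(1+|\lambda_0|)^{-\eta}\quad\text{for all }\lambda .$$ Then for every $0<\epsilon<\eta$ there is a constant $B_{f,g,\epsilon}$ such that $(\ast)$ holds for all $t>0$. Hence, if the supremum $\delta$ of all $\epsilon$ for which such a $B_{f,g,\epsilon}$ exists is at most $\frac1{v+1}$, the exponent above is sharp: there is no $\eta>\delta$ for which an estimate $|T(\lambda)|\le C_{f,g,\eta}(1+|\lambda_0|)^{-\eta}$ holds for all admissible $\phi$ and all $\lambda$. (b) Suppose $g\in L^p([-1,1]^n)$ where $1\le p\le\infty$, and let $p'$ be the conjugate exponent, $\frac1p+\frac1{p'}=1$. Write $\lambda'=(\lambda_1,\dots,\lambda_n)$ and let $|\lambda'|$ be its magnitude. If $p'\neq v+1$, then for some $C'_{f,g,p}>0$, for all admissible $\phi$ and all $\lambda$, $$|T(\lambda_0,\lambda_1,\dots,\lambda_n)|\le C'_{f,g,p}(1+|\lambda'|)^{-\min(\frac1{p'},\frac1{v+1})}.$$ If $p'=v+1$, the same estimate holds with an additional factor of $(\ln(2+|\lambda'|))^{\frac1{v+1}}$ on the right-hand side. (c) Suppose $g\in L^p([-1,1]^n)$ for some $1\le p\le\infty$, with $p'$ the conjugate exponent. If $p'\neq v$, then for some $C''_{f,g,p}>0$, for all admissible $\phi$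 and all $\lambda'=(\lambda_1,\dots,\lambda_n)$, $$|T(0,\lambda_1,\dots,\lambda_n)|\le C''_{f,g,p}(1+|\lambda'|)^{-\min(\frac1{p'},\frac1v)}.$$ If $p'=v$, the same estimate holds with an additional factor of $(\ln(2+|\lambda'|))^{\frac1v}$ on the right-hand side.
   Context: Mixed homogeneity: for positive $a_1,\dots,a_n$, a function $f:\mathbb{R}^n\to\mathbb{R}$ is mixed homogeneous of degree $(a_1,\dots,a_n)$ if $f(t^{1/a_1}x_1,\dots,t^{1/a_n}x_n)=t\,f(x_1,\dots,x_n)$ for all $t>0$ and all $x\in\mathbb{R}^n$; $f$ is understood to be Lebesgue measurable. For $\rho\in\mathbb{R}$ (possibly zero or negative), $g$ is mixed homogeneous of degree $(\rho a_1,\dots,\rho a_n)$ on $\mathbb{R}^n\setminus\{0\}$ if $g(t^{1/a_1}x_1,\dots,t^{1/a_n}x_n)=t^{\rho}g(x_1,\dots,x_n)$ for all $t>0$ and $x\neq0$. Admissible $\phi$: an integrable (real- or complex-valued) function $\phi$ on $\mathbb{R}^n$ supported on the unit ball such that $$|\phi(x)|\le g(x)\quad\text{and}\quad\Big|\sum_{i=1}^n\frac{x_i}{a_i}\frac{\partial\phi}{\partial x_i}(x)\Big|\le g(x)$$ for $x\ne 0$. No regularity of $f,g,\phi$ is assumed in directions other than along the curves $t\mapsto(t^{1/a_1}x_1,\dots,t^{1/a_n}x_n)$: the sum $\sum_i\frac{x_i}{a_i}\frac{\partial\phi}{\partial x_i}(x)$ is understood as $\frac{d}{dt}\big|_{t=1}\phi(t^{1/a_1}x_1,\dots,t^{1/a_n}x_n)$,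 where $t\mapsto\phi(t^{1/a_1}x_1,\dots,t^{1/a_n}x_n)$ is $C^1$ on $(0,\infty)$ for each $x\neq0$. Convention: $1/p'=0$ when $p=1$ ($p'=\infty$). *)

(* Defs.v *)
From HB Require Import structures.
From mathcomp Require Import all_boot all_order all_algebra.
From mathcomp Require Import complex.
From mathcomp Require Import all_classical all_reals all_analysis.

Set Implicit Arguments.
Unset Strict Implicit.
Unset Printing Implicit Defensive.
Import Order.TTheory GRing.Theory Num.Theory.
Import numFieldNormedType.Exports.
Import ComplexField.Normc.
Local Open Scope classical_set_scope.
Local Open Scope ring_scope.

(* Lebesgue measure on R^n = 'rV[R]_n. The library has the one-dimensional
   Lebesgue measure, binary products and Caratheodory completion only, so the
   Borel version is the iterated product (along R * R^n ~ R^(n+1)), and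
   [lebesgue_rV] is its completion: its measurable sets are the Lebesgue
   measurable sets of R^n, not just the Borel sets. *)
Section lebesgue_measure_rV.
Context (R : realType).

Definition rV_cylinders (n : nat) : set (set 'rV[R]_n) :=
  [set A | exists (i : 'I_n) (B : set R),
    measurable B /\ A = [set x : 'rV[R]_n | B (x 0 i)]].

Definition borel_rV (n : nat) := g_sigma_algebraType (@rV_cylinders n).

Definition cons_rV (n : nat) (p : measurableTypeR R * borel_rV n) :
    borel_rV n.+1 :=
  \row_(i < n.+1) oapp ((p.2 : 'rV[R]_n) 0) p.1 (unlift ord0 i).

Lemma measurable_cons_rV (n : nat) : measurable_fun setT (@cons_rV n).
Proof.
apply: measurability => // _ [_ [i [B [mB ->]]] <-]; rewrite setTI.
case: (unliftP ord0 i) => [j|] ->.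
- rewrite [X in measurable X](_ : _ =
    snd @^-1` ([set x : 'rV[R]_n | B (x 0 j)] : set (borel_rV n))).
    rewrite -[X in measurable X]setTI.
    apply: measurable_snd => //; apply: sub_sigma_algebra.
    by exists j, B.
  by apply/seteqP; split=> p /=; rewrite mxE liftK.
- rewrite [X in measurable X](_ : _ = fst @^-1` (B : set (measurableTypeR R))).
    by rewrite -[X in measurable X]setTI; exact: measurable_fst.
  by apply/seteqP; split=> p /=; rewrite mxE unlift_none.
Qed.

Definition uncons_rV (n : nat) (x : borel_rV n.+1) :
    measurableTypeR R * borel_rV n :=
  ((x : 'rV[R]_n.+1) 0 ord0,
   \row_(j < n) (x : 'rV[R]_n.+1) 0 (lift ord0 j)).

Lemma cons_rVK (n : nat) : cancel (@cons_rV n) (@uncons_rV n).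
Proof.
move=> [c u]; congr pair => /=; first by rewrite mxE unlift_none.
by apply/rowP => j; rewrite !mxE liftK.
Qed.

Lemma measurable_coord_rV (n : nat) (i : 'I_n) :
  measurable_fun setT
    (fun x : borel_rV n => (x : 'rV[R]_n) 0 i : measurableTypeR R).
Proof.
move=> _ B mB; rewrite setTI; apply: sub_sigma_algebra.
by exists i, B.
Qed.

Lemma measurable_uncons_rV (n : nat) : measurable_fun setT (@uncons_rV n).
Proof.
apply: measurable_fun_pair; first exact: measurable_coord_rV.
apply: measurability => // _ [_ [i [B [mB ->]]] <-]; rewrite setTI.
rewrite [X in measurable X](_ : _ =
    [set x : borel_rV n.+1 | B ((x : 'rV[R]_n.+1) 0 (lift ord0 i))]).
  by rewrite -[X in measurable X]setTI; exact: measurable_coord_rV.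
by apply/seteqP; split=> x /=; rewrite mxE.
Qed.

Section lebesgue_cons.
Context (n : nat) (m : {sigma_finite_measure set (borel_rV n) -> \bar R}).

Definition lebesgue_cons : set (borel_rV n.+1) -> \bar R :=
  pushforward (lebesgue_measure \x m)%E (@cons_rV n).

Let mcons (A : set (borel_rV n.+1)) :
  measurable A -> measurable (@cons_rV n @^-1` A).
Proof.
by move=> mA; rewrite -[X in measurable X]setTI; exact: measurable_cons_rV.
Qed.

Let lebesgue_cons0 : lebesgue_cons set0 = 0%E.
Proof. by rewrite /lebesgue_cons /pushforward preimage_set0 measure0. Qed.

Let lebesgue_cons_ge0 A : (0 <= lebesgue_cons A)%E.
Proof. exact: (measure_ge0 (lebesgue_measure \x m)%E). Qed.

Let lebesgue_cons_additive : semi_sigma_additive lebesgue_cons.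
Proof.
move=> F mF tF mUF; rewrite /lebesgue_cons /pushforward preimage_bigcup.
apply: measure_semi_sigma_additive.
- by move=> k; exact: mcons.
- apply/trivIsetP => /= i j _ _ ij; rewrite -preimage_setI.
  by move/trivIsetP : tF => /(_ _ _ _ _ ij) ->//; rewrite preimage_set0.
- by rewrite -preimage_bigcup; exact: mcons.
Qed.

HB.instance Definition _ := isMeasure.Build _ _ _ lebesgue_cons
  lebesgue_cons0 lebesgue_cons_ge0 lebesgue_cons_additive.

Let lebesgue_cons_sigma_finite : sigma_finite setT lebesgue_cons.
Proof.
have /sigma_finiteP[F [FT ndF Foo]] := sigma_finiteT (@lebesgue_measure R).
have /sigma_finiteP[G [GT ndG Goo]] := sigma_finiteT m.
exists (fun k => @uncons_rV n @^-1` (F k `*` G k)).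
  rewrite -preimage_bigcup [X in _ @^-1` X](_ : _ = setT) ?preimage_setT//.
  apply/seteqP; split=> // -[x y] _.
  have [k _ Fkx] : (\bigcup_k F k) x by rewrite -FT.
  have [l _ Gly] : (\bigcup_k G k) y by rewrite -GT.
  exists (maxn k l) => //; split => /=.
  - by move: x Fkx; exact/subsetPset/ndF/leq_maxl.
  - by move: y Gly; exact/subsetPset/ndG/leq_maxr.
move=> k; have [mF Fkoo] := Foo k; have [mG Gkoo] := Goo k; split.
  rewrite -[X in measurable X]setTI.
  by apply: measurable_uncons_rV => //; exact: measurableX.
rewrite /lebesgue_cons /pushforward.
rewrite [X in (_ X < _)%E](_ : _ = F k `*` G k); last first.
  by apply/funext => p; rewrite /preimage /mkset cons_rVK.
by rewrite product_measure1E// lte_mul_pinfty// ge0_fin_numE.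
Qed.

HB.instance Definition _ := Measure_isSigmaFinite.Build _ _ _ lebesgue_cons
  lebesgue_cons_sigma_finite.

End lebesgue_cons.

Fixpoint lebesgue_borel_rV (n : nat) :
    {sigma_finite_measure set (borel_rV n) -> \bar R} :=
  match n with
  | 0 => \d_((0 : 'rV[R]_0) : borel_rV 0)
  | k.+1 => lebesgue_cons (lebesgue_borel_rV k)
  end.

Definition lebesgue_rV_type (n : nat) : measurableType _ :=
  caratheodory_type (lebesgue_borel_rV n)^*%mu.

Definition lebesgue_rV (n : nat) :
    {measure set (lebesgue_rV_type n) -> \bar R} :=
  @completed_measure_extension _ _ _ (lebesgue_borel_rV n).

End lebesgue_measure_rV.

Section oscillatory_integrals.
Context (R : realType) (n : nat).
Implicit Types (x l : 'rV[R]_n) (f g : 'rV[R]_n -> R) (phi : 'rV[R]_n -> R[i]).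

Local Notation mu := (lebesgue_rV R n).

Definition lebesgue_measurable f : Prop :=
  measurable_fun (setT : set (lebesgue_rV_type R n)) f.

Definition locally_integrable_rV g : Prop :=
  lebesgue_measurable g /\
  forall K : set 'rV[R]_n, compact K -> (\int[mu]_(x in K) `|g x|%:E < +oo)%E.

Definition enorm x : R := Num.sqrt (\sum_(i < n) x 0 i ^+ 2).

Definition cube : set 'rV[R]_n := [set x | forall i, -1 <= x 0 i <= 1].

(* g \in L^p([-1,1]^n), for 1 <= p <= +oo *)
Definition Lp_cube (p : \bar R) g : Prop :=
  lebesgue_measurable (fun x => g x * \1_cube x) /\
  finite_norm mu p (fun x : lebesgue_rV_type R n => g x * \1_cube x).

Variable a : 'I_n -> R.

Definition dilation (t : R) x : 'rV[R]_n :=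
  \row_(i < n) (t `^ (a i)^-1 * x 0 i).

Definition mixed_homogeneous f : Prop :=
  forall (t : R) x, 0 < t -> f (dilation t x) = t * f x.

Definition mixed_homogeneous_away0 (rho : R) g : Prop :=
  forall (t : R) x, 0 < t -> x != 0 -> g (dilation t x) = t `^ rho * g x.

Definition distinct_values : nat := size (undup (codom a)).

Definition C1_pos (h : R -> R) : Prop :=
  forall t : R, 0 < t -> derivable h t 1 /\ {for t, continuous (derive1 h)}.

Definition orbit_re phi x (t : R) : R := complex.Re (phi (dilation t x)).
Definition orbit_im phi x (t : R) : R := complex.Im (phi (dilation t x)).

(* sum_i (x_i / a_i) d(phi)/d(x_i), read as the derivative at t = 1 of
   t |-> phi (dilation t x) *)
Definition euler_deriv phi x : R[i] :=
  (derive1 (orbit_re phi x) 1 +i* derive1 (orbit_im phi x) 1)%C.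

Definition cintegrable phi : Prop :=
  mu.-integrable setT (fun x => (complex.Re (phi x))%:E) /\
  mu.-integrable setT (fun x => (complex.Im (phi x))%:E).

Definition cintegral phi : R[i] :=
  ((\int[mu]_x complex.Re (phi x)) +i* (\int[mu]_x complex.Im (phi x)))%C.

Definition admissible g phi : Prop :=
  [/\ cintegrable phi,
      forall x, 1 < enorm x -> phi x = 0,
      forall x, x != 0 -> C1_pos (orbit_re phi x) /\ C1_pos (orbit_im phi x),
      forall x, x != 0 -> normc (phi x) <= g x
    & forall x, x != 0 -> normc (euler_deriv phi x) <= g x].

Definition expi (theta : R) : R[i] := (cos theta +i* sin theta)%C.

Definition osc_integral f phi (l0 : R) l : R[i] :=
  cintegral (fun x => expi (l0 * f x + \sum_(i < n) l 0 i * x 0 i) * phi x).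

Definition mu_g g (A : set 'rV[R]_n) : \bar R :=
  (\int[mu]_(x in A) `|g x|%:E)%E.

Definition sublevel_growth f g (eps : R) : Prop :=
  exists2 B : R, 0 < B & forall t : R, 0 < t ->
    (mu_g g (cube `&` [set x | (`|f x| < t)%R]) <= (B * t `^ eps)%:E)%E.

(* With eps = 0 the condition always holds for locally integrable g; admitting
   it gives the supremum of the positive exponents, and 0 if there are none. *)
Definition growth_sup f g : \bar R :=
  ereal_sup [set eps%:E | eps in
    [set eps : R | 0 <= eps /\ sublevel_growth f g eps]].

End oscillatory_integrals.

(* Main.v *)
(* The dilations delta_s x = (e^(s/a_i) x_i) scale Lebesgue measure by e^(Qs) with
   Q = sum_i 1/a_i, so an integral over R^n is the average over s in [0,1] of its
   pullbacks by delta_s, and Fubini leaves for each x an integral over the orbit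
   s |-> delta_s x. By homogeneity the phase on an orbit is
     l0 f(x) e^s + sum_y L_y(x) e^(ys),
   where y runs over the v distinct values of 1/a_i (none equal to 1) and L_y(x)
   is the sum of the l_i x_i with 1/a_i = y. Some derivative of order at most v+1
   of such an exponential sum is at least comparable to its largest coefficient,
   so by van der Corput the orbit integral is
     O(g(x) (1 + |l0 f(x)| + sum_y |L_y(x)|)^(-1/(v+1))),
   with v in place of v+1 when l0 = 0. Keeping only |l0 f(x)| and integrating over
   the layers of f gives (a); keeping one |L_y(x)|, whose sublevel sets in the cube
   have measure O(t/|l_i|), and using Hoelder's inequality gives (b) and (c).
   For the converse take phi = c g(x) (1 - |x|^2)_+^2. Summing Re T(j - k, 0) over
   0 <= j, k < N gives the integral of phi |sum_(j < N) e^(ijf)|^2, which is at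
   least N^2/4 times the phi-mass of {|f| < 1/N}; by homogeneity this mass
   controls mu_g on the part of the cube where |f| < 1/N. *)

From HB Require Import structures.
Require Import Defs.
From mathcomp Require Import all_boot all_order all_algebra.
From mathcomp Require Import complex ring lra zify.
From mathcomp Require Import all_classical all_reals all_analysis.
From mathcomp Require Import measurable_realfun ess_sup_inf.

Set Implicit Arguments.
Unset Strict Implicit.
Unset Printing Implicit Defensive.
Import Order.TTheory GRing.Theory Num.Theory.
Import numFieldNormedType.Exports.
Import ComplexField.Normc.
Local Open Scope classical_set_scope.
Local Open Scope ring_scope.

(** * van der Corput estimates for sums of exponentials *)

(** Because every [a i] is positive and different from 1, the exponents 1 and [1/a i] are nonzero
    and 1 is not among the others; this is what lets the derivatives of positive order recover every
    coefficient. Order 0 takes no part in that recovery, so a constant may be added to the phase for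
    free and sines are treated as shifted cosines. The order that is large changes from point to
    point; but each derivative is bounded by a multiple of the coefficients, so it stays large on
    intervals of a fixed length, and finitely many of these cover [0,1]. On them the first-order
    estimate can do without a monotone derivative, since the second derivative is under control.
    Averaging over s >= 0 has a purpose: the flow expands, so the orbit of a point outside the cube
    never meets the support of phi, and g is only integrated over the cube. Regularity is available
    along orbits only, so every oscillatory estimate lives on a single orbit and the transverse
    directions are seen by Fubini alone. In the converse, eta < 1 makes the row sums of (1 + |j -
    k|)^(-eta) grow like N^(1 - eta); N such rows against N^2 leave N^(-eta). *)

Section pointwise_derivatives.
Context {R : realType}.
Implicit Types (f g : R -> R) (s df dg k : R).

Lemma is_derive_addf f g s df dg : is_derive s 1 f df -> is_derive s 1 g dg ->
  is_derive s 1 (fun t => f t + g t) (df + dg).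
Proof. by move=> hf hg; exact: (is_deriveD hf hg). Qed.

Lemma is_derive_subf f g s df dg : is_derive s 1 f df -> is_derive s 1 g dg ->
  is_derive s 1 (fun t => f t - g t) (df - dg).
Proof. by move=> hf hg; exact: (is_deriveB hf hg). Qed.

Lemma is_derive_oppf f s df : is_derive s 1 f df ->
  is_derive s 1 (fun t => - f t) (- df).
Proof. by move=> hf; exact: (is_deriveN hf). Qed.

Lemma is_derive_mulf f g s df dg : is_derive s 1 f df -> is_derive s 1 g dg ->
  is_derive s 1 (fun t => f t * g t) (df * g s + f s * dg).
Proof.
move=> hf hg; apply: is_derive_eq (is_deriveM hf hg) _.
by rewrite /GRing.scale/= addrC [g s * _]mulrC.
Qed.

Lemma is_derive_mulfl f s df k : is_derive s 1 f df ->
  is_derive s 1 (fun t => k * f t) (k * df).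
Proof. by move=> hf; exact: (is_deriveZ k hf). Qed.

Lemma is_derive_sumf (I : eqType) (r : seq I) (h dh : I -> R -> R) s :
  (forall i, i \in r -> is_derive s 1 (h i) (dh i s)) ->
  is_derive s 1 (fun t => \sum_(i <- r) h i t) (\sum_(i <- r) dh i s).
Proof.
elim: r => [|i r IH] H.
  rewrite big_nil (_ : (fun _ => _) = cst 0); first exact: is_derive_cst.
  by apply/funext => t; rewrite big_nil.
rewrite big_cons (_ : (fun _ => _) = fun t => h i t + \sum_(j <- r) h j t).
  apply: is_derive_addf; first by apply: H; rewrite mem_head.
  by apply: IH => j jr; apply: H; rewrite in_cons jr orbT.
by apply/funext => t; rewrite big_cons.
Qed.

Lemma is_derive_idf s : is_derive s 1 (fun t : R => t) 1.
Proof. exact: is_derive_id. Qed.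

Lemma is_derive_invf f s df : f s != 0 -> is_derive s 1 f df ->
  is_derive s 1 (fun t => (f t)^-1) (- (df / f s ^+ 2)).
Proof.
move=> fs hf; apply: is_derive_eq (is_deriveV fs hf) _.
by rewrite /GRing.scale/= mulNr mulrC.
Qed.

Lemma is_derive_continuous f s df : is_derive s 1 f df -> {for s, continuous f}.
Proof.
by case=> h _; apply/differentiable_continuous; rewrite -derivable1_diffP.
Qed.

End pointwise_derivatives.

Section van_der_corput.
Context {R : realType}.
Implicit Types (F dF : R -> R) (a b s : R).

Lemma is_derive_ge0_le F dF a b : a <= b ->
  (forall s, a <= s <= b -> is_derive s 1 F (dF s)) ->
  (forall s, a <= s <= b -> 0 <= dF s) -> F a <= F b.
Proof.
move=> ab dF_F dF0.
have [|s|c cab E] := @MVT_segment _ F dF _ _ ab.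
- by move=> s; rewrite in_itv/= => /andP[/ltW s1 /ltW s2]; apply: dF_F; rewrite s1.
- apply: derivable_within_continuous => {}s; rewrite in_itv/= => /dF_F.
  by case.
- by rewrite -subr_ge0 E mulr_ge0 ?subr_ge0// dF0.
Qed.

(** Both [G + F] and [G - F] are nondecreasing. The increment of the majorant [G] plays the role of
    the integral of [|dF|], so the van der Corput bounds need no integration theory. *)
Lemma is_derive_norm_le F dF (G dG : R -> R) a b : a <= b ->
  (forall s, a <= s <= b -> is_derive s 1 F (dF s)) ->
  (forall s, a <= s <= b -> is_derive s 1 G (dG s)) ->
  (forall s, a <= s <= b -> `|dF s| <= dG s) ->
  `|F b - F a| <= G b - G a.
Proof.
move=> ab hF hG FG; rewrite ler_norml; apply/andP; split.
- have := @is_derive_ge0_le (G \+ F) (fun s => dG s + dF s) _ _ ab.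
  have: forall s : R, a <= s <= b -> is_derive s 1 (G \+ F) (dG s + dF s).
    by move=> s sab; apply: is_deriveD; [exact: hG|exact: hF].
  move=> /[swap] /[apply] /=; rewrite -lerBlDr => H.
  suff: G a + F a - F b <= G b by lra.
  by apply: H => s /FG; rewrite ler_norml => /andP[]; lra.
- have := @is_derive_ge0_le (G \- F) (fun s => dG s - dF s) _ _ ab.
  have: forall s : R, a <= s <= b -> is_derive s 1 (G \- F) (dG s - dF s).
    by move=> s sab; apply: is_deriveB; [exact: hG|exact: hF].
  move=> /[swap] /[apply] /=; rewrite lerBrDr => H.
  suff: G a - F a + F b <= G b by lra.
  by apply: H => s /FG; rewrite ler_norml => /andP[]; lra.
Qed.

Lemma is_derive_norm_le_cst F dF (M : R) a b : a <= b ->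
  (forall s, a <= s <= b -> is_derive s 1 F (dF s)) ->
  (forall s, a <= s <= b -> `|dF s| <= M) ->
  `|F b - F a| <= M * (b - a).
Proof.
move=> ab hF FM; rewrite mulrBr.
apply: (@is_derive_norm_le _ _ (fun s => M * s) (fun=> M) _ _ ab hF) => // s _.
by apply: is_derive_eq (is_derive_mulfl M (is_derive_idf s)) _; rewrite mulr1.
Qed.

Implicit Types (p : nat -> R -> R) (A : R -> R).

(** The phase is carried along with all its derivatives, so an argument on [p l] and [p l.+1] does
    not depend on the order [l]. *)
Definition derive_chain p := forall l s, is_derive s 1 (p l) (p l.+1 s).

(** An oscillatory integral is encoded as an increment of a primitive [A] of the cosine of the
    phase: cutting the interval is then mere telescoping. *)
Definition osc_primitive p A a b :=
  forall s, a <= s <= b -> is_derive s 1 A (cos (p 0 s)).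

Lemma derive_chainN p : derive_chain p -> derive_chain (fun l s => - p l s).
Proof. by move=> hp l s; apply: is_derive_oppf. Qed.

Lemma osc_primitiveN p A a b : osc_primitive p A a b ->
  osc_primitive (fun l s => - p l s) A a b.
Proof. by move=> hA s /hA; rewrite cosN. Qed.

Lemma osc_primitive_sub p A a b c d : a <= c -> d <= b ->
  osc_primitive p A a b -> osc_primitive p A c d.
Proof.
by move=> ac db hA s /andP[cs sd]; apply: hA; rewrite (le_trans ac)//= (le_trans sd).
Qed.

Lemma osc_primitive_le p A a b : a <= b -> osc_primitive p A a b ->
  `|A b - A a| <= b - a.
Proof.
move=> ab hA; rewrite -[leRHS]mul1r; apply: is_derive_norm_le_cst ab hA _ => s _.
by rewrite ler_norml cos_geN1 cos_le1.
Qed.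

(* Integration by parts: [A - sin p0 / p1] has derivative [sin p0 * p2 / p1^2]. *)
Lemma van_der_corput1_var p A (G dG : R -> R) a b (lam : R) :
  derive_chain p -> osc_primitive p A a b -> a <= b -> 0 < lam ->
  (forall s, a <= s <= b -> lam <= p 1 s) ->
  (forall s, a <= s <= b -> is_derive s 1 G (dG s)) ->
  (forall s, a <= s <= b -> `|p 2 s| / p 1 s ^+ 2 <= dG s) ->
  `|A b - A a| <= 2 / lam + (G b - G a).
Proof.
move=> hp hA ab lam0 p1 hG GdG.
pose B s := A s - sin (p 0 s) * (p 1 s)^-1.
have p1_gt0 s : a <= s <= b -> 0 < p 1 s by move=> /p1; exact: lt_le_trans.
have hB s : a <= s <= b -> is_derive s 1 B (sin (p 0 s) * (p 2 s / p 1 s ^+ 2)).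
  move=> sab; have ? : p 1 s != 0 by rewrite gt_eqF// p1_gt0.
  have := hA s sab; have := hp 0 s; have := hp 1 s => h1 h0 hAs.
  have hs : is_derive s 1 (fun s => sin (p 0 s)) (cos (p 0 s) * p 1 s).
    exact: (@is_derive1_comp _ sin (p 0) s).
  have hi := is_derive_invf (lt0r_neq0 (p1_gt0 _ sab)) h1.
  apply: (@is_derive_eq _ _ _ _ _ _ _ _ (is_derive_subf hAs (is_derive_mulf hs hi))).
  by field.
have : `|B b - B a| <= G b - G a.
  apply: is_derive_norm_le ab hB hG _ => s sab; apply: le_trans (GdG s sab).
  rewrite normrM normrM normfV (ger0_norm (sqr_ge0 _)) ler_piMl//.
    by rewrite divr_ge0// sqr_ge0.
  by rewrite ler_norml sin_geN1 sin_le1.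
have sp s : a <= s <= b -> `|sin (p 0 s) * (p 1 s)^-1| <= lam^-1.
  move=> sab; rewrite normrM normfV -[leRHS]mul1r ler_pM//.
    by rewrite ler_norml sin_geN1 sin_le1.
  by rewrite gtr0_norm ?p1_gt0// lef_pV2 ?posrE ?p1_gt0// p1.
have := sp _ (_ : a <= a <= b); have := sp _ (_ : a <= b <= b).
rewrite !lexx ab => /(_ isT) + /(_ isT); rewrite /B !ler_norml => /andP[? ?] /andP[? ?] /andP[? ?].
by apply/andP; split; lra.
Qed.

(** First-order estimate without a monotone derivative: the error term is harmless on an interval
    short enough that [M * (b - a)] is at most [lam]. *)
Lemma van_der_corput1 p A a b (lam M : R) :
  derive_chain p -> osc_primitive p A a b -> a <= b -> 0 < lam ->
  (forall s, a <= s <= b -> lam <= p 1 s) ->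
  (forall s, a <= s <= b -> `|p 2 s| <= M) ->
  `|A b - A a| <= 2 / lam + M / lam ^+ 2 * (b - a).
Proof.
move=> hp hA ab lam0 p1 p2; rewrite mulrBr.
apply: (@van_der_corput1_var _ _ (fun s => M / lam ^+ 2 * s) (fun=> M / lam ^+ 2) _ _ _ hp hA) => // s sab.
  by apply: is_derive_eq (is_derive_mulfl _ (is_derive_idf s)) _; rewrite mulr1.
have := p1 s sab; have := p2 s sab => hM hl.
apply: ler_pM => //; first by rewrite invr_ge0 sqr_ge0.
by rewrite lef_pV2 ?posrE ?exprn_gt0// ?(lt_le_trans lam0)// lerXn2r ?nnegrE// ltW// (lt_le_trans lam0).
Qed.

(** When [p 2] keeps its sign, [|p 2| / (p 1)^2] is up to sign the derivative of [1 / p 1], which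
    varies by at most [1 / lam]. *)
Lemma van_der_corput1_mono p A a b (lam : R) :
  derive_chain p -> osc_primitive p A a b -> a <= b -> 0 < lam ->
  (forall s, a <= s <= b -> lam <= p 1 s) ->
  (forall s, a <= s <= b -> 0 <= p 2 s) \/ (forall s, a <= s <= b -> p 2 s <= 0) ->
  `|A b - A a| <= 4 / lam.
Proof.
move=> hp hA ab lam0 p1 p2.
have p1_gt0 s : a <= s <= b -> 0 < p 1 s by move=> /p1; exact: lt_le_trans.
have hi s : a <= s <= b -> is_derive s 1 (fun s => (p 1 s)^-1) (- (p 2 s / p 1 s ^+ 2)).
  by move=> sab; exact: is_derive_invf (lt0r_neq0 (p1_gt0 _ sab)) (hp 1 s).
have bnd s : a <= s <= b -> 0 <= (p 1 s)^-1 <= lam^-1.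
  move=> sab; have := p1_gt0 _ sab => p0; rewrite invr_ge0 ltW//=.
  by rewrite lef_pV2 ?posrE// p1.
have /andP[a1 a2] : 0 <= (p 1 a)^-1 <= lam^-1 by apply: bnd; rewrite lexx ab.
have /andP[b1 b2] : 0 <= (p 1 b)^-1 <= lam^-1 by apply: bnd; rewrite lexx ab.
have: exists2 G : R -> R, `|G b - G a| <= 2 / lam &
    forall s, a <= s <= b -> is_derive s 1 G (`|p 2 s| / p 1 s ^+ 2).
  case: p2 => p2.
    exists (fun s => - (p 1 s)^-1).
      by rewrite ler_norml; apply/andP; split; lra.
    move=> s sab; rewrite ger0_norm ?p2//.
    by rewrite -[X in is_derive _ _ _ X]opprK; apply: is_derive_oppf; exact: hi.
  exists (fun s => (p 1 s)^-1).
    by rewrite ler_norml; apply/andP; split; lra.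
  by move=> s sab; rewrite ler0_norm ?p2// mulNr; exact: hi.
move=> [G Gle hG].
have := van_der_corput1_var hp hA ab lam0 p1 hG (fun _ _ => lexx _).
by move: Gle; rewrite ler_norml => /andP[]; lra.
Qed.

Lemma derive_chain_continuous p l : derive_chain p -> continuous (p l).
Proof. by move=> hp s; exact: is_derive_continuous (hp l s). Qed.

Lemma derive_chain_growth p l a b (lam : R) : derive_chain p -> a <= b ->
  (forall s, a <= s <= b -> lam <= p l.+1 s) ->
  lam * (b - a) <= p l b - p l a.
Proof.
move=> hp ab pl.
have := @is_derive_ge0_le (fun s => p l s - lam * s) (fun s => p l.+1 s - lam) _ _ ab.
suff H s : is_derive s 1 (fun s => p l s - lam * s) (p l.+1 s - lam).
  move=> /(_ (fun s _ => H s)) => {}H; suff: p l a - lam * a <= p l b - lam * b by lra.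
  by apply: H => s /pl; rewrite subr_ge0.
apply: is_derive_subf => //.
by apply: is_derive_eq (is_derive_mulfl _ (is_derive_idf s)) _; rewrite mulr1.
Qed.

(** [p l] increases at rate at least [lam]. The point [c] is its zero, or the endpoint nearest to
    where the zero would be if [p l] does not vanish on the interval. *)
Lemma derive_chain_turning_point p l a b (lam : R) : derive_chain p -> a <= b ->
  0 <= lam -> (forall s, a <= s <= b -> lam <= p l.+1 s) ->
  exists2 c, a <= c <= b & forall s, a <= s <= b ->
    (c < s -> lam * (s - c) <= p l s) /\ (s < c -> p l s <= - (lam * (c - s))).
Proof.
move=> hp ab lam0 pl.
have gr u w : a <= u -> u <= w -> w <= b -> lam * (w - u) <= p l w - p l u.
  move=> au uw wb; apply: derive_chain_growth => // s /andP[us sw].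
  by apply: pl; rewrite (le_trans au us) (le_trans sw wb).
have [pa|pa] := leP 0 (p l a).
  exists a; first by rewrite lexx ab.
  move=> s /andP[as_ sb]; split=> h; last by lra.
  by have := gr a s (lexx _) (ltW h) sb; lra.
have [pb|pb] := leP (p l b) 0.
  exists b; first by rewrite lexx ab.
  move=> s /andP[as_ sb]; split=> h; first by lra.
  by have := gr s b as_ (ltW h) (lexx _); lra.
have [||c] := @IVT R (p l) a b 0 ab; first exact/continuous_subspaceT/derive_chain_continuous.
  by rewrite ge_min le_max (ltW pa) (ltW pb) orbT.
rewrite in_itv/= => /andP[ac cb] pc; exists c; first by rewrite ac cb.
move=> s /andP[as_ sb]; split=> h.
  by have := gr c s ac (ltW h) sb; rewrite pc; lra.
by have := gr s c as_ (ltW h) cb; rewrite pc; lra.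
Qed.

(** With [mono] set, [p l.+1] must keep its sign. Order 1 fails without this; in the passage from
    [l] to [l.+1] it is automatic, because the lower bound on [p l.+1] fixes its sign. *)
Definition osc_order (l : nat) (C : R) (mono : bool) := forall p A a b (lam : R),
  derive_chain p -> osc_primitive p A a b -> a <= b -> 0 < lam ->
  (forall s, a <= s <= b -> lam <= p l s) \/
    (forall s, a <= s <= b -> p l s <= - lam) ->
  (mono -> (forall s, a <= s <= b -> 0 <= p l.+1 s) \/
    (forall s, a <= s <= b -> p l.+1 s <= 0)) ->
  `|A b - A a| <= C * lam `^ (- l%:R^-1).

Lemma osc_order1 : osc_order 1 4 true.
Proof.
move=> p A a b lam hp hA ab lam0 p1 /(_ isT) p2.
rewrite invr1 powR_inv1 ?(ltW lam0)//.
case: p1 => p1; first exact: van_der_corput1_mono hp hA ab lam0 p1 p2.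
apply: (van_der_corput1_mono (derive_chainN hp) (osc_primitiveN hA)) => //.
  by move=> s /p1; rewrite lerNr.
by case: p2 => p2; [right|left] => s /p2; rewrite ?oppr_le0 ?oppr_ge0.
Qed.

(** Remove the window of radius [d = lam^(-1/(l+1))] around the turning point. Outside it [|p l|] is
    at least [lam * d], and [(lam * d)^(-1/l) = d]; inside, the trivial bound is [2 * d]. The two
    sides and the window give [2 * C + 2]. *)
Lemma osc_orderS l C : (0 < l)%N -> 0 <= C ->
  osc_order l C true -> osc_order l.+1 (2 * C + 2) false.
Proof.
move=> l0 C0 IH p A a b lam hp hA ab lam0 pl _.
(* The cosine is even, so the phase may be negated with the same primitive. *)
wlog : p hp hA pl / forall s, a <= s <= b -> lam <= p l.+1 s.
  move=> W; case: (pl) => pl'; first exact: (W p).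
  apply: (W (fun l s => - p l s)) (derive_chainN hp) (osc_primitiveN hA) _ _.
    by left => s /pl'; rewrite lerNr.
  by move=> s /pl'; rewrite lerNr.
move=> {}pl.
have [c /andP[ac cb] hc] := derive_chain_turning_point hp ab (ltW lam0) pl.
pose d := lam `^ (- l.+1%:R^-1).
have d0 : 0 < d by exact: powR_gt0.
have lamd : (lam * d) `^ (- l%:R^-1) = d.
  rewrite /d -{1}(powRr1 (ltW lam0)) -powRD; last by rewrite (gt_eqF lam0) implybT.
  rewrite -powRrM; congr (_ `^ _).
  have : l%:R != 0 :> R by rewrite pnatr_eq0 -lt0n.
  rewrite -natr1 => l0'; have : l%:R + 1 != 0 :> R by rewrite natr1 pnatr_eq0.
  by move=> ?; field; apply/andP.
have sgn s : a <= s <= b -> 0 <= p l.+1 s by move=> /pl; apply/le_trans/ltW.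
have L : `|A (Num.max a (c - d)) - A a| <= C * d.
  have [h|h] := leP a (c - d); last by rewrite subrr normr0 mulr_ge0// ltW.
  rewrite -[X in _ <= C * X]lamd; apply: (IH p _ _ _ _ hp) => //.
  - by apply: osc_primitive_sub hA => //; lra.
  - by rewrite mulr_gt0.
  - right => s /andP[s1 s2].
    have [|_ /(_ _)] := hc s; first by apply/andP; split; lra.
    move=> H; apply: (le_trans (H _)); first by lra.
    by rewrite lerN2 ler_pM2l//; lra.
  - by left => s /andP[s1 s2]; apply: sgn; apply/andP; split; lra.
have U : `|A b - A (Num.min b (c + d))| <= C * d.
  have [h|h] := leP b (c + d); first by rewrite subrr normr0 mulr_ge0// ltW.
  rewrite -lamd; apply: (IH p) => //; last 3 first.
  - by rewrite mulr_gt0.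
  - left => s /andP[s1 s2].
    have [|/(_ _) H _] := hc s; first by apply/andP; split; lra.
    apply: (le_trans _ (H _)); last by lra.
    by rewrite ler_pM2l//; lra.
  - by left => s /andP[s1 s2]; apply: sgn; apply/andP; split; lra.
  - by apply: osc_primitive_sub hA => //; lra.
  - by lra.
have au : a <= Num.max a (c - d) by rewrite le_max lexx.
have ub : Num.min b (c + d) <= b by rewrite ge_min lexx.
have uc : Num.max a (c - d) <= c by rewrite ge_max ac/=; lra.
have cu : c <= Num.min b (c + d) by rewrite le_min cb/=; lra.
have M : `|A (Num.min b (c + d)) - A (Num.max a (c - d))| <= 2 * d.
  apply: le_trans (osc_primitive_le (le_trans uc cu) (osc_primitive_sub au ub hA)) _.
  have : c - d <= Num.max a (c - d) by rewrite le_max lexx orbT.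
  have : Num.min b (c + d) <= c + d by rewrite ge_min lexx orbT.
  by lra.
rewrite (_ : A b - A a = (A b - A (Num.min b (c + d))) +
  (A (Num.min b (c + d)) - A (Num.max a (c - d))) + (A (Num.max a (c - d)) - A a)); last by ring.
rewrite -/d (_ : (2 * C + 2) * d = C * d + 2 * d + C * d); last by ring.
apply: le_trans (ler_normD _ _) _.
by have := ler_normD (A b - A (Num.min b (c + d))) (A (Num.min b (c + d)) - A (Num.max a (c - d))); lra.
Qed.

Lemma osc_order_exists l : exists2 C : R, 0 <= C &
  osc_order l.+1 C true /\ ((0 < l)%N -> osc_order l.+1 C false).
Proof.
elim: l => [|l [C C0 [IH _]]]; first by exists 4 => //; split=> //; exact: osc_order1.
exists (2 * C + 2); first by lra.
have H := osc_orderS (ltn0Sn l) C0 IH; split=> //.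
by move=> p A a b lam hp hA ab lam0 pl _; exact: (H p).
Qed.

Lemma osc_order_uniform k : exists2 C : R, 0 <= C &
  forall l, (1 < l <= k)%N -> osc_order l C false.
Proof.
elim: k => [|k [C C0 IH]]; first by exists 0 => // -[|[]].
have [D D0 [_ HD]] := osc_order_exists k.
exists (C + D); first exact: addr_ge0.
move=> l; rewrite [(l <= _)%N]leq_eqVlt => /andP[l1 /orP[/eqP lk|lk]] p A a b lam hp hA ab lam0 pl m.
  apply: le_trans (_ : D * lam `^ (- l%:R^-1) <= _).
    by rewrite lk in pl m l1 *; exact: (HD l1 p).
  by rewrite ler_wpM2r ?powR_ge0// lerDr.
apply: le_trans (_ : C * lam `^ (- l%:R^-1) <= _).
  by apply: (IH l _ p) => //; rewrite l1.
by rewrite ler_wpM2r ?powR_ge0// lerDl.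
Qed.

(** The constant [theta] survives at order 0 only; taking it to be [- pi / 2] turns the cosine into
    a sine. *)
Definition expsum (al : seq R) (c : R -> R) (theta : R) (l : nat) (s : R) : R :=
  (if l is 0%N then theta else 0) + \sum_(x <- al) c x * x ^+ l * expR (x * s).

Lemma expsum_derive_chain al c theta : derive_chain (expsum al c theta).
Proof.
move=> l s; rewrite /expsum.
apply: is_derive_addf.
apply: (@is_derive_sumf _ _ al (fun x t => c x * x ^+ l * expR (x * t))
  (fun x t => c x * x ^+ l.+1 * expR (x * t))) => x _.
have h : is_derive s 1 (fun t => expR (x * t)) (expR (x * s) * x).
  apply: (@is_derive1_comp _ expR (fun t => x * t)).
  by apply: is_derive_eq (is_derive_mulfl _ (is_derive_idf s)) _; rewrite mulr1.
by apply: is_derive_eq (is_derive_mulfl _ h) _; rewrite exprSr; ring.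
Qed.

(* The polynomial [X * prod_(y != x) (X - y)] in the exponents isolates the
   coefficient of [exp (x s)] from the derivatives of orders 1 .. size al. *)
Lemma expsum_coef_le (al : seq R) x : uniq al -> 0 \notin al -> x \in al ->
  exists2 K : R, 0 < K & forall (c : R -> R) (theta s m : R), 0 <= s <= 1 ->
    (forall l, (0 < l <= size al)%N -> `|expsum al c theta l s| <= m) ->
    `|c x| <= K * m.
Proof.
move=> ual al0 xal.
pose L : {poly R} := 'X * \prod_(y <- rem x al) ('X - y%:P).
have Ly y : y \in al -> y != x -> L.[y] = 0.
  move=> yal yx; apply/eqP; rewrite hornerM mulf_eq0; apply/orP; right.
  by rewrite -rootE root_prod_XsubC mem_rem_uniq// inE yx.
have Lx : L.[x] != 0.
  rewrite hornerM mulf_neq0//; first by rewrite hornerX; apply: contraNneq al0 => <-.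
  by rewrite -rootE root_prod_XsubC mem_rem_uniq// inE eqxx.
have sL : size L = (size al).+1.
  rewrite /L mulrC size_mulX ?monic_neq0 ?monic_prod_XsubC// size_prod_XsubC size_rem//.
  by case: (al) xal.
(* [expR |x|] compensates the factor [exp (x s)], which is at least [exp (- |x|)] for [s] in
   [0,1]. *)
pose K := expR `|x| / `|L.[x]| * (\sum_(i < (size al).+1) `|L`_i|).
exists (K + 1); first by rewrite ltr_wpDl// mulr_ge0 ?sumr_ge0// divr_ge0 ?expR_ge0.
move=> c theta s m /andP[s0 s1] pm.
have m0 : 0 <= m.
  by apply: le_trans (pm 1%N _) => //; case: (al) xal.
have E : c x * expR (x * s) * L.[x] = \sum_(i < (size al).+1) L`_i * expsum al c theta i s.
  transitivity (\sum_(y <- al) c y * expR (y * s) * L.[y]).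
    rewrite (bigD1_seq x)//= big1_seq ?addr0// => y /andP[yx yal].
    by rewrite Ly// mulr0.
  rewrite big_ord_recl {2}/L coefXM/= mul0r add0r.
  under eq_bigr do rewrite horner_coef sL big_ord_recl {1}/L coefXM/= mul0r add0r mulr_sumr.
  rewrite exchange_big/=; apply: eq_bigr => i _.
  rewrite /expsum/= add0r mulr_sumr; apply: eq_bigr => y _; ring.
have B : `|c x| * expR (x * s) * `|L.[x]| <= (\sum_(i < (size al).+1) `|L`_i|) * m.
  rewrite -[expR _]ger0_norm ?expR_ge0// -!normrM E.
  apply: le_trans (ler_norm_sum _ _ _) _; rewrite mulr_suml; apply: ler_sum => i _.
  rewrite normrM; have [->|i0] := posnP i; first by rewrite /L coefXM/= normr0 !mul0r.
  by rewrite ler_wpM2l// pm// i0/= -ltnS.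
have ex : 1 <= expR `|x| * expR (x * s).
  rewrite -expRD -expR0 ler_expR.
  have : - `|x| <= x * s; last by lra.
  rewrite lerNl; apply: le_trans (ler_norm _) _; rewrite normrN normrM.
  by rewrite (ger0_norm s0) ler_piMr.
apply: le_trans (_ : K * m <= _); last by rewrite ler_wpM2r// lerDl.
have Lx0 : 0 < `|L.[x]| by rewrite normr_gt0.
apply: le_trans (_ : expR `|x| * (`|c x| * expR (x * s)) <= _).
  by rewrite mulrCA ler_peMr//.
have -> : K * m = expR `|x| * ((\sum_(i < (size al).+1) `|L`_i|) * m / `|L.[x]|).
  by rewrite /K; ring.
by rewrite ler_wpM2l ?expR_ge0// ler_pdivlMr.
Qed.

(** The absolute value of [m] covers the empty [al], for which the hypothesis on [m] is vacuous and
    [m] may be negative. *)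
Lemma expsum_coefs_le (al : seq R) : uniq al -> 0 \notin al ->
  exists2 K : R, 0 < K & forall (c : R -> R) (theta s m : R), 0 <= s <= 1 ->
    (forall l, (0 < l <= size al)%N -> `|expsum al c theta l s| <= m) ->
    \sum_(x <- al) `|c x| <= K * `|m|.
Proof.
move=> ual al0.
suff H (r : seq R) : {subset r <= al} -> exists2 K : R, 0 < K & forall (c : R -> R) (theta s m : R), 0 <= s <= 1 ->
    (forall l, (0 < l <= size al)%N -> `|expsum al c theta l s| <= m) ->
    \sum_(x <- r) `|c x| <= K * `|m| by exact: H.
elim: r => [_|x r IH sub].
  by exists 1 => // c theta s m _ _; rewrite big_nil mul1r.
have [K K0 HK] := IH (fun y yr => sub y (@mem_behead _ (x :: r) y yr)).
have [K' K'0 HK'] := expsum_coef_le ual al0 (sub x (mem_head _ _)).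
exists (K' + K); first exact: addr_gt0.
move=> c theta s m s01 pm; rewrite big_cons mulrDl lerD//; last exact: (HK c theta s).
by apply: le_trans (HK' c theta s m s01 pm) _; rewrite ler_wpM2l ?ler_norm// ltW.
Qed.

Lemma expsum_le (al : seq R) n : exists2 K : R, 0 < K & forall (c : R -> R) (theta s : R) l, 0 <= s <= 1 ->
  (0 < l <= n)%N -> `|expsum al c theta l s| <= K * \sum_(x <- al) `|c x|.
Proof.
pose M := 1 + \sum_(y <- al) `|y|.
have M1 : 1 <= M by rewrite lerDl sumr_ge0.
exists (M ^+ n * expR M); first by rewrite mulr_gt0 ?expR_gt0// exprn_gt0// (lt_le_trans ltr01).
move=> c theta s [//|l] /andP[s0 s1] ln; rewrite /expsum add0r.
apply: le_trans (ler_norm_sum _ _ _) _; rewrite mulr_sumr !big_seq; apply: ler_sum => x xal.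
have xM : `|x| <= M.
  by rewrite /M (big_rem x xal)/= addrCA lerDl addr_ge0// sumr_ge0.
rewrite !normrM -mulrA mulrC ler_wpM2r// ler_pM//.
  rewrite normrX; apply: le_trans (_ : M ^+ l.+1 <= _); last by rewrite ler_weXn2l.
  by rewrite lerXn2r ?nnegrE// (le_trans _ xM).
rewrite ger0_norm ?expR_ge0// ler_expR; apply: le_trans (ler_norm _) _.
by rewrite normrM (ger0_norm s0) -[leRHS]mulr1 ler_pM.
Qed.

(** Comparable bases give comparable powers; the loss [M^k] is at most [M] because [k] is at most
    1. *)
Lemma powR_shift_le (x y M k : R) : 0 < x -> 0 <= y -> 1 <= M -> 0 <= k <= 1 ->
  1 + y <= M * x -> x `^ (- k) <= M * (1 + y) `^ (- k).
Proof.
move=> x0 y0 M1 /andP[k0 k1] yM.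
have M0 : 0 < M by exact: lt_le_trans M1.
have h : (M * x) `^ (- k) <= (1 + y) `^ (- k).
  have y1 : 0 < 1 + y by lra.
  rewrite !powRN lef_pV2 ?posrE; [|exact/powR_gt0/mulr_gt0|exact: powR_gt0].
  by apply: ge0_ler_powR => //; rewrite nnegrE; [lra|rewrite mulr_ge0// ltW].
have -> : x `^ (- k) = M `^ k * (M * x) `^ (- k).
  rewrite powRM ?(ltW M0) ?(ltW x0)// mulrA -powRD; last by rewrite (gt_eqF M0) implybT.
  by rewrite subrr powRr0 mul1r.
apply: ler_pM; rewrite ?powR_ge0//.
by rewrite -[leRHS](powRr1 (ltW M0)) ler_powR.
Qed.

(** Some order [l] has [|p l a| > 2 * lam] at the left endpoint. As [p l.+1] is bounded by the
    coefficients, [p l] moves by at most [lam] on a short interval, so it keeps its sign and stays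
    at least [lam] in size. Because [lam >= 1], the worst rate among the orders is that of the top
    order. *)
Lemma expsum_piece (al : seq R) : uniq al -> 0 \notin al -> (0 < size al)%N ->
  exists K N C : R, [/\ 0 < K, 0 < N, 0 <= C &
    forall c theta A a b (lam := (\sum_(x <- al) `|c x|) / K),
    0 <= a -> a <= b -> b <= 1 -> b - a <= N -> 1 <= lam ->
    osc_primitive (expsum al c theta) A a b ->
    `|A b - A a| <= C * lam `^ (- (size al)%:R^-1)].
Proof.
move=> ual al0 szal.
have [K1 K10 hK1] := expsum_coefs_le ual al0.
have [K2 K20 hK2] := expsum_le al (size al).+1.
have [C C0 hC] := osc_order_uniform (size al).
(* With [S = 4 * K1 * lam], all orders being at most [2 * lam] would force [S <= 2 * K1 * lam]. The
   length is chosen so that [K2 * S] times it equals [lam]. The 3 serves order 1: [2 / lam] plus an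
   error of at most [1 / lam]. *)
exists (4 * K1), ((4 * K1 * K2)^-1), (C + 3).
have K12 : 0 < 4 * K1 * K2 by rewrite !mulr_gt0.
split; [by lra|by rewrite invr_gt0|by lra|].
move=> c theta A a b lam a0 ab b1 baN lam1 hA.
pose p := expsum al c theta; pose S := \sum_(x <- al) `|c x|.
have hp : derive_chain p by exact: expsum_derive_chain.
have lam0 : 0 < lam by lra.
have SE : S = 4 * K1 * lam by rewrite /lam -/S mulrC divfK// gt_eqF//; lra.
have a01 : 0 <= a <= 1 by rewrite a0 (le_trans ab).
have [l lk la] : exists2 l, (0 < l <= size al)%N & 2 * lam < `|p l a|.
  apply: contrapT => H.
  have := hK1 c theta a (2 * lam) a01; rewrite -/S SE ger0_norm; last by lra.
  have {}H l : (0 < l <= size al)%N -> `|expsum al c theta l a| <= 2 * lam.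
    by move=> lk; rewrite leNgt; apply/negP => h; apply: H; exists l.
  move=> /(_ H); have : 0 < K1 * lam by exact: mulr_gt0.
  by lra.
have /andP[l0 lk'] := lk.
have pS l' s : (0 < l' <= (size al).+1)%N -> a <= s <= b -> `|p l' s| <= K2 * S.
  move=> hl /andP[as_ sb]; apply: hK2 => //.
  by rewrite (le_trans a0 as_) (le_trans sb b1).
have KS0 : 0 <= K2 * S by rewrite mulr_ge0 ?(ltW K20)// sumr_ge0.
have N0 : K2 * S * (b - a) <= lam.
  have -> : lam = K2 * S * (4 * K1 * K2)^-1 by rewrite SE; field; lra.
  exact: ler_wpM2l.
have dev s : a <= s <= b -> `|p l s - p l a| <= lam.
  move=> /andP[as_ sb]; apply: le_trans (_ : K2 * S * (s - a) <= _).
    apply: (@is_derive_norm_le_cst (p l) (p l.+1)) => // t /andP[at_ ts].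
    by apply: pS => //; rewrite at_ (le_trans ts sb).
  by apply: le_trans N0; rewrite ler_wpM2l ?lerB//.
have sgn : (forall s, a <= s <= b -> lam <= p l s) \/
    (forall s, a <= s <= b -> p l s <= - lam).
  move: la; rewrite ltr_normr => /orP[] la; [left|right] => s /dev;
    by rewrite ler_norml => /andP[]; lra.
have n1 : (1:R) <= (size al)%:R by rewrite ler1n.
have pw l' : (0 < l' <= size al)%N -> lam `^ (- l'%:R^-1) <= lam `^ (- (size al)%:R^-1).
  move=> /andP[l'0 l'k]; rewrite ler_powR// lerN2 lef_pV2 ?posrE ?ltr0n//.
  by rewrite ler_nat.
rewrite mulrDl; have [l1|l1] := leqP l 1; last first.
  apply: ler_wpDr; first by rewrite mulr_ge0// powR_ge0.
  apply: le_trans (_ : C * lam `^ (- l%:R^-1) <= _); last by rewrite ler_wpM2l// pw.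
  by apply: (hC l _ p) => //; rewrite l1.
have {}l1 : l = 1%N by case: (l) l0 l1 => [|[]].
apply: ler_wpDl; first by rewrite mulr_ge0// powR_ge0.
apply: le_trans (_ : 3 * lam `^ (- l%:R^-1) <= _); last by rewrite ler_wpM2l// pw.
rewrite l1 invr1 powR_inv1 ?(ltW lam0)//.
apply: le_trans (_ : 2 / lam + K2 * S / lam ^+ 2 * (b - a) <= _); last first.
  have -> : K2 * S / lam ^+ 2 * (b - a) = (K2 * S * (b - a)) / lam ^+ 2 by ring.
  have : K2 * S * (b - a) / lam ^+ 2 <= lam / lam ^+ 2.
    by rewrite ler_wpM2r// invr_ge0 sqr_ge0.
  have -> : lam / lam ^+ 2 = lam^-1 by field; lra.
  lra.
rewrite l1 in sgn; case: sgn => sgn.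
  apply: (van_der_corput1 hp hA) => // s; exact: (pS 2%N).
apply: (van_der_corput1 (derive_chainN hp) (osc_primitiveN hA)) => // s.
  by move=> /sgn; rewrite lerNr.
rewrite normrN; exact: (pS 2%N).
Qed.

(** [0,u] is cut into [n] pieces of length at most [N], with [n] depending on [al] only. If the
    coefficients are small ([lam < 1]), the trivial bound by the length of the interval is
    enough. *)
Lemma expsum_primitive_le (al : seq R) : uniq al -> 0 \notin al -> (0 < size al)%N ->
  exists2 C : R, 0 < C & forall c theta A u, 0 <= u <= 1 ->
    osc_primitive (expsum al c theta) A 0 1 ->
    `|A u - A 0| <= C * (1 + \sum_(x <- al) `|c x|) `^ (- (size al)%:R^-1).
Proof.
move=> ual al0 szal.
have [K [N [C [K0 N0 C0 H]]]] := expsum_piece ual al0 szal.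
pose n := (Num.truncn N^-1).+1.
have n0 : 0 < n%:R :> R by rewrite ltr0n.
have nN : n%:R^-1 <= N.
  by rewrite -[leRHS]invrK lef_pV2 ?posrE ?invr_gt0// ltW// truncnS_gt.
exists ((n%:R * C + 1) * (1 + K)).
  by rewrite mulr_gt0//; [rewrite ltr_wpDl// mulr_ge0// ltW|lra].
move=> c theta A u /andP[u0 u1] hA.
set S := \sum_(x <- al) _; have S0 : 0 <= S by rewrite sumr_ge0.
pose k : R := (size al)%:R^-1.
have k01 : 0 <= k <= 1.
  by rewrite invr_ge0 ler0n/= invf_le1 ?ltr0n// ler1n.
pose lam := S / K; have SE : S = K * lam by rewrite mulrC divfK// gt_eqF.
have [lam1|lam1] := leP 1 lam; last first.
  apply: le_trans (osc_primitive_le u0 (osc_primitive_sub (lexx _) u1 hA)) _.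
  rewrite subr0; apply: (le_trans u1).
  have : 1 `^ (- k) <= (1 + K) * (1 + S) `^ (- k).
    apply: powR_shift_le => //; first by lra.
    by rewrite mulr1 SE lerD2l ler_piMr// ltW.
  rewrite powR1 => h; rewrite -mulrA mulrDl mul1r.
  apply: (le_trans h); rewrite lerDr mulr_ge0 ?mulr_ge0 ?(ltW n0) ?powR_ge0//.
  by lra.
pose t i := u * i%:R / n%:R.
have step i : (i <= n)%N -> `|A (t i) - A 0| <= i%:R * (C * lam `^ (- k)).
  elim: i => [_|i IH ni]; first by rewrite /t mulr0 !mul0r subrr normr0.
  have -> : A (t i.+1) - A 0 = (A (t i.+1) - A (t i)) + (A (t i) - A 0) by ring.
  apply: le_trans (ler_normD _ _) _; rewrite -natr1 mulrDl mul1r addrC.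
  rewrite lerD ?IH ?(ltnW ni)//.
  have ti : t i.+1 - t i = u / n%:R by rewrite /t -natr1; ring.
  have ti0 j : 0 <= t j by rewrite /t !mulr_ge0// invr_ge0.
  have ti1 : t i.+1 <= 1.
    by rewrite /t ler_pdivrMr// mul1r -[leRHS]mul1r ler_pM// ler_nat.
  have tt : t i <= t i.+1 by rewrite -subr_ge0 ti divr_ge0// ltW.
  apply: (H c theta) => //.
    by rewrite ti (le_trans _ nN)// ler_piMl// invr_ge0 ltW.
  exact: osc_primitive_sub hA.
have := step n (leqnn _); rewrite {1}/t mulfK ?gt_eqF// => h; apply: (le_trans h).
rewrite mulrA; apply: le_trans (_ : (n%:R * C) * ((1 + K) * (1 + S) `^ (- k)) <= _).
  rewrite ler_wpM2l//; first by rewrite mulr_ge0 ?(ltW n0).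
  apply: powR_shift_le => //; [by lra|by lra|].
  by rewrite [leLHS]addrC [leRHS]mulrDl mul1r [leRHS]addrC -SE lerD2l.
have P0 := powR_ge0 (1 + S) (- k).
rewrite -[leRHS]mulrA ler_wpM2r//; first by rewrite mulr_ge0//; lra.
by rewrite lerDl.
Qed.

Lemma continuous_primitive (h : R -> R) : continuous h ->
  exists A : R -> R, forall s, 0 <= s <= 1 -> is_derive s 1 A (h s).
Proof.
move=> ch.
(* Starting at -1, and staying below 2 later on, makes 0 and 1 interior points, where the derivative
   has to be two-sided. *)
pose A s := (\int[lebesgue_measure]_(t in [set` `[-1, s]]) h t)%R.
exists A => s /andP[s0 s1].
have [||||dA AE] := @continuous_FTC1_closed R h (-1) s 2.
- lra.
- apply: continuous_compact_integrable; first exact: segment_compact.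
  exact/continuous_subspaceT.
- lra.
- exact: ch.
by apply: DeriveDef => //; rewrite -derive1E.
Qed.

Lemma continuous_primitive_integral (h A : R -> R) : continuous h ->
  (forall s, 0 <= s <= 1 -> is_derive s 1 A (h s)) ->
  (\int[lebesgue_measure]_(s in `[0%R, 1%R]) (h s)%:E = (A 1 - A 0)%:E)%E.
Proof.
move=> ch hA; rewrite EFinB; apply: continuous_FTC2 => //.
- exact/continuous_subspaceT.
- split.
  + move=> s; rewrite in_itv/= => /andP[/ltW s0 /ltW s1].
    by have [] := hA s; rewrite ?s0.
  + apply: cvg_at_right_filter; apply: is_derive_continuous (hA 0 _); lra.
  + apply: cvg_at_left_filter; apply: is_derive_continuous (hA 1 _); lra.
- move=> s; rewrite in_itv/= => /andP[/ltW s0 /ltW s1].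
  by rewrite derive1E; have [] := hA s; rewrite ?s0.
Qed.

(** Integration by parts against [B s = A s - A 0]: the boundary term and the integral of [B * dh]
    each cost [C * G] times the decay. The bounds on [h] and [dh] are where the two conditions on an
    admissible function enter. *)
Lemma expsum_integral_le (al : seq R) : uniq al -> 0 \notin al -> (0 < size al)%N ->
  exists2 C : R, 0 < C & forall c theta (h dh : R -> R) (G : R),
    (forall s, is_derive s 1 h (dh s)) ->
    (forall s, 0 <= s <= 1 -> `|h s| <= G) ->
    (forall s, 0 <= s <= 1 -> `|dh s| <= G) ->
    (`|\int[lebesgue_measure]_(s in `[0%R, 1%R]) (cos (expsum al c theta 0 s) * h s)%:E|
     <= (C * G * (1 + \sum_(x <- al) `|c x|) `^ (- (size al)%:R^-1))%:E)%E.
Proof.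
move=> ual al0 szal; have [C C0 HC] := expsum_primitive_le ual al0 szal.
exists (2 * C); first by rewrite mulr_gt0.
move=> c theta h dh G hh hG dhG.
set p := expsum al c theta; set P := (_ `^ _).
have hp : derive_chain p by exact: expsum_derive_chain.
have cp : continuous (fun s => cos (p 0 s)).
  move=> s; apply: is_derive_continuous; exact: (@is_derive1_comp _ cos (p 0) s).
have [A hA] := continuous_primitive cp.
have ch : continuous (fun s => cos (p 0 s) * h s).
  by move=> s; apply: continuousM; [exact: cp|exact: is_derive_continuous (hh s)].
have [J hJ] := continuous_primitive ch.
rewrite (continuous_primitive_integral ch hJ) abse_EFin lee_fin.
pose B s := A s - A 0.
have hB s : 0 <= s <= 1 -> is_derive s 1 B (cos (p 0 s)).
  move=> s01; rewrite -[X in is_derive _ _ _ X]subr0.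
  by apply: is_derive_subf; exact: hA.
have BC s : 0 <= s <= 1 -> `|B s| <= C * P by move=> s01; exact: (HC c theta A s s01 hA).
have hD s : 0 <= s <= 1 -> is_derive s 1 (fun s => J s - B s * h s) (- (B s * dh s)).
  move=> s01; apply: is_derive_eq (is_derive_subf (hJ s s01) (is_derive_mulf (hB s s01) (hh s))) _.
  by ring.
have := @is_derive_norm_le_cst _ _ (C * P * G) 0 1 ler01 hD.
have o1 : 0 <= (1 : R) <= 1 by rewrite ler01 lexx.
have B0 : B 0 = 0 by rewrite /B subrr.
have BM : `|B 1 * h 1| <= C * P * G by rewrite normrM ler_pM// ?BC ?hG.
have dM s : 0 <= s <= 1 -> `|- (B s * dh s)| <= C * P * G.
  by move=> s01; rewrite normrN normrM ler_pM// ?BC ?dhG.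
move=> /(_ dM); rewrite B0 mul0r subr0 (subr0 1) mulr1 => H.
have -> : J 1 - J 0 = (J 1 - B 1 * h 1 - J 0) + B 1 * h 1 by ring.
apply: le_trans (ler_normD _ _) _.
have -> : 2 * C * G * P = C * P * G + C * P * G by ring.
exact: lerD.
Qed.

End van_der_corput.

(** * Lebesgue measure on R^n *)

Section completion.
Context {d} {T : measurableType d} {R : realType}.
Variable mu : {sigma_finite_measure set T -> \bar R}.
Local Notation X := (caratheodory_type (mu^*)%mu).
Local Notation cmu := (@completed_measure_extension _ _ _ mu : set X -> \bar R).
Local Open Scope ereal_scope.

Lemma completion_measurable (A : set T) : measurable A -> measurable (A : set X).
Proof. exact: caratheodory_measurable_mu_ext. Qed.

Lemma completionE (A : set T) : measurable A -> cmu A = mu A.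
Proof. by move=> mA; rewrite /completed_measure_extension measurable_mu_extE. Qed.

(** The hull is a countable intersection of countable covers whose measure is within [1/(n+1)] of
    the outer measure. *)
Lemma completion_hull (E : set T) : (mu^*)%mu E < +oo ->
  exists F : set T, [/\ measurable F, E `<=` F & mu F = (mu^*)%mu E].
Proof.
move=> Eoo.
have Efin : (mu^*)%mu E \is a fin_num by rewrite ge0_fin_numE ?mu_ext_ge0.
have cov n : {F : set T | [/\ measurable F, E `<=` F &
    mu F <= (mu^*)%mu E + n.+1%:R^-1%:E]}.
  apply: cid.
  have /(lb_ereal_inf_adherent) := Efin => /(_ n.+1%:R^-1%R).
  rewrite invr_gt0 ltr0n => /(_ isT)[_ [A [mA EA] <-] h].
  exists (\bigcup_k A k); split => //; first exact: bigcupT_measurable.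
  apply: le_trans (ltW h); rewrite -measurable_mu_extE//; last exact: bigcupT_measurable.
  apply: le_trans (outer_measure_sigma_subadditive (mu^*)%mu A) _.
  apply: lee_nneseries => k; first by move=> _ _; exact: mu_ext_ge0.
  by move=> _; rewrite -(measurable_mu_extE mu (mA k)).
pose F := \bigcap_n (projT1 (cov n)).
have mF : measurable F by apply: bigcapT_measurable => k; case: (projT2 (cov k)).
have EF : E `<=` F by apply: sub_bigcap => k _; case: (projT2 (cov k)).
exists F; split => //; apply/eqP; rewrite eq_le; apply/andP; split.
  apply/lee_addgt0Pr => /= _/posnumP[e]; near \oo => n.
  apply: (@le_trans _ _ (mu (projT1 (cov n)))).
    apply: le_measure; rewrite ?inE//; first by case: (projT2 (cov n)).
    exact: bigcap_inf.
  have [_ _ h] := projT2 (cov n); apply: (le_trans h).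
  rewrite leeD// lee_fin ltW//.
  by near: n; apply: near_infty_natSinv_lt.
by rewrite -(measurable_mu_extE mu)//; exact: le_outer_measure.
Unshelve. all: by end_near. Qed.

(** For a set [G] of finite measure with hull [F], the Caratheodory condition tested on [F] makes
    [F \ G] null; if [N] is a hull of that difference, then [G \ N = F \ N]. The general case
    exhausts the space by sets of finite measure. *)
Lemma completion_measurable_diff_null (E : set X) : measurable E ->
  exists N : set T, [/\ measurable N, mu N = 0 & measurable (E `\` N : set T)].
Proof.
move=> mE.
have fin_case (G : set X) : measurable G -> cmu G < +oo ->
    exists N : set T, [/\ measurable N, mu N = 0 & measurable (G `\` N : set T)].
  move=> mG Goo; have [F [mF GF FE]] := completion_hull Goo.
  have FG0 : (mu^*)%mu (F `\` G) = 0.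
    have H : (mu^*)%mu F = (mu^*)%mu (F `&` G) + (mu^*)%mu (F `&` ~` G) := mG F.
    have Gfin : (mu^*)%mu G \is a fin_num by rewrite ge0_fin_numE ?mu_ext_ge0.
    have FE' : (mu^*)%mu F = (mu^*)%mu G by rewrite -FE; exact: measurable_mu_extE.
    move: H; rewrite FE' setIidr// -setDE; move: Gfin.
    case: (mu_ext mu G) => [r| |]// _.
    have : (0 <= (mu^*)%mu (F `\` G)) by exact: mu_ext_ge0.
    case: (mu_ext mu _) => [s| |]//= _.
    by move=> [] rs; congr EFin; move: rs; lra.
  have [N [mN FN NE]] := @completion_hull (F `\` G) ltac:(by rewrite FG0).
  exists N; split => //; first by rewrite NE.
  rewrite (_ : G `\` N = F `\` N); first exact: measurableD.
  apply/seteqP; split=> x [h1 h2]; split => //; first exact: GF.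
  by apply: contrapT => nG; apply: h2; apply: FN.
have /sigma_finiteP[F [FT ndF Foo]] := sigma_finiteT mu.
have mEF i : measurable (E `&` F i : set X).
  by apply: measurableI => //; apply: completion_measurable; case: (Foo i).
have EFoo i : cmu (E `&` F i) < +oo.
  have [mF Fi] := Foo i.
  apply: (@le_lt_trans _ _ (cmu (F i))); last by rewrite completionE.
  by apply: le_outer_measure; exact: subIsetr.
pose N i := projT1 (cid (fin_case _ (mEF i) (EFoo i))).
have HN i : [/\ measurable (N i), mu (N i) = 0 & measurable ((E `&` F i) `\` N i : set T)].
  by rewrite /N; case: cid.
have mN : measurable (\bigcup_i N i) by apply: bigcupT_measurable => i; case: (HN i).
exists (\bigcup_i N i); split => //.
  apply: measure_negligible => //; apply: negligible_bigcup => i.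
  by have [mNi Ni0 _] := HN i; apply/negligibleP.
rewrite (_ : E `\` _ = (\bigcup_i ((E `&` F i) `\` N i)) `\` (\bigcup_i N i)).
  apply: measurableD => //; apply: bigcupT_measurable => i; by case: (HN i).
apply/seteqP; split=> x [].
  move=> Ex nN; split => //.
  have [i _ Fi] : (\bigcup_k F k) x by rewrite -FT.
  by exists i => //; split => // Ni; apply: nN; exists i.
by move=> [i _ [[Ex _] _]] nN; split.
Qed.

(** One null set is removed for each rational sublevel set of [f], and countably many of them form a
    null set. *)
Lemma completion_measurable_fun_null (f : X -> R) : measurable_fun setT f ->
  exists N : set T, [/\ measurable N, mu N = 0 &
    measurable_fun setT (fun x : T => f x * \1_(~` N) x)%R].
Proof.
move=> mf.
have mE (q : rat) : measurable (f @^-1` `]-oo, ratr q[%classic : set X).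
  by rewrite -[X in measurable X]setTI; exact: mf.
pose N q := projT1 (cid (completion_measurable_diff_null (mE q))).
have HN q : [/\ measurable (N q), mu (N q) = 0 &
    measurable ((f @^-1` `]-oo, ratr q[%classic) `\` N q : set T)].
  by rewrite /N; case: cid.
have mN : measurable (\bigcup_q N q).
  by apply: bigcupT_measurable_rat => q; case: (HN q).
exists (\bigcup_q N q); split => //.
  apply: measure_negligible => //.
  pose e n : rat := odflt 0%R (unpickle n).
  rewrite (_ : \bigcup_q N q = \bigcup_i N (e i)); last first.
    apply/seteqP; split => x [q _ Nq]; last by exists (e q).
    by exists (pickle q) => //; rewrite /e pickleK.
  apply: negligible_bigcup => i.
  by have [mNi Ni0 _] := HN (e i); apply/negligibleP.
set M := \bigcup_q N q.
have mfq (q : rat) : measurable ((f @^-1` `]-oo, ratr q[%classic) `\` M : set T).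
  rewrite (_ : _ `\` M = ((f @^-1` `]-oo, ratr q[%classic) `\` N q) `\` M).
    by apply: measurableD => //; case: (HN q).
  apply/seteqP; split=> x [h1 h2]; split => //; last by case: h1.
  by split => // Nq; apply: h2; exists q.
apply: (measurability _ (RGenInftyO.measurableE R)) => // _ [_ [r ->] <-].
rewrite setTI.
(* On [M] the modified function is 0, so [M] belongs to the sublevel set exactly when [0 < r]. *)
rewrite (_ : _ @^-1` _ = (\bigcup_(q in [set q : rat | ratr q < r]%R)
    ((f @^-1` `]-oo, ratr q[%classic) `\` M)) `|`
    (if (0 < r)%R then M else set0)).
  apply: measurableU; last by case: ifP.
  rewrite bigcup_mkcond; apply: bigcupT_measurable_rat => q; case: ifP => // _.
apply/seteqP; split => x /=; rewrite in_itv/= indicE.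
  have [xM|xM] := pselect (M x).
    rewrite memNset; last by move=> /(_ xM).
    by rewrite mulr0 => ->; right.
  rewrite mem_set//= mulr1 => fr; left.
  have [q] := rat_in_itvoo fr; rewrite in_itv/= => /andP[fq qr].
  by exists q => //; split => //=; rewrite in_itv/=.
move=> [[q /= qr [/=]]|].
  rewrite in_itv/= => fq nM; rewrite mem_set// mulr1.
  exact: lt_trans qr.
by case: ifP => // r0 xM; rewrite memNset ?mulr0.
Qed.

Lemma completion_measurable_funT {d'} {Y : measurableType d'} (f : T -> Y) :
  measurable_fun setT f -> measurable_fun (setT : set X) (f : X -> Y).
Proof.
move=> mf _ B mB; rewrite setTI; apply: completion_measurable.
by rewrite -[X in measurable X]setTI; exact: mf.
Qed.

(** The Borel measure is the push-forward of its completion under the identity map. *)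
Lemma completion_ge0_integral (f : T -> \bar R) : measurable_fun setT f ->
  (forall x, 0 <= f x) -> \int[cmu]_x f x = \int[mu]_x f x.
Proof.
move=> mf f0.
have mid : measurable_fun (setT : set X) (id : X -> T).
  by apply: (@completion_measurable_funT _ T id); exact: measurable_id.
transitivity (\int[pushforward cmu (id : X -> T)]_x f x).
  by rewrite (ge0_integral_pushforward mid)//.
apply: eq_measure_integral => A mA _; exact: completionE.
Qed.

Lemma completion_integral (f : T -> \bar R) : measurable_fun setT f ->
  \int[cmu]_x f x = \int[mu]_x f x.
Proof.
move=> mf; rewrite integralE [RHS]integralE; congr (_ - _).
  by apply: completion_ge0_integral => //; exact: measurable_funepos.
by apply: completion_ge0_integral => //; exact: measurable_funeneg.
Qed.

Lemma completion_ae (N : set T) (P : X -> Prop) : measurable N -> mu N = 0 ->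
  (forall x, ~ N x -> P x) -> {ae cmu, forall x, P x}.
Proof.
move=> mN N0 NP; exists N; split.
- exact: completion_measurable.
- by rewrite completionE.
- by move=> x /=; apply: contra_notP => /NP.
Qed.

End completion.

(** * Change of variables under diagonal scalings *)

Section scaling.
Context {R : realType}.
Local Open Scope ereal_scope.
Local Notation leb := (@lebesgue_measure R).

(** The push-forward of Lebesgue measure under [x |-> c x], multiplied by [c], agrees with Lebesgue
    measure on half-open intervals, hence everywhere. *)
Lemma ge0_integral_lebesgue_scale (c : R) (f : R -> \bar R) : (0 < c)%R ->
  measurable_fun setT f -> (forall x, 0 <= f x) ->
  \int[leb]_x f x = c%:E * \int[leb]_x f (c * x)%R.
Proof.
move=> c0 mf f0.
have mc : measurable_fun (setT : set (measurableTypeR R))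
    (( *%R c) : measurableTypeR R -> measurableTypeR R).
  exact: measurable_funM.
pose mcmix := isMeasurableFun.Build _ _ _ _ _ mc.
pose mcf : {mfun measurableTypeR R >-> measurableTypeR R} := HB.pack ( *%R c) mcmix.
pose k := NngNum (ltW c0).
transitivity (\int[pushforward (mscale k leb) mcf]_x f x).
  apply: eq_measure_integral => A mA _.
  apply: lebesgue_measure_unique => // X /ocitvP[->|[[a b]/= ab ->]].
    by rewrite !measure0.
  rewrite /pushforward /mscale/= lebesgue_measure_itv/= lte_fin ab.
  rewrite (_ : _ @^-1` _ = `](c^-1 * a)%R, (c^-1 * b)%R]%classic); last first.
    apply/seteqP; split => x /=; rewrite !in_itv/= ![(c^-1 * _)%R]mulrC;
      by rewrite ltr_pdivrMr// ler_pdivlMr// ![(x * c)%R]mulrC.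
  rewrite lebesgue_measure_itv/= lte_fin ltr_pM2l ?invr_gt0// ab.
  by rewrite -!EFinB -EFinM -mulrBr mulrA mulfV ?gt_eqF// mul1r.
rewrite (ge0_integral_pushforward mc)// preimage_setT ge0_integral_mscale//.
  exact: (measurableT_comp mf mc).
by move=> x _; exact: f0.
Qed.

Definition diag_scale n (c : 'I_n -> R) (x : borel_rV R n) : borel_rV R n :=
  \row_i (c i * (x : 'rV[R]_n) 0%R i)%R.

Lemma measurable_rV {d} {T : measurableType d} n (F : T -> borel_rV R n) :
  (forall i, measurable_fun setT (fun t => (F t : 'rV[R]_n) 0%R i)) ->
  measurable_fun setT F.
Proof.
move=> mF; apply: measurability => // _ [_ [i [B [mB ->]]] <-].
exact: (mF i).
Qed.

Lemma measurable_diag_scale n (c : 'I_n -> R) : measurable_fun setT (@diag_scale n c).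
Proof.
apply: measurable_rV => i; under eq_fun do rewrite mxE.
by apply: measurable_funM => //; exact: measurable_coord_rV.
Qed.

Lemma ge0_integral_cons n (f : borel_rV R n.+1 -> \bar R) :
  measurable_fun setT f -> (forall x, 0 <= f x) ->
  \int[lebesgue_borel_rV R n.+1]_x f x =
  \int[leb]_x \int[lebesgue_borel_rV R n]_y f (cons_rV (x, y)).
Proof.
move=> mf f0; rewrite /= /lebesgue_cons.
rewrite (ge0_integral_pushforward (@measurable_cons_rV R n))//.
rewrite preimage_setT fubini_tonelli1//; last by move=> x; exact: f0.
exact: measurableT_comp mf (@measurable_cons_rV R n).
Qed.

Lemma ge0_integral_diag_scale n (c : 'I_n -> R) (f : borel_rV R n -> \bar R) :
  (forall i, (0 < c i)%R) -> measurable_fun setT f -> (forall x, 0 <= f x) ->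
  \int[lebesgue_borel_rV R n]_x f x =
  (\prod_i c i)%:E * \int[lebesgue_borel_rV R n]_x f (diag_scale c x).
Proof.
elim: n c f => [|n IH] c f c0 mf f0.
  rewrite big_ord0 mul1e; apply: eq_integral => x _; congr f.
  by apply/rowP => -[].
rewrite ge0_integral_cons// big_ord_recl EFinM -muleA.
have mfD := measurableT_comp mf (measurable_diag_scale c).
rewrite [in RHS]ge0_integral_cons//.
pose G x := \int[lebesgue_borel_rV R n]_y f (cons_rV (x, y)).
have mfc : measurable_fun setT (f \o @cons_rV R n).
  exact: measurableT_comp mf (@measurable_cons_rV R n).
have mG : measurable_fun setT G.
  by apply: (measurable_fun_fubini_tonelli_F (m2 := lebesgue_borel_rV R n) _ mfc) => x; exact: f0.
have G0 x : 0 <= G x by exact: integral_ge0.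
rewrite (ge0_integral_lebesgue_scale (c0 ord0) mG G0); congr (_ * _).
have mI : measurable_fun setT
    (fun x => \int[lebesgue_borel_rV R n]_y f (diag_scale c (cons_rV (x, y)))).
  apply: (measurable_fun_fubini_tonelli_F (m2 := lebesgue_borel_rV R n) _
    (measurableT_comp mfD (@measurable_cons_rV R n))) => x; exact: f0.
rewrite -ge0_integralZl//; last 2 first.
- by move=> x _; exact: integral_ge0.
- by rewrite lee_fin prodr_ge0// => i _; rewrite ltW.
apply: eq_integral => x _; rewrite /G.
rewrite (IH (fun i => c (lift ord0 i)))//; last first.
  by apply: (measurableT_comp mfc); exact: pair1_measurable.
congr (_ * _); apply: eq_integral => y _; congr f.
apply/rowP => i; rewrite !mxE; case: (unliftP ord0 i) => [j|] ->/=.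
  by rewrite mxE.
by [].
Qed.

End scaling.

(** * Sublevel sets of affine functions on the cube *)

Section cube_sublevel.
Context {R : realType}.
Local Open Scope ereal_scope.
Local Notation leb := (@lebesgue_measure R).
Local Notation m n := (lebesgue_borel_rV R n).

Lemma measurable_cube n : measurable (@cube R n : set (borel_rV R n)).
Proof.
rewrite (_ : @cube R n = \bigcap_(i in [set: 'I_n])
    [set x : borel_rV R n | `[(-1)%R, 1%R]%classic ((x : 'rV[R]_n) 0%R i)]).
  apply: fin_bigcap_measurable => // i _.
  rewrite -[X in measurable X]setTI; exact: (@measurable_coord_rV R n i).
apply/seteqP; split=> x /= H i; first by move=> _; rewrite /= in_itv/=; exact: H.
by have := H i Logic.I; rewrite /= in_itv.
Qed.

Lemma cube_cons n (x : R) (y : borel_rV R n) :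
  @cube R n.+1 (cons_rV (x, y)) <-> (-1 <= x <= 1)%R /\ @cube R n y.
Proof.
rewrite /cube/=; split=> [H|[x1 Hy] i].
  split; first by have := H ord0; rewrite mxE unlift_none.
  by move=> i; have := H (lift ord0 i); rewrite mxE liftK.
by rewrite mxE; case: (unliftP ord0 i) => [j|] _ /=; [exact: Hy|].
Qed.

Lemma integral_le_cst {d} {T : measurableType d} (mu : {measure set T -> \bar R})
    (D : set T) (F : T -> \bar R) (K : R) : measurable D ->
  measurable_fun setT F -> (forall x, 0 <= F x) -> (0 <= K)%R ->
  (forall x, ~ D x -> F x = 0) -> (forall x, D x -> F x <= K%:E) ->
  \int[mu]_x F x <= K%:E * mu D.
Proof.
move=> mD mF F0 K0 FD FK.
rewrite (_ : \int[mu]_x F x = \int[mu]_(x in D) F x); last first.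
  rewrite [RHS]integral_mkcond; apply: eq_integral => x _; rewrite patchE.
  by case: ifPn => // /negP xD; rewrite FD// => Dx; apply: xD; rewrite inE.
rewrite -integral_cst//; apply: ge0_le_integral => //.
exact: measurable_funTS.
Qed.

Lemma lebesgue_borel_consE n (A : set (borel_rV R n.+1)) :
  m n.+1 A = \int[leb]_x m n (xsection (@cons_rV R n @^-1` A) x).
Proof. by []. Qed.

(** By uniqueness of the product measure the slices may also be taken along the first coordinate, as
    required when that coordinate carries the chosen coefficient. *)
Lemma lebesgue_borel_consE2 n (A : set (borel_rV R n.+1)) : measurable A ->
  m n.+1 A = \int[m n]_y leb (ysection (@cons_rV R n @^-1` A) y).
Proof.
move=> mA.
have mA' : measurable (@cons_rV R n @^-1` A).
  by rewrite -[X in measurable X]setTI; exact: measurable_cons_rV.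
have H (B : set R) (C : set (borel_rV R n)) : measurable B -> measurable C ->
    (leb \x^ m n) (B `*` C) = leb B * m n C.
  by move=> mB mC; exact: product_measure2E.
exact: (@product_measure_unique _ _ _ _ R leb (m n) (leb \x^ m n) H _ mA').
Qed.

Lemma lebesgue_borel_cons_le n (A : set (borel_rV R n.+1)) (K : R) :
  measurable A -> A `<=` @cube R n.+1 -> (0 <= K)%R ->
  (forall x, (-1 <= x <= 1)%R -> m n [set y | A (cons_rV (x, y))] <= K%:E) ->
  m n.+1 A <= (2 * K)%:E.
Proof.
move=> mA Acube K0 H; rewrite lebesgue_borel_consE.
have mA' : measurable (@cons_rV R n @^-1` A).
  by rewrite -[X in measurable X]setTI; exact: measurable_cons_rV.
apply: le_trans (integral_le_cst leb (D := `[(-1)%R, 1%R]%classic) (K := K) _ _ _ _ _ _) _ => //.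
- exact: measurable_fun_xsection.
- move=> x /= xD; rewrite (_ : xsection _ _ = set0) ?measure0//.
  apply/seteqP; split => // y; rewrite /xsection/= inE => /Acube/cube_cons[xD' _].
  by apply: xD; rewrite in_itv.
- move=> x /=; rewrite in_itv/= => /H; rewrite (_ : xsection _ _ = [set y | A (cons_rV (x, y))])//.
  by apply/seteqP; split => y; rewrite /xsection/= inE.
by rewrite [X in _ * X]lebesgue_measure_itv/= lte_fin gtrN// -EFinB -EFinM lee_fin mulrC; lra.
Qed.

Lemma lebesgue_borel_cons_le2 n (A : set (borel_rV R n.+1)) (K : R) :
  measurable A -> A `<=` @cube R n.+1 -> (0 <= K)%R ->
  (forall y, cube y -> leb [set x | A (cons_rV (x, y))] <= K%:E) ->
  m n.+1 A <= K%:E * m n (@cube R n).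
Proof.
move=> mA Acube K0 H; rewrite lebesgue_borel_consE2//.
have mA' : measurable (@cons_rV R n @^-1` A).
  by rewrite -[X in measurable X]setTI; exact: measurable_cons_rV.
apply: integral_le_cst => //.
- exact: measurable_cube.
- exact: measurable_fun_ysection.
- move=> y /= yD; rewrite (_ : ysection _ _ = set0) ?measure0//.
  by apply/seteqP; split => // x; rewrite /ysection/= inE => /Acube/cube_cons[_].
- move=> y /H; rewrite (_ : ysection _ _ = [set x | A (cons_rV (x, y))])//.
  by apply/seteqP; split => x; rewrite /ysection/= inE.
Qed.

Lemma lebesgue_borel_cube n : m n (@cube R n) <= (2 ^+ n)%:E.
Proof.
elim: n => [|n IH]; first by rewrite expr0 /= diracE; case: (_ \in _); rewrite lee_fin.
rewrite exprS; apply: lebesgue_borel_cons_le => //; first exact: measurable_cube.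
move=> x x1; apply: le_trans IH; apply: le_measure; rewrite ?inE; last first.
- by move=> y /cube_cons[].
- exact: measurable_cube.
rewrite (_ : [set y | _] = @cube R n); first exact: measurable_cube.
by apply/seteqP; split=> y /=; [move=> /cube_cons[]|move=> cy; apply/cube_cons].
Qed.

(** The constant term closes the induction on the dimension: freezing the first coordinate moves its
    contribution into [c]. *)
Definition affine n (c : R) (l : 'I_n -> R) (x : 'rV[R]_n) : R :=
  (c + \sum_i l i * x 0 i)%R.

Lemma measurable_affine n c l :
  measurable_fun setT (@affine n c l : borel_rV R n -> R).
Proof.
apply: measurable_funD => //; apply: measurable_sum => i.
by apply: measurable_funM => //; exact: measurable_coord_rV.
Qed.

Lemma measurable_norm_lt {d} {T : measurableType d} (f : T -> R) (t : R) :
  measurable_fun setT f -> measurable [set x | `|f x| < t]%R.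
Proof.
move=> mf; rewrite (_ : [set x | _] = (fun x => `|f x|%R) @^-1` `]-oo, t[%classic).
  rewrite -[X in measurable X]setTI.
  by apply: (measurableT_comp (@normr_measurable R setT) mf) => //.
by apply/seteqP; split => x /=; rewrite in_itv.
Qed.

Lemma measurable_affine_sublevel n c l (t : R) :
  measurable (@cube R n `&` [set x | `|affine c l x| < t]%R : set (borel_rV R n)).
Proof.
apply: measurableI; first exact: measurable_cube.
by apply: measurable_norm_lt; exact: measurable_affine.
Qed.

Lemma affine_cons n c (l : 'I_n.+1 -> R) x (y : borel_rV R n) :
  affine c l (cons_rV (x, y)) =
  affine (c + l ord0 * x)%R (fun j => l (lift ord0 j)) y.
Proof.
rewrite /affine big_ord_recl -addrA; congr (_ + (_ + _))%R.
  by rewrite mxE unlift_none.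
by apply: eq_bigr => j _; rewrite mxE liftK.
Qed.

(** If [i] is not the first coordinate, freeze the first one and use induction. If it is, each line
    in that direction meets the set inside an interval of length [2 * t / |l i|], and the remaining
    cube contributes [2^n]. *)
Lemma affine_sublevel n c (l : 'I_n -> R) i (t : R) : l i != 0%R -> (0 <= t)%R ->
  m n (@cube R n `&` [set x | `|affine c l x| < t]%R) <= (2 ^+ n * (t / `|l i|))%:E.
Proof.
elim: n c l i => [|n IH] c l i li t0; first by case: i li.
have tl : (0 <= t / `|l i|)%R by rewrite divr_ge0.
case: (unliftP ord0 i) => [j|] E.
  rewrite exprS -mulrA; apply: lebesgue_borel_cons_le.
  - exact: measurable_affine_sublevel.
  - exact: subIsetl.
  - by rewrite mulr_ge0// exprn_ge0.
  move=> x x1; have := IH (c + l ord0 * x)%R (fun k => l (lift ord0 k)) j.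
  rewrite -E => /(_ li t0); apply: le_trans; apply: le_measure; rewrite ?inE.
  - rewrite (_ : [set y | _] = @cube R n `&`
      [set y | `|affine (c + l ord0 * x)%R (fun k => l (lift ord0 k)) y| < t]%R).
      exact: measurable_affine_sublevel.
    apply/seteqP; split=> y /=.
      by rewrite affine_cons => -[/cube_cons[_ cy]].
    by rewrite affine_cons => -[cy h]; split => //; apply/cube_cons.
  - exact: measurable_affine_sublevel.
  - by move=> y /=; rewrite affine_cons => -[/cube_cons[_ cy]].
have /le_trans : m n.+1 (@cube R n.+1 `&` [set x | `|affine c l x| < t]%R) <=
    (2 * (t / `|l i|))%:E * m n (@cube R n).
  apply: lebesgue_borel_cons_le2.
  - exact: measurable_affine_sublevel.
  - exact: subIsetl.
  - by rewrite mulr_ge0.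
  move=> y cy.
  pose c' : R := (c + \sum_j l (lift ord0 j) * (y : 'rV[R]_n) 0%R j)%R.
  pose z : R := (- c' / l i)%R.
  apply: (@le_trans _ _ (leb (ball z (t / `|l i|)%R))).
    have aE x : affine c l (cons_rV (x, y)) = (l i * (x - z))%R.
      by rewrite affine_cons /affine /z /c' -E; set S := (\sum_j _)%R; field.
    have mA : measurable [set x | (@cube R n.+1 `&` [set x | `|affine c l x| < t]%R) (cons_rV (x, y))].
      have mA := @measurable_affine_sublevel n.+1 c l t.
      have mA' : measurable (@cons_rV R n @^-1` (@cube R n.+1 `&` [set x | `|affine c l x| < t]%R)).
        by rewrite -[X in measurable X]setTI; exact: measurable_cons_rV.
      rewrite (_ : [set x | _] = ysection (@cons_rV R n @^-1` (@cube R n.+1 `&` [set x | `|affine c l x| < t]%R)) y).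
        exact: measurable_ysection.
      by apply/seteqP; split => x; rewrite /ysection/= inE.
    apply: le_measure; rewrite ?inE//; first exact: measurable_ball.
    move=> x /= [_]; rewrite aE normrM /ball/= distrC.
    by rewrite ltr_pdivlMr ?normr_gt0// mulrC.
  by rewrite lebesgue_measure_ball// lee_fin mulr_natl.
apply; rewrite exprS (mulrAC 2%R) [leRHS]EFinM; apply: lee_pmul => //.
  by rewrite lee_fin mulr_ge0.
exact: lebesgue_borel_cube.
Qed.

End cube_sublevel.

(** * Averaging over the dilation flow *)

Section averaging.
Context {R : realType} (n : nat) (a : 'I_n -> R).
Local Open Scope ereal_scope.
Local Notation leb := (@lebesgue_measure R).
Local Notation B := (borel_rV R n).
Local Notation m := (lebesgue_borel_rV R n).
Local Notation X := (lebesgue_rV_type R n).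
Local Notation mu := (lebesgue_rV R n).

Definition hom_dim : R := (\sum_i (a i)^-1)%R.

Definition flow (s : R) : B -> B := diag_scale (fun i => expR ((a i)^-1 * s)).

Lemma dilation_expR s (x : 'rV[R]_n) : dilation a (expR s) x = flow s x.
Proof. by apply/rowP => i; rewrite !mxE -expRM (mulrC s). Qed.

Lemma flow_eq0 s (x : 'rV[R]_n) : (flow s x == 0 :> 'rV[R]_n)%R = (x == 0)%R.
Proof.
apply/eqP/eqP => [|->]; last by apply/rowP => i; rewrite !mxE mulr0.
move=> /rowP H; apply/rowP => i; have := H i; rewrite !mxE => /eqP.
by rewrite mulf_eq0 gt_eqF ?expR_gt0//= => /eqP.
Qed.

Lemma measurable_flow : measurable_fun setT (fun z : R * B => flow z.1 z.2).
Proof.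
apply: measurable_rV => i; under eq_fun do rewrite mxE.
apply: measurable_funM.
  apply: (measurableT_comp (f := @expR R)) => //.
  by apply: measurable_funM => //; exact: measurable_fst.
exact: (measurableT_comp (@measurable_coord_rV R n i) measurable_snd).
Qed.

Lemma prod_expR s : (\prod_i expR ((a i)^-1 * s) = expR (hom_dim * s))%R.
Proof. by rewrite /hom_dim mulr_suml expR_sum. Qed.

Lemma ge0_integral_flow s (f : B -> \bar R) :
  measurable_fun setT f -> (forall x, 0 <= f x) ->
  \int[m]_x f x = (expR (hom_dim * s))%:E * \int[m]_x f (flow s x).
Proof.
move=> mf f0; rewrite -prod_expR; apply: ge0_integral_diag_scale => // i.
exact: expR_gt0.
Qed.

Definition flow_weight (s : R) : R := (\1_`[0%R, 1%R] s * expR (hom_dim * s))%R.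

Lemma flow_weight_ge0 s : (0 <= flow_weight s)%R.
Proof. by rewrite mulr_ge0 ?expR_ge0. Qed.

Lemma ge0_integral_flow_weight s (f : B -> \bar R) :
  measurable_fun setT f -> (forall x, 0 <= f x) ->
  \int[m]_x ((flow_weight s)%:E * f (flow s x)) = (\1_`[0%R, 1%R] s)%:E * \int[m]_x f x.
Proof.
move=> mf f0.
have mf' : measurable_fun setT (fun x => f (flow s x)).
  exact: (measurableT_comp mf (measurable_diag_scale _)).
rewrite ge0_integralZl//; last by rewrite lee_fin flow_weight_ge0.
by rewrite /flow_weight EFinM -muleA -ge0_integral_flow.
Qed.

Lemma integral_flow_weight s (f : B -> \bar R) : measurable_fun setT f ->
  m.-integrable setT f ->
  \int[m]_x ((flow_weight s)%:E * f (flow s x)) = (\1_`[0%R, 1%R] s)%:E * \int[m]_x f x.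
Proof.
move=> mf fi.
have -> : \int[m]_x f x = \int[m]_x f^\+ x - \int[m]_x f^\- x by rewrite integralE.
rewrite muleBr//; last first.
  by apply: fin_num_adde_defl; rewrite fin_numN; exact: integrable_neg_fin_num.
rewrite integralE ge0_funeposM ?flow_weight_ge0// ge0_funenegM ?flow_weight_ge0//.
have -> : (fun x => f (flow s x))^\+ = fun x => f^\+ (flow s x).
  by apply/funext => x; rewrite !funeposE.
have -> : (fun x => f (flow s x))^\- = fun x => f^\- (flow s x).
  by apply/funext => x; rewrite !funenegE.
rewrite (ge0_integral_flow_weight s (f := f^\+))//; last exact: measurable_funepos.
rewrite (ge0_integral_flow_weight s (f := f^\-))//.
exact: measurable_funeneg.
Qed.

Lemma integral_indic01 : \int[leb]_s (\1_`[0%R, 1%R] s)%:E = 1.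
Proof.
rewrite integral_indic// setIT.
by rewrite [LHS]lebesgue_measure_itv/= lte_fin ltr01 -EFinB subr0.
Qed.

Hypothesis n_gt0 : (0 < n)%N.

Lemma measurable_zero : measurable ([set (0 : 'rV[R]_n)%R] : set B).
Proof.
rewrite (_ : [set _] = \bigcap_(i in [set: 'I_n])
    [set x : B | [set 0%R] ((x : 'rV[R]_n) 0%R i)]).
  apply: fin_bigcap_measurable => // i _.
  by rewrite -[X in measurable X]setTI; exact: (@measurable_coord_rV R n i).
apply/seteqP; split=> x /=; first by move=> -> i _ /=; rewrite mxE.
by move=> H; apply/rowP => i; rewrite mxE; exact: (H i).
Qed.

(** The origin lies in every thin strip around a hyperplane. Positive dimension matters: for [n = 0]
    the measure is the unit mass at the origin. *)
Lemma lebesgue_borel_zero : m [set (0 : 'rV[R]_n)%R] = 0.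
Proof.
have i : 'I_n by case: (n) n_gt0 => // k _; exact: ord0.
apply/eqP; rewrite -measure_le0; apply/lee_addgt0Pr => e e0; rewrite add0e.
have t0 : (0 <= e / 2 ^+ n)%R by rewrite divr_ge0 ?ltW.
have := @affine_sublevel R n 0%R (fun=> 1%R) i (e / 2 ^+ n)%R (oner_neq0 _) t0.
rewrite normr1 divr1 (mulrC (2 ^+ n)%R) divfK ?gt_eqF ?exprn_gt0//; apply: le_trans.
apply: le_measure; rewrite ?inE.
- exact: measurable_zero.
- exact: measurable_affine_sublevel.
move=> _ ->; split; first by move=> j; rewrite mxE lerN10 ler01.
rewrite /= /affine big1 ?addr0 ?normr0 ?divr_gt0 ?exprn_gt0// => j _.
by rewrite mxE mulr0.
Qed.

Lemma measurable_flow_weight : measurable_fun setT flow_weight.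
Proof.
apply: measurable_funM; first exact: measurable_indic.
apply: (measurableT_comp (f := @expR R)); first exact: measurable_expR.
exact: mulrl_measurable.
Qed.

(** For each fixed time the weighted pullback of the indicator of [N] has integral 0, so by Tonelli
    its integral over times in [0,1] vanishes for almost every [x]. *)
Lemma flow_null (N : set B) : measurable N -> m N = 0 ->
  exists M : set B, [/\ measurable M, m M = 0 & forall x, ~ M x ->
    {ae leb, forall s, `[0%R, 1%R]%classic s -> ~ N (flow s x)}].
Proof.
move=> mN N0.
pose k (z : R * B) : \bar R := (flow_weight z.1)%:E * (\1_N (flow z.1 z.2))%:E.
have k0 z : 0 <= k z by rewrite mule_ge0// lee_fin flow_weight_ge0.
have mk : measurable_fun setT k.
  apply: emeasurable_funM.
    apply/measurable_EFinP; exact: (measurableT_comp measurable_flow_weight measurable_fst).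
  apply/measurable_EFinP.
  exact: (measurableT_comp (measurable_indic mN) measurable_flow).
pose h x := \int[leb]_s k (s, x).
have mh : measurable_fun setT h.
  by apply: (measurable_fun_fubini_tonelli_G (m1 := leb)).
have h0 x : 0 <= h x by exact: integral_ge0.
have H : \int[m]_x h x = 0.
  rewrite /h -fubini_tonelli//; apply: integral0_eq => s _.
  rewrite /k/= (ge0_integral_flow_weight s (f := EFin \o \1_N))//.
    have E : \int[m]_x (\1_N x)%:E = 0 by rewrite integral_indic// setIT; exact: N0.
    by rewrite [X in _ * X]E mule0.
    by apply/measurable_EFinP; exact: measurable_indic.
  by move=> x; rewrite lee_fin.
exists [set x | h x != 0]; split.
- by rewrite -[X in measurable X]setTI; apply: emeasurable_neq.
- have : \int[m]_x `|h x| = 0 by under eq_integral do rewrite gee0_abs//.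
  move=> /(ae_eq_integral_abs _ measurableT mh)[M [mM M0 HM]].
  apply: measure_negligible.
    by rewrite -[X in measurable X]setTI; apply: emeasurable_neq.
  exists M; split => // x /= /eqP hx; apply: HM => /= H'; exact/hx/H'.
move=> x /negP; rewrite negbK => /eqP hx.
have mkx : measurable_fun setT (fun s => k (s, x)) by exact: (measurableT_comp mk (pair2_measurable x)).
have E : \int[leb]_s `|k (s, x)| = 0 by under eq_integral do rewrite gee0_abs//.
have := (ae_eq_integral_abs leb measurableT mkx).1 E; apply: filterS => s /(_ Logic.I)/= + s01 Ns.
rewrite /k/= /flow_weight indicE mem_set// indicE mem_set// mul1r mule1 => -[] /eqP.
by rewrite gt_eqF ?expR_gt0.
Qed.

(* The integral of [F] is the average over [s] in [0,1] of its pullbacks by the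
   measure-scaling flow. [F] is only Lebesgue measurable, so Fubini is applied to
   a Borel function equal to [F] off a Borel null set [N]; almost every orbit
   meets [N] in a null set of times. *)
Lemma averaging_le (F W : 'rV[R]_n -> R) :
  mu.-integrable setT (EFin \o (F : X -> R)) ->
  measurable_fun (setT : set X) (W : X -> R) -> (forall x, 0 <= W x)%R ->
  (forall x : 'rV[R]_n, x != 0%R ->
    measurable_fun setT (fun s : R => F (flow s x)) /\
    `|\int[leb]_(s in `[0%R, 1%R]) (expR (hom_dim * s) * F (flow s x))%:E| <= (W x)%:E) ->
  `|\int[mu]_x (F x)%:E| <= \int[mu]_x (W x)%:E.
Proof.
move=> Fi mW W0 H.
have mF : measurable_fun (setT : set X) (F : X -> R).
  by apply/measurable_EFinP; case/integrableP: Fi.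
have [N [mN N0 mF']] := completion_measurable_fun_null mF.
pose F' (x : B) : R := (F x * \1_(~` N) x)%R.
have F'E x : ~ N x -> F' x = F x.
  by move=> Nx; rewrite /F' indicE mem_set// mulr1.
have mF'e : measurable_fun setT (EFin \o F') by exact/measurable_EFinP.
have FF' : \int[mu]_x (F x)%:E = \int[m]_x (F' x)%:E.
  rewrite -(completion_integral m mF'e).
  apply: ae_eq_integral; first exact: measurableT.
  - exact/measurable_EFinP.
  - apply/measurable_EFinP. exact: completion_measurable_funT.
  - by apply: (completion_ae mN N0) => x /F'E Fx _; rewrite -[F x]Fx.
have F'i : m.-integrable setT (EFin \o F').
  apply/integrableP; split => //.
  rewrite -(completion_integral m); last exact: measurableT_comp.
  case/integrableP : Fi => _; apply: le_lt_trans.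
  apply: ge0_le_integral; first exact: measurableT.
  - by move=> x _; exact: abse_ge0.
  - apply/measurableT_comp; first exact: abse_measurable.
    exact/measurable_EFinP/completion_measurable_funT.
  - apply: measurableT_comp; first exact: abse_measurable.
    exact/measurable_EFinP.
  - move=> x _; rewrite /= lee_fin /F' normrM ler_piMr// indicE.
    by case: (_ \in _); rewrite ?normr1 ?normr0.
pose k (z : R * B) : \bar R := (flow_weight z.1)%:E * (F' (flow z.1 z.2))%:E.
have mk : measurable_fun setT k.
  apply: emeasurable_funM.
    apply/measurable_EFinP; exact: (measurableT_comp measurable_flow_weight measurable_fst).
  apply/measurable_EFinP; exact: (measurableT_comp mF' measurable_flow).
have ki : (leb \x m).-integrable setT k.
  apply/integrable12ltyP => //.
  have kE s x : `|k (s, x)| = (flow_weight s)%:E * (abse \o (EFin \o F')) (flow s x).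
    by rewrite /k abseM gee0_abs// lee_fin flow_weight_ge0.
  have kI s : \int[m]_x `|k (s, x)| =
      (\1_`[0%R, 1%R] s)%:E * \int[m]_x `|(F' x)%:E|.
    under eq_integral do rewrite kE.
    apply: (ge0_integral_flow_weight s (f := abse \o (EFin \o F'))).
      exact: measurableT_comp.
    by move=> x; exact: abse_ge0.
  under eq_integral do rewrite kI.
  rewrite ge0_integralZr//; last 2 first.
  - exact/measurable_EFinP/measurable_indic.
  - exact: integral_ge0.
  rewrite [X in X * _]integral_indic01 mul1e.
  by case/integrableP : F'i.
pose Phi x := \int[leb]_s k (s, x).
have FPhi : \int[m]_x (F' x)%:E = \int[m]_x Phi x.
  rewrite /Phi -(Fubini ki).
  under [RHS]eq_integral => s _ do rewrite (integral_flow_weight s mF'e F'i).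
  transitivity (\int[leb]_s ((\int[m]_x (F' x)%:E) * (\1_`[0%R, 1%R] s)%:E)).
    have /fineK <- : \int[m]_x (F' x)%:E \is a fin_num by exact: integrable_fin_num.
    rewrite integralZl//; last first.
      apply/integrableP; split; first exact/measurable_EFinP/measurable_indic.
      under eq_integral do rewrite gee0_abs ?lee_fin//.
      by rewrite [X in X < _]integral_indic01 ltry.
    by rewrite [X in _ * X]integral_indic01 mule1.
  by apply: eq_integral => s _; rewrite muleC.
have mPhi : measurable_fun setT Phi by exact: (measurable_fubini_G ki).
have [M [mM M0 HM]] := flow_null mN N0.
rewrite FF' FPhi.
apply: le_trans (le_abse_integral _ _ mPhi) _ => //.
have mPhi' : measurable_fun setT (fun x => `|Phi x|) by exact: measurableT_comp.
have Phi0 x : 0 <= `|Phi x| by exact: abse_ge0.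
rewrite -(completion_ge0_integral m mPhi' Phi0).
apply: ae_ge0_le_integral; first exact: measurableT.
- by move=> x _; exact: Phi0.
- exact: completion_measurable_funT.
- by move=> x _; rewrite lee_fin.
- exact/measurable_EFinP.
(* The orbit estimate [H] is available only for [x != 0], so the origin joins the exceptional null
   set. *)
apply: (completion_ae (measurableU _ _ mM measurable_zero)).
  by rewrite measureU0//; [exact: measurable_zero|exact: lebesgue_borel_zero].
move=> x /not_orP[Mx /eqP x0] _.
have [mFx Fx] := H x x0; apply: le_trans Fx.
rewrite le_eqVlt; apply/orP; left; apply/eqP; congr (`|_|).
rewrite integral_mkcond /Phi; apply: ae_eq_integral => //.
- exact: (measurableT_comp mk (pair2_measurable x)).
- apply/(measurable_restrictT _ _).1 => //.
  apply/measurable_EFinP/measurable_funTS; apply: measurable_funM => //.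
  apply: (measurableT_comp (f := @expR R)); first exact: measurable_expR.
  exact: mulrl_measurable.
have [Z [mZ Z0 HZ]] := HM x Mx; exists Z; split => // s /= Hs.
apply: HZ => /= Ns; apply: Hs => _.
rewrite patchE /k/= /flow_weight indicE.
have [s01|s01] := boolP (s \in _); last by rewrite mul0r mul0e.
by rewrite mul1r -EFinM F'E//; apply: Ns; move: s01; rewrite inE.
Qed.

(** Change of variables at one fixed time; in the converse it pulls the cube back to a small
    neighbourhood of the origin. *)
Lemma ge0_integral_flow_le s (F W : 'rV[R]_n -> R) :
  measurable_fun (setT : set X) (F : X -> R) -> (forall x, 0 <= F x)%R ->
  measurable_fun (setT : set X) (W : X -> R) -> (forall x, 0 <= W x)%R ->
  (forall x : 'rV[R]_n, x != 0%R -> (F (flow s x) <= W x)%R) ->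
  \int[mu]_x (F x)%:E <= (expR (hom_dim * s))%:E * \int[mu]_x (W x)%:E.
Proof.
move=> mF F0 mW W0 FW.
have [N [mN N0 mF']] := completion_measurable_fun_null mF.
pose F' (x : B) : R := (F x * \1_(~` N) x)%R.
have F'0 x : (0 <= F' x)%R by rewrite mulr_ge0.
have mF'e : measurable_fun setT (EFin \o F') by exact/measurable_EFinP.
have -> : \int[mu]_x (F x)%:E = \int[m]_x (F' x)%:E.
  rewrite -(completion_integral m mF'e).
  apply: ae_eq_integral; first exact: measurableT.
  - exact/measurable_EFinP.
  - apply/measurable_EFinP; exact: completion_measurable_funT.
  - apply: (completion_ae mN N0) => x Nx _ /=.
    by rewrite /F' indicE mem_set// mulr1.
have mF's : measurable_fun setT (fun x => (F' (flow s x))%:E).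
  exact: (measurableT_comp mF'e (measurable_diag_scale _)).
have F'e0 x : 0 <= (EFin \o F') x by rewrite lee_fin.
have F's0 x : 0 <= (F' (flow s x))%:E by rewrite lee_fin.
rewrite (ge0_integral_flow s mF'e F'e0).
apply: lee_wpmul2l; first by rewrite lee_fin expR_ge0.
rewrite -(completion_ge0_integral m mF's F's0).
apply: ae_ge0_le_integral; first exact: measurableT.
- by move=> x _; rewrite lee_fin.
- exact: completion_measurable_funT.
- by move=> x _; rewrite lee_fin.
- exact/measurable_EFinP.
apply: (completion_ae measurable_zero lebesgue_borel_zero) => x /eqP x0 _.
rewrite lee_fin; apply: le_trans (FW x x0).
by rewrite /F' ler_piMr// indicE; case: (_ \in _).
Qed.

End averaging.

(** * Decay of the oscillatory integral through one phase coefficient *)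

Section key_estimate.
Context {R : realType} (n : nat) (a : 'I_n -> R) (rho : R) (g : 'rV[R]_n -> R).
Local Notation leb := (@lebesgue_measure R).
Local Notation X := (lebesgue_rV_type R n).
Local Notation mu := (lebesgue_rV R n).
Local Notation flow := (flow a).
Local Notation Q := (hom_dim a).
Hypothesis n_gt0 : (0 < n)%N.
Hypothesis a_gt0 : forall i, 0 < a i.
Hypothesis g_ge0 : forall x, 0 <= g x.
Hypothesis g_meas : lebesgue_measurable g.
Hypothesis g_hom : mixed_homogeneous_away0 a rho g.
Implicit Types (x : 'rV[R]_n) (psi : 'rV[R]_n -> R).

Lemma flowD (s u : R) x : flow (s + u) x = flow u (flow s x).
Proof. by apply/rowP => i; rewrite !mxE mulrA -expRD -mulrDr addrC. Qed.

Lemma flow0 x : flow 0 x = x.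
Proof. by apply/rowP => i; rewrite !mxE mulr0 expR0 mul1r. Qed.

(** For [s >= 0] the flow does not decrease any [|x_i|], so a coordinate exceeding 1 in size keeps
    doing so. *)
Lemma flow_cube_enorm (s : R) x : 0 <= s -> ~ @cube R n x -> 1 < enorm (flow s x).
Proof.
move=> s0 /existsNP[i /negP xi].
have xi1 : 1 < `|x 0 i|.
  by move: xi; rewrite negb_and -!ltNge ltr_normr => /orP[|->//]; rewrite ltrNr => ->; rewrite orbT.
have f1 : 1 < `|(flow s x : 'rV[R]_n) 0 i|.
  rewrite mxE normrM ger0_norm ?expR_ge0//; apply: (lt_le_trans xi1).
  by rewrite ler_peMl// -expR0 ler_expR mulr_ge0// invr_ge0 ltW.
apply: (lt_le_trans f1); rewrite /enorm -sqrtr_sqr ler_wsqrtr//.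
by rewrite (bigD1 i)//= lerDl sumr_ge0// => j _; rewrite sqr_ge0.
Qed.

Lemma flow_hom (s : R) x : x != 0 -> g (flow s x) = expR (rho * s) * g x.
Proof.
by move=> x0; rewrite -dilation_expR g_hom ?expR_gt0// -expRM (mulrC s).
Qed.

Definition orbit psi x (t : R) := psi (dilation a t x).

(** Real-valued form of admissibility, satisfied by the real and the imaginary part of an admissible
    function. *)
Record amplitude psi : Prop := Amplitude {
  amplitude_integrable : mu.-integrable setT (EFin \o (psi : X -> R));
  amplitude_support : forall x, 1 < enorm x -> psi x = 0;
  amplitude_C1 : forall x, x != 0 -> C1_pos (orbit psi x);
  amplitude_le : forall x, x != 0 -> `|psi x| <= g x;
  amplitude_derive_le : forall x, x != 0 -> `|derive1 (orbit psi x) 1| <= g x }.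

(** The group law of the flow turns the derivative at time [s] into the derivative at [t = 1] based
    at [flow s x], the only one that the hypotheses bound. *)
Lemma amplitude_is_derive psi x (s : R) : amplitude psi -> x != 0 ->
  is_derive s 1 (fun u => psi (flow u x)) (derive1 (orbit psi (flow s x)) 1).
Proof.
move=> [_ _ C1 _ _] x0.
have xs0 : (flow s x : 'rV[R]_n) != 0 by rewrite flow_eq0.
have [d1 _] := C1 _ xs0 1 ltr01.
have E : (fun u => psi (flow u x)) = orbit psi (flow s x) \o (fun u => expR (u - s)).
  apply/funext => u; rewrite /orbit /= dilation_expR -flowD.
  by congr (psi (flow _ _)); ring.
have h1 : is_derive s 1 (fun u : R => u - s) 1.
  apply: is_derive_eq (is_derive_subf (is_derive_idf s) (is_derive_cst s s 1)) _.
  exact: subr0.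
have h2 := @is_derive1_comp _ expR (fun u => u - s) s _ _ (is_derive_expR (s - s)) h1.
have h3 : is_derive (expR (s - s)) 1 (orbit psi (flow s x)) (derive1 (orbit psi (flow s x)) 1).
  rewrite subrr expR0; split; first exact: d1.
  by rewrite derive1E.
rewrite E; apply: is_derive_eq (@is_derive1_comp _ _ _ s _ _ h3 h2) _.
by rewrite mulr1 subrr expR0 mulr1.
Qed.

Definition decay_weight (k : R) (c : 'rV[R]_n -> R) (x : 'rV[R]_n) : R :=
  g x * \1_(@cube R n) x * (1 + `|c x|) `^ (- k).

Lemma decay_weight_ge0 k c x : 0 <= decay_weight k c x.
Proof. by rewrite /decay_weight !mulr_ge0// powR_ge0. Qed.

Lemma measurable_cube_completed : measurable (@cube R n : set X).
Proof. by apply: completion_measurable; exact: measurable_cube. Qed.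

Lemma measurable_decay k (c : 'rV[R]_n -> R) : lebesgue_measurable c ->
  lebesgue_measurable (fun x => (1 + `|c x|) `^ (- k)).
Proof.
move=> mc; apply: (measurableT_comp (f := fun y : R => y `^ (- k))).
  exact: measurable_powR.
apply: measurable_funD; first exact: measurable_cst.
exact: (measurableT_comp (@normr_measurable R setT) mc).
Qed.

Lemma measurable_decay_weight k (c : 'rV[R]_n -> R) : lebesgue_measurable c ->
  lebesgue_measurable (decay_weight k c).
Proof.
move=> mc; apply: measurable_funM; last exact: measurable_decay.
apply: measurable_funM; first exact: g_meas.
by apply: measurable_indic; exact: measurable_cube_completed.
Qed.

(** The averaging inequality reduces the claim to one orbit, where the phase is an exponential sum.
    Negative powers decrease, so any single coefficient [c beta] may be kept in place of the sum of
    all of them. *)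
Lemma amplitude_osc_le (al : seq R) : uniq al -> 0 \notin al -> (0 < size al)%N ->
  exists2 C : R, 0 < C & forall psi (theta : 'rV[R]_n -> R) (c : R -> 'rV[R]_n -> R)
      (beta theta0 : R), amplitude psi ->
    lebesgue_measurable theta -> beta \in al -> lebesgue_measurable (c beta) ->
    (forall (s : R) x, theta (flow s x) = \sum_(y <- al) c y x * expR (y * s)) ->
    mu.-integrable setT (EFin \o (fun x => cos (theta x + theta0) * psi x : R)) /\
    (`|\int[mu]_x (cos (theta x + theta0) * psi x)%:E| <=
      C%:E * \int[mu]_x (decay_weight (size al)%:R^-1 (c beta) x)%:E)%E.
Proof.
move=> ual al0 szal; have [C C0 HC] := expsum_integral_le ual al0 szal.
(* [M] bounds the growth of [exp (Q s) * g (flow s x)] relative to [g x] for [s] in [0,1]; the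
   factor [|Q| + 1] below accounts for differentiating [exp (Q s)]. *)
pose M := expR (`|Q| + `|rho|).
have M0 : 0 < M by exact: expR_gt0.
pose K := C * ((`|Q| + 1) * M).
have K0 : 0 < K by rewrite !mulr_gt0// ltr_wpDl.
exists K => // psi theta c beta theta0 hpsi mtheta betaal mc flowE.
have mcos : lebesgue_measurable (fun x => cos (theta x + theta0)).
  apply: (measurableT_comp (f := @cos R)).
    by apply: continuous_measurable_fun; exact: continuous_cos.
  by apply: measurable_funD; [exact: mtheta|exact: measurable_cst].
have mpsi : lebesgue_measurable psi.
  by apply/measurable_EFinP; case/integrableP: (amplitude_integrable hpsi).
have Fint : mu.-integrable setT (EFin \o (fun x => cos (theta x + theta0) * psi x : R)).
  apply: le_integrable (amplitude_integrable hpsi).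
  - exact: measurableT.
  - by apply/measurable_EFinP; apply: measurable_funM; [exact: mcos|exact: mpsi].
  - move=> x _; rewrite /= lee_fin normrM ler_piMl//.
    by rewrite ler_norml cos_geN1 cos_le1.
split => //.
set k := (size al)%:R^-1; pose W x := K * decay_weight k (c beta) x.
have mW : lebesgue_measurable W.
  by apply: measurable_funM; [exact: measurable_cst|exact: measurable_decay_weight].
rewrite -ge0_integralZl; last first.
- by rewrite lee_fin ltW.
- by move=> x _; rewrite lee_fin decay_weight_ge0.
- by apply/measurable_EFinP; exact: measurable_decay_weight.
- exact: measurableT.
apply: (averaging_le n_gt0 (a := a) (W := W) Fint) => //.
  by move=> x; rewrite mulr_ge0 ?decay_weight_ge0// ltW.
move=> x x0.
pose h s := expR (Q * s) * psi (flow s x).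
pose d s := derive1 (orbit psi (flow s x)) 1.
have hpsid (s : R) : is_derive s 1 (fun u => psi (flow u x)) (d s).
  exact: amplitude_is_derive.
have hh (s : R) : is_derive s 1 h (Q * expR (Q * s) * psi (flow s x) + expR (Q * s) * d s).
  apply: is_derive_mulf => //.
  have h1 : is_derive s 1 (fun u : R => Q * u) Q.
    by apply: is_derive_eq (is_derive_mulfl Q (is_derive_idf s)) _; exact: mulr1.
  apply: is_derive_eq (@is_derive1_comp _ expR _ s _ _ (is_derive_expR _) h1) _.
  exact: mulrC.
pose cx y := c y x.
have thE (s : R) : theta (flow s x) + theta0 = expsum al cx theta0 0 s.
  rewrite flowE /expsum addrC; congr (_ + _).
  by apply: eq_bigr => y _; rewrite expr0 mulr1.
have FE (s : R) : expR (Q * s) * (cos (theta (flow s x) + theta0) * psi (flow s x)) =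
    cos (expsum al cx theta0 0 s) * h s.
  by rewrite thE /h mulrCA.
split.
  apply: continuous_measurable_fun => s.
  have cpsi : {for s, continuous (fun u => psi (flow u x))}.
    exact: is_derive_continuous (hpsid s).
  apply: continuousM => //.
  rewrite (_ : (fun u => cos _) = fun u => cos (expsum al cx theta0 0 u)).
    have cp := @derive_chain_continuous _ _ 0 (expsum_derive_chain al cx theta0).
    by apply: (@continuous_comp _ _ _ (expsum al cx theta0 0) (@cos R)); [exact: cp|exact: continuous_cos].
  by apply/funext => u; rewrite thE.
under eq_integral do rewrite FE.
have [xc|xc] := pselect (@cube R n x); last first.
  rewrite (@eq_integral _ _ _ _ _ (cst 0%E)); last first.
    move=> s; rewrite inE/= in_itv/= => /andP[s0 _].
    by rewrite /h (amplitude_support hpsi) ?mulr0// flow_cube_enorm.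
  by rewrite integral0 abse0 lee_fin mulr_ge0 ?decay_weight_ge0// ltW.
have ebnd (s : R) : 0 <= s <= 1 -> expR (Q * s) * g (flow s x) <= M * g x.
  move=> /andP[s0 s1]; rewrite flow_hom// mulrA -expRD ler_wpM2r// ler_expR -mulrDl.
  apply: le_trans (ler_norm _) _; rewrite normrM (ger0_norm s0).
  apply: le_trans (ler_wpM2r s0 (ler_normD _ _)) _.
  by rewrite ler_piMr// addr_ge0.
have xs0 (s : R) : (flow s x : 'rV[R]_n) != 0 by rewrite flow_eq0.
have hb (s : R) : 0 <= s <= 1 -> `|h s| <= M * g x.
  move=> s01; apply: le_trans (ebnd s s01); rewrite normrM ger0_norm ?expR_ge0//.
  by rewrite ler_wpM2l ?expR_ge0// (amplitude_le hpsi).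
have eb (s : R) : 0 <= s <= 1 -> `|expR (Q * s) * d s| <= M * g x.
  move=> s01; apply: le_trans (ebnd s s01); rewrite normrM ger0_norm ?expR_ge0//.
  by rewrite ler_wpM2l ?expR_ge0// (amplitude_derive_le hpsi).
have Mg : 0 <= M * g x by rewrite mulr_ge0// ltW.
apply: le_trans (HC cx theta0 h _ ((`|Q| + 1) * (M * g x)) hh _ _) _.
- by move=> s /hb hs; apply: (le_trans hs); rewrite ler_peMl// lerDr.
- move=> s s01; apply: le_trans (ler_normD _ _) _.
  rewrite mulrDl mul1r lerD ?eb// -mulrA normrM ler_wpM2l//.
  exact: hb.
rewrite lee_fin /W /decay_weight indicE mem_set// mulr1 /K.
have -> : C * ((`|Q| + 1) * M) * (g x * (1 + `|c beta x|) `^ (- k)) =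
  C * ((`|Q| + 1) * (M * g x)) * (1 + `|c beta x|) `^ (- k) by ring.
rewrite ler_wpM2l//; first by rewrite mulr_ge0 ?(ltW C0)// mulr_ge0// addr_ge0.
have S0 : 0 <= \sum_(y <- al) `|cx y| by rewrite sumr_ge0.
have k0 : 0 <= k by rewrite invr_ge0.
have cS : `|c beta x| <= \sum_(y <- al) `|cx y|.
  by rewrite (big_rem beta betaal)/= lerDl sumr_ge0.
have p1 : 0 < 1 + `|c beta x| by rewrite ltr_pwDl.
have p2 : 0 < 1 + \sum_(y <- al) `|cx y| by rewrite ltr_pwDl.
rewrite !powRN lef_pV2 ?posrE; [|exact: powR_gt0|exact: powR_gt0].
by apply: ge0_ler_powR => //; rewrite ?nnegrE ?(ltW p1) ?(ltW p2)// lerD2l.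
Qed.

Lemma normc_le (z : R[i]) : normc z <= `|complex.Re z| + `|complex.Im z|.
Proof.
case: z => x y /=; rewrite -[leRHS]ger0_norm ?addr_ge0// -sqrtr_sqr.
rewrite ler_wsqrtr// sqrrD !real_normK ?num_real// lerD2r lerDl.
by rewrite mulrn_wge0// mulr_ge0.
Qed.

Lemma Re_le_normc (z : R[i]) : `|complex.Re z| <= normc z.
Proof. by case: z => x y /=; rewrite -sqrtr_sqr ler_wsqrtr// lerDl sqr_ge0. Qed.

Lemma Im_le_normc (z : R[i]) : `|complex.Im z| <= normc z.
Proof. by case: z => x y /=; rewrite -sqrtr_sqr ler_wsqrtr// lerDr sqr_ge0. Qed.

Lemma admissible_amplitude_re phi : admissible a g phi ->
  amplitude (fun x => complex.Re (phi x)).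
Proof.
move=> [[Ri Ii] supp C1 le dle]; split.
- exact: Ri.
- by move=> x /supp ->.
- by move=> x /C1[].
- by move=> x /le; apply: le_trans; exact: Re_le_normc.
- move=> x /dle; apply: le_trans.
  exact: (Re_le_normc (euler_deriv a phi x)).
Qed.

Lemma admissible_amplitude_im phi : admissible a g phi ->
  amplitude (fun x => complex.Im (phi x)).
Proof.
move=> [[Ri Ii] supp C1 le dle]; split.
- exact: Ii.
- by move=> x /supp ->.
- by move=> x /C1[].
- by move=> x /le; apply: le_trans; exact: Im_le_normc.
- move=> x /dle; apply: le_trans.
  exact: (Im_le_normc (euler_deriv a phi x)).
Qed.

Lemma Rintegral_norm_le (F : 'rV[R]_n -> R) (r : R) :
  mu.-integrable setT (EFin \o (F : X -> R)) ->
  (`|\int[mu]_x (F x)%:E| <= r%:E)%E -> `|\int[mu]_x F x| <= r.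
Proof.
move=> Fi; rewrite /Rintegral.
have : (\int[mu]_x (F x)%:E)%E \is a fin_num by exact: integrable_fin_num.
by case: (\int[mu]_x (F x)%:E)%E => //= s _; rewrite lee_fin.
Qed.

(** The real and imaginary parts of the integral split into four real integrals against a cosine
    with shift 0 or [- pi / 2], whence the factor 4. *)
Lemma osc_integral_decay (al : seq R) : uniq al -> 0 \notin al -> (0 < size al)%N ->
  exists2 C : R, 0 < C & forall phi f (l0 : R) (l : 'rV[R]_n)
      (c : R -> 'rV[R]_n -> R) (beta I : R),
    admissible a g phi -> lebesgue_measurable f ->
    beta \in al -> lebesgue_measurable (c beta) ->
    (forall (s : R) x, l0 * f (flow s x) + \sum_i l 0 i * (flow s x : 'rV[R]_n) 0 i =
       \sum_(y <- al) c y x * expR (y * s)) ->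
    (\int[mu]_x (decay_weight (size al)%:R^-1 (c beta) x)%:E <= I%:E)%E ->
    normc (osc_integral f phi l0 l) <= C * I.
Proof.
move=> ual al0 szal; have [C C0 HC] := amplitude_osc_le ual al0 szal.
exists (4 * C); first by rewrite mulr_gt0.
move=> phi f l0 l c beta I adm mf betaal mc flowE WI.
pose theta x := l0 * f x + \sum_i l 0 i * x 0 i.
have mtheta : lebesgue_measurable theta.
  apply: measurable_funD.
    by apply: measurable_funM; [exact: measurable_cst|exact: mf].
  apply: completion_measurable_funT; apply: measurable_sum => i.
  by apply: measurable_funM => //; exact: measurable_coord_rV.
have [hR hI] := (admissible_amplitude_re adm, admissible_amplitude_im adm).
have key psi theta0 : amplitude psi ->
    mu.-integrable setT (EFin \o (fun x => cos (theta x + theta0) * psi x : R)) /\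
    `|\int[mu]_x (cos (theta x + theta0) * psi x)| <= C * I.
  move=> hpsi; have [Fi Fle] := HC psi theta c beta theta0 hpsi mtheta betaal mc flowE.
  split => //; apply: Rintegral_norm_le => //; apply: (le_trans Fle).
  by rewrite EFinM; apply: lee_wpmul2l => //; rewrite lee_fin ltW.
have sinE (t : R) : sin t = cos (t + - (pi / 2)) by rewrite cosBpihalf.
have [i1 e1] := key _ 0 hR; have [i2 e2] := key _ (- (pi / 2)) hI.
have [i3 e3] := key _ 0 hI; have [i4 e4] := key _ (- (pi / 2)) hR.
apply: le_trans (normc_le _) _.
have -> : 4 * C * I = (C * I + C * I) + (C * I + C * I) by ring.
rewrite /osc_integral /cintegral /=; apply: lerD.
  rewrite (_ : (fun x => complex.Re _) = (fun x => cos (theta x + 0) * complex.Re (phi x) -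
      cos (theta x + - (pi / 2)) * complex.Im (phi x))); last first.
    by apply/funext => x; rewrite addr0 -sinE; case: (phi x).
  rewrite (RintegralB measurableT i1 i2).
  by apply: le_trans (ler_normB _ _) _; exact: lerD.
rewrite (_ : (fun x => complex.Im _) = (fun x => cos (theta x + 0) * complex.Im (phi x) +
    cos (theta x + - (pi / 2)) * complex.Re (phi x))); last first.
  by apply/funext => x; rewrite addr0 -sinE; case: (phi x).
rewrite (RintegralD measurableT i3 i4).
by apply: le_trans (ler_normD _ _) _; exact: lerD.
Qed.

End key_estimate.

(** * Layer-cake decay and the direct part of (a) *)

Section dyadic_layers.
Context {R : realType}.

Lemma dyadic_ceil (L : R) : 1 <= L -> exists2 K : nat, L <= 2 ^+ K & 2 ^+ K < 2 * L.
Proof.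
move=> L1.
have exK : exists K : nat, L <= 2 ^+ K.
  exists (Num.truncn L).+1; apply: (le_trans (ltW (truncnS_gt L))).
  by rewrite -natrX ler_nat ltnW// ltn_expl.
case: (ex_minnP exK) => K LK minK; exists K => //.
case: K LK minK => [|K] LK minK; first by rewrite expr0; lra.
rewrite exprS ltr_pM2l// ltNge; apply/negP => /minK.
by rewrite ltnn.
Qed.

Lemma geometric_sum_le (q : R) n : 0 <= q -> q < 1 ->
  \sum_(j < n) q ^+ j <= (1 - q)^-1.
Proof.
move=> q0 q1; rewrite -[leRHS]mul1r ler_pdivlMr ?subr_gt0//.
have := subrX1 q n => E; have : 0 <= q ^+ n by exact: exprn_ge0.
move: E; set S := \sum_(_ < _) _; lra.
Qed.

Lemma geometric_sum_le_gt1 (q : R) n : 1 < q ->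
  \sum_(j < n.+1) q ^+ j <= q ^+ n * (q / (q - 1)).
Proof.
move=> q1; rewrite mulrA -exprSr ler_pdivlMr ?subr_gt0//.
have := subrX1 q n.+1; set S := \sum_(_ < _) _; lra.
Qed.

Lemma powRN_le (x y k : R) : 0 < x -> x <= y -> 0 <= k ->
  y `^ (- k) <= x `^ (- k).
Proof.
move=> x0 xy k0; have y0 := lt_le_trans x0 xy.
rewrite !powRN lef_pV2 ?posrE; [|exact: powR_gt0|exact: powR_gt0].
by apply: ge0_ler_powR; rewrite // nnegrE ltW.
Qed.

Lemma powR_exprn (x p : R) n : 0 <= x -> (x ^+ n) `^ p = (x `^ p) ^+ n.
Proof.
by move=> x0; rewrite -(powR_mulrn n x0) powRAC powR_mulrn ?powR_ge0.
Qed.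

(** The geometric ratio is [2^(eps - k)]: below 1 the series converges, above 1 its last term, of
    size [L^(eps - k)], dominates, and at 1 the number of terms produces the logarithm. *)
Lemma dyadic_sum_le (eps k : R) : exists2 C : R, 0 < C & forall (L : R) K,
    1 <= L -> L <= 2 ^+ K -> 2 ^+ K < 2 * L ->
  L `^ (- eps) * (\sum_(j < K.+1) (2 `^ (eps - k)) ^+ j) <=
  C * L `^ (- Num.min eps k) * (if eps == k then ln (2 + L) else 1).
Proof.
pose q : R := 2 `^ (eps - k).
have q0 : 0 < q by exact: powR_gt0.
have ln2 : 0 < ln 2 :> R by rewrite ln_gt0// ltr1n.
case: (ltgtP eps k) => ek.
- have q1 : q < 1.
    by rewrite -(powRr0 2) /q /powR gt_eqF// ltr_expR ltr_pM2r// subr_lt0.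
  exists (1 - q)^-1; first by rewrite invr_gt0 subr_gt0.
  move=> L K L1 _ _; rewrite mulr1 mulrC ler_wpM2r ?powR_ge0//.
  by apply: geometric_sum_le => //; exact: ltW.
- have q1 : 1 < q.
    by rewrite -(powRr0 2) /q /powR gt_eqF// ltr_expR ltr_pM2r// subr_gt0.
  exists (q * (q / (q - 1))).
    by rewrite !mulr_gt0// invr_gt0 subr_gt0.
  move=> L K L1 LK KL; rewrite mulr1.
  have L0 : 0 < L by lra.
  have qK : q ^+ K <= q * L `^ (eps - k).
    rewrite -powR_exprn// /q -powRM//; last exact: ltW.
    apply: ge0_ler_powR; rewrite ?nnegrE ?subr_ge0 ?ltW//.
    by rewrite mulr_gt0.
  have -> : L `^ (- k) = L `^ (- eps) * L `^ (eps - k).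
    rewrite -powRD; last by rewrite (gt_eqF L0) implybT.
    by congr (_ `^ _); ring.
  rewrite mulrCA ler_wpM2l ?powR_ge0//.
  apply: le_trans (geometric_sum_le_gt1 _ q1) _.
  rewrite mulrAC ler_wpM2r// divr_ge0 ?subr_ge0 ?ltW//.
- exists (2 / ln 2); first by rewrite divr_gt0.
  move=> L K L1 LK KL; have L0 : 0 < L by lra.
  rewrite ek subrr powRr0; under eq_bigr do rewrite expr1n.
  rewrite sumr_const card_ord mulrC [X in _ <= X]mulrAC ler_wpM2r ?powR_ge0//.
  rewrite mulrAC ler_pdivlMr//.
  (* The [K + 1] equal terms are counted by [2^(K+1) < 4 L <= (2 + L)^2]. *)
  have -> : K.+1%:R * ln 2 = ln (2 ^+ K.+1) :> R.
    by rewrite lnXn// mulr_natl.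
  have -> : 2 * ln (2 + L) = ln ((2 + L) ^+ 2).
    by rewrite lnXn ?mulr_natl//; lra.
  rewrite ler_ln ?posrE ?exprn_gt0//; last by lra.
  rewrite exprS; nra.
Qed.

(* Dyadic decomposition: [2^j <= 2 L h] on the j-th layer, and [L <= L h] off the
   first [K] layers. *)
Lemma dyadic_pointwise (L h k : R) K : 0 < k -> 1 <= L -> L <= 2 ^+ K -> 0 <= h ->
  (1 + L * h) `^ (- k) <=
  \sum_(j < K.+1) 2 `^ k * (2 ^+ j) `^ (- k) * (h < 2 ^+ j / L)%R%:R + L `^ (- k).
Proof.
move=> k0 L1 LK h0.
have L0 : 0 < L by lra.
have Lh0 : 0 <= L * h by rewrite mulr_ge0// ltW.
have anti (x y : R) : 0 < x -> x <= y -> y `^ (- k) <= x `^ (- k).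
  by move=> x0 xy; apply: powRN_le => //; exact: ltW.
have t0 (j : nat) : 0 <= 2 `^ k * (2 ^+ j) `^ (- k) * (h < 2 ^+ j / L)%R%:R :> R.
  by rewrite !mulr_ge0 ?powR_ge0.
have [LhK|LhK] := leP (2 ^+ K) (L * h).
  apply: ler_wpDl; first by rewrite sumr_ge0// => j _; exact: t0.
  by apply: anti => //; lra.
have exj : exists j, L * h < 2 ^+ j by exists K.
case: (ex_minnP exj) => j Lhj minj.
have jK : (j < K.+1)%N by rewrite ltnS minj.
apply: ler_wpDr; first exact: powR_ge0.
rewrite (bigD1 (Ordinal jK))//=; apply: ler_wpDr.
  by rewrite sumr_ge0// => i _; exact: t0.
rewrite ltr_pdivlMr// (mulrC h L) Lhj mulr1.
case: j {jK} Lhj minj => [|j] Lhj minj.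
  rewrite expr0 powR1 mulr1; apply: (@le_trans _ _ (1 `^ (- k))).
    by apply: anti => //; lra.
  by rewrite powR1 -[X in X <= _](powRr0 2) ler_powR ?(ltW k0)// ler1n.
have -> : 2 `^ k * (2 ^+ j.+1) `^ (- k) = (2 ^+ j) `^ (- k) :> R.
  rewrite exprS powRM// mulrA -powRD; last by rewrite pnatr_eq0 implybT.
  by rewrite subrr powRr0 mul1r.
apply: anti; first exact: exprn_gt0.
have : 2 ^+ j <= L * h; last by lra.
by rewrite leNgt; apply/negP => /minj; rewrite ltnn.
Qed.

Context {d} {T : measurableType d} (mu : {measure set T -> \bar R}).

(** The constant is chosen before [w] and [h], so it is uniform over the linear forms to which this
    is applied later. For [L < 1] the total mass bound suffices; otherwise the dyadic bound is
    integrated layer by layer. *)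
Lemma layer_cake_decay (B M eps k : R) : 0 <= B -> 0 <= M -> 0 < eps -> 0 < k ->
  exists2 C : R, 0 < C & forall (w h : T -> R),
    measurable_fun setT w -> measurable_fun setT h -> (forall x, 0 <= w x) ->
    (\int[mu]_x (w x)%:E <= M%:E)%E ->
    (forall t, 0 < t ->
      (\int[mu]_x (w x * (`|h x| < t)%R%:R)%:E <= (B * t `^ eps)%:E)%E) ->
    forall L : R, 0 <= L ->
    (\int[mu]_x (w x * (1 + L * `|h x|) `^ (- k))%:E <=
     (C * (1 + L) `^ (- Num.min eps k) * (if eps == k then ln (2 + L) else 1))%:E)%E.
Proof.
move=> B0 M0 eps0 k0.
have [D D0 HD] := dyadic_sum_le eps k.
set mn := Num.min eps k.
have mn0 : 0 < mn by rewrite lt_min eps0.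
pose lg L : R := if eps == k then ln (2 + L) else 1.
have ln2 : 0 < ln 2 :> R by rewrite ln_gt0// ltr1n.
have lgln L : 0 <= L -> Num.min 1 (ln 2) <= lg L.
  move=> L0; rewrite /lg; case: ifP => _; last by rewrite ge_min lexx.
  by rewrite ge_min ler_ln ?posrE ?orbT//; lra.
(* A lower bound for the logarithmic factor, which lets terms without a logarithm be absorbed. *)
set c := Num.min 1 (ln 2) in lgln.
have c0 : 0 < c by rewrite lt_min ltr01.
pose E := 2 `^ k * B * D + M / c.
have E0 : 0 <= E by rewrite addr_ge0 ?mulr_ge0 ?powR_ge0 ?invr_ge0// ltW.
(* [2^mn] pays for replacing [L] by [1 + L], which is at most [2 L] when [L >= 1]. *)
exists ((E + 1) * 2 `^ mn); first by rewrite mulr_gt0 ?powR_gt0//; lra.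
move=> w h mw mh w0 wM wB L L0.
have anti (x y : R) : 0 < x -> x <= y -> y `^ (- mn) <= x `^ (- mn).
  by move=> x0 xy; apply: powRN_le => //; exact: ltW.
have half (x : R) : 0 < x -> x `^ (- mn) = 2 `^ mn * (2 * x) `^ (- mn).
  move=> x0; rewrite powRM// ?ltW// mulrA -powRD; last by rewrite pnatr_eq0 implybT.
  by rewrite subrr powRr0 mul1r.
have lg0 : c <= lg L by exact: lgln.
have lgp : 0 < lg L by exact: lt_le_trans lg0.
have mdec : measurable_fun setT (fun x => w x * (1 + L * `|h x|) `^ (- k)).
  apply: measurable_funM => //; apply: (measurableT_comp (f := fun y : R => y `^ (- k))).
    exact: measurable_powR.
  apply: measurable_funD => //; apply: measurable_funM => //.
  exact: (measurableT_comp (@normr_measurable R setT) mh).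
have dec0 x : 0 <= w x * (1 + L * `|h x|) `^ (- k) by rewrite mulr_ge0 ?powR_ge0.
have [L1|L1] := ltP L 1.
  apply: (@le_trans _ _ (\int[mu]_x (w x)%:E)%E).
    apply: ge0_le_integral => //.
    - by move=> x _; rewrite lee_fin.
    - exact/measurable_EFinP.
    - exact/measurable_EFinP.
    move=> x _; rewrite lee_fin ler_piMr//.
    rewrite powRN invf_le1 ?powR_gt0//; last by rewrite ltr_pwDl// mulr_ge0.
    rewrite -[X in X <= _](powRr0 (1 + L * `|h x|)) ler_powR ?(ltW k0)//.
    by rewrite lerDl mulr_ge0.
  apply: (le_trans wM); rewrite lee_fin -/(lg L).
  have h1 : 1 <= 2 `^ mn * (1 + L) `^ (- mn).
    have := half 1 ltr01; rewrite powR1 mulr1 => E1; rewrite [leLHS]E1.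
    by rewrite ler_wpM2l ?powR_ge0//; apply: anti; lra.
  have ME : M <= E * lg L.
    apply: (@le_trans _ _ (M / c * lg L)).
      by rewrite -mulrA ler_peMr// mulrC ler_pdivlMr// mul1r.
    rewrite ler_wpM2r ?(ltW lgp)// lerDr !mulr_ge0 ?powR_ge0//; exact: ltW.
  have -> : (E + 1) * 2 `^ mn * (1 + L) `^ (- mn) * lg L =
     ((E + 1) * lg L) * (2 `^ mn * (1 + L) `^ (- mn)) by ring.
  apply: (@le_trans _ _ ((E + 1) * lg L)).
    by rewrite mulrDl mul1r; lra.
  by rewrite ler_peMr// mulr_ge0 ?(ltW lgp)//; lra.
have [K LK KL] := dyadic_ceil L1.
have Lp : 0 < L by lra.
pose cj (j : nat) : R := 2 `^ k * (2 ^+ j) `^ (- k).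
have cj0 j : 0 <= cj j by rewrite mulr_ge0 ?powR_ge0.
pose F (j : nat) x : \bar R := ((cj j)%:E * (w x * (`|h x| < 2 ^+ j / L)%R%:R)%:E)%E.
have mS t : measurable_fun setT (fun x => w x * (`|h x| < t)%R%:R).
  rewrite (_ : (fun x => _) = (fun x => w x * \1_[set x | `|h x| < t] x)).
    apply: measurable_funM => //; apply: measurable_indic.
    exact: measurable_norm_lt.
  apply/funext => x; rewrite indicE; congr (_ * (nat_of_bool _)%:R).
  by apply/idP/idP => [H|]; [rewrite mem_set|rewrite inE].
have mF j : measurable_fun setT (F j).
  by apply: measurable_funeM; apply/measurable_EFinP; exact: mS.
have F0 j x : (0 <= F j x)%E by rewrite mule_ge0// lee_fin// mulr_ge0.
apply: (@le_trans _ _ (\int[mu]_x (\sum_(j < K.+1) F j x + (L `^ (- k))%:E * (w x)%:E))%E).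
  apply: ge0_le_integral => //.
  - by move=> x _; rewrite lee_fin.
  - exact/measurable_EFinP.
  - apply: emeasurable_funD; first by apply: emeasurable_sum.
    by apply: measurable_funeM; exact/measurable_EFinP.
  move=> x _; rewrite sumEFin -EFinM -EFinD lee_fin.
  apply: le_trans (ler_wpM2l (w0 x) (dyadic_pointwise k0 L1 LK (normr_ge0 (h x)))) _.
  rewrite mulrDr [w x * L `^ _]mulrC lerD2r mulr_sumr ler_sum// => j _.
  by rewrite /cj mulrCA.
rewrite ge0_integralD//; last first.
- by apply: measurable_funeM; exact/measurable_EFinP.
- by move=> x _; rewrite mule_ge0 ?lee_fin ?powR_ge0.
- by apply: emeasurable_sum.
- by move=> x _; rewrite sume_ge0.
rewrite ge0_integral_sum//.
apply: (@le_trans _ _ (\sum_(j < K.+1) (cj j * (B * (2 ^+ j / L) `^ eps))%:E + (L `^ (- k) * M)%:E)%E).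
  apply: leeD.
    apply: lee_sum => j _; rewrite ge0_integralZl ?lee_fin//; last first.
    - by move=> x _; rewrite lee_fin mulr_ge0.
    - exact/measurable_EFinP.
    rewrite [leRHS]EFinM; apply: lee_wpmul2l; first by rewrite lee_fin.
    by apply: wB; rewrite divr_gt0 ?exprn_gt0.
  rewrite ge0_integralZl ?lee_fin ?powR_ge0//; last first.
  - by move=> x _; rewrite lee_fin.
  - exact/measurable_EFinP.
  by rewrite [leRHS]EFinM; apply: lee_wpmul2l; rewrite ?lee_fin ?powR_ge0.
rewrite sumEFin -EFinD lee_fin -/(lg L).
have -> : \sum_(j < K.+1) cj j * (B * (2 ^+ j / L) `^ eps) =
    2 `^ k * B * (L `^ (- eps) * (\sum_(j < K.+1) (2 `^ (eps - k)) ^+ j)).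
  rewrite !mulr_sumr; apply: eq_bigr => j _.
  have -> : (2 ^+ j / L) `^ eps = (2 ^+ j) `^ eps * L `^ (- eps).
    rewrite powRM ?exprn_ge0// ?invr_ge0 ?(ltW Lp)//; congr (_ * _).
    by rewrite -(powR_inv1 (ltW Lp)) -powRrM mulN1r.
  rewrite -powR_exprn// powRD; last by rewrite expf_eq0 pnatr_eq0 andbF implybT.
  by rewrite /cj; ring.
have P0 : 0 <= 2 `^ k * B by rewrite mulr_ge0 ?powR_ge0.
have HDL := HD L K L1 LK KL; rewrite -/mn -/(lg L) in HDL.
set Lm := L `^ (- mn) in HDL *; have Lm0 : 0 <= Lm by exact: powR_ge0.
apply: (@le_trans _ _ (E * Lm * lg L)).
  rewrite /E !mulrDl; apply: lerD.
    have -> : 2 `^ k * B * D * Lm * lg L = (2 `^ k * B) * (D * Lm * lg L) by ring.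
    exact: ler_wpM2l.
  have -> : M / c * Lm * lg L = (Lm * M) * (lg L / c) by ring.
  have kmn : L `^ (- k) <= Lm.
    by rewrite /Lm ler_powR// lerN2 ge_min lexx orbT.
  apply: (@le_trans _ _ (Lm * M)); first exact: ler_wpM2r.
  by rewrite ler_peMr ?mulr_ge0// ler_pdivlMr// mul1r.
have LL : Lm <= 2 `^ mn * (1 + L) `^ (- mn).
  by rewrite /Lm half// ler_wpM2l ?powR_ge0//; apply: anti; lra.
have -> : (E + 1) * 2 `^ mn * (1 + L) `^ (- mn) * lg L =
  (E + 1) * (2 `^ mn * (1 + L) `^ (- mn)) * lg L by ring.
rewrite ler_wpM2r ?(ltW lgp)//; apply: ler_pM => //.
by rewrite lerDl.
Qed.

End dyadic_layers.

(** * Coefficients of the phase along an orbit *)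

Section exponents.
Context {R : realType} (n : nat) (a : 'I_n -> R).
Local Notation X := (lebesgue_rV_type R n).
Local Notation mu := (lebesgue_rV R n).
Hypothesis a_gt0 : forall i, 0 < a i.
Hypothesis a_neq1 : forall i, a i != 1.

Definition exponents : seq R := [seq y^-1 | y <- undup (codom a)].

Lemma exponents_uniq : uniq exponents.
Proof. by rewrite map_inj_uniq ?undup_uniq//; exact: invr_inj. Qed.

Lemma size_exponents : size exponents = distinct_values a.
Proof. by rewrite size_map. Qed.

Lemma mem_exponents i : (a i)^-1 \in exponents.
Proof. by apply: map_f; rewrite mem_undup codom_f. Qed.

Lemma exponents_neq0 : 0 \notin exponents.
Proof.
apply/mapP => -[y]; rewrite mem_undup => /codomP[i ->] /esym/eqP.
by rewrite invr_eq0 gt_eqF.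
Qed.

Lemma exponents_neq1 : 1 \notin exponents.
Proof.
apply/mapP => -[y]; rewrite mem_undup => /codomP[i ->] /esym/eqP.
by rewrite invr_eq1; apply/negP.
Qed.

Definition lin_coef (l : 'rV[R]_n) (y : R) (x : 'rV[R]_n) : R :=
  affine 0 (fun i => if (a i)^-1 == y then l 0 i else 0) x.

Lemma flow_lin_coef (l : 'rV[R]_n) (s : R) (x : 'rV[R]_n) :
  \sum_i l 0 i * (flow a s x : 'rV[R]_n) 0 i =
  \sum_(y <- exponents) lin_coef l y x * expR (y * s).
Proof.
rewrite /lin_coef /affine; under [RHS]eq_bigr do rewrite add0r mulr_suml.
rewrite exchange_big/=; apply: eq_bigr => i _.
rewrite (bigD1_seq (a i)^-1) ?mem_exponents ?exponents_uniq//= eqxx.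
rewrite big1 ?addr0 => [|y]; first by rewrite mxE; ring.
by rewrite eq_sym => /negbTE ->; rewrite !mul0r.
Qed.

Lemma measurable_lin_coef (l : 'rV[R]_n) (y : R) : lebesgue_measurable (lin_coef l y).
Proof. by apply: completion_measurable_funT; exact: measurable_affine. Qed.

Lemma lin_coef_sublevel (l : 'rV[R]_n) i (t : R) : l 0 i != 0 -> 0 <= t ->
  (mu (@cube R n `&` [set x | (`|lin_coef l (a i)^-1%R x| < t)%R]) <=
   (2 ^+ n * (t / `|l 0%R i|))%:E)%E.
Proof.
move=> li t0; set A := _ `&` _.
have mA : measurable (A : set (borel_rV R n)) by exact: measurable_affine_sublevel.
have -> : mu A = lebesgue_borel_rV R n A by exact: completionE.
have := @affine_sublevel R n 0 (fun j => if (a j)^-1 == (a i)^-1 then l 0 j else 0) i t.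
by rewrite eqxx; apply.
Qed.

Lemma lebesgue_rV_cube : (mu (@cube R n) <= (2 ^+ n)%:E)%E.
Proof.
have -> : mu (@cube R n) = lebesgue_borel_rV R n (@cube R n).
  by apply: completionE; exact: measurable_cube.
exact: lebesgue_borel_cube.
Qed.

Lemma compact_cube : compact (@cube R n).
Proof.
have seg : compact (`[-1, 1]%classic : set R) by exact: segment_compact.
exact: (@rV_compact R n (fun=> `[-1, 1]%classic) (fun=> seg)).
Qed.

Context (rho : R) (f g : 'rV[R]_n -> R).
Hypothesis n_ge1 : (1 <= n)%N.
Hypothesis f_meas : lebesgue_measurable f.
Hypothesis f_hom : mixed_homogeneous a f.
Hypothesis g_ge0 : forall x, 0 <= g x.
Hypothesis g_loc : locally_integrable_rV g.
Hypothesis g_hom : mixed_homogeneous_away0 a rho g.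
Local Notation v := (distinct_values a).
Local Notation cube_weight := (fun x => g x * \1_(@cube R n) x).

Lemma distinct_values_gt0 : (0 < v)%N.
Proof.
have i : 'I_n by case: (n) n_ge1 => // k _; exact: ord0.
by rewrite -size_exponents; have := mem_exponents i; case: exponents.
Qed.

(** No [a i] equals 1, so the exponent 1 belongs to [f] alone and no linear term is lost in the
    first case. *)
Definition phase_coef (l0 : R) (l : 'rV[R]_n) (y : R) (x : 'rV[R]_n) : R :=
  if y == 1 then l0 * f x else lin_coef l y x.

Lemma osc_integral_coef_decay : exists2 C : R, 0 < C &
  forall phi l0 l (beta I : R), beta \in 1 :: exponents -> admissible a g phi ->
  (\int[mu]_x (decay_weight g v.+1%:R^-1 (phase_coef l0 l beta) x)%:E <= I%:E)%E ->
  normc (osc_integral f phi l0 l) <= C * I.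
Proof.
have ual : uniq (1 :: exponents) by rewrite /= exponents_neq1 exponents_uniq.
have al0 : 0 \notin 1 :: exponents by rewrite inE eq_sym oner_eq0 exponents_neq0.
have [C C0 HC] := osc_integral_decay n_ge1 a_gt0 g_ge0 (proj1 g_loc) g_hom ual al0 isT.
exists C => // phi l0 l beta I betaal adm HI.
apply: (HC phi f l0 l (phase_coef l0 l) beta I adm f_meas betaal).
- rewrite /phase_coef; case: eqP => _; last exact: measurable_lin_coef.
  by apply: measurable_funM; [exact: measurable_cst|exact: f_meas].
- move=> s x; rewrite big_cons {1}/phase_coef eqxx mul1r flow_lin_coef; congr (_ + _).
    by rewrite -dilation_expR f_hom ?expR_gt0// mulrCA [RHS]mulrC.
  apply: eq_big_seq => y; rewrite /phase_coef; case: eqP => // -> y1.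
  by have := exponents_neq1; rewrite y1.
- by rewrite /= size_exponents.
Qed.

Lemma osc_integral0_lin_decay : exists2 C : R, 0 < C & forall i phi l (I : R),
  admissible a g phi ->
  (\int[mu]_x (decay_weight g v%:R^-1 (lin_coef l (a i)^-1%R) x)%:E <= I%:E)%E ->
  normc (osc_integral f phi 0 l) <= C * I.
Proof.
have sz : (0 < size exponents)%N by rewrite size_exponents distinct_values_gt0.
have [C C0 HC] := osc_integral_decay n_ge1 a_gt0 g_ge0 (proj1 g_loc) g_hom
  exponents_uniq exponents_neq0 sz.
exists C => // i phi l I adm HI.
apply: (HC phi f 0 l (lin_coef l) (a i)^-1 I adm f_meas).
- exact: mem_exponents.
- exact: measurable_lin_coef.
- by move=> s x; rewrite mul0r add0r flow_lin_coef.
- by rewrite size_exponents.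
Qed.

Lemma measurable_cube_weight : lebesgue_measurable cube_weight.
Proof.
apply: measurable_funM; first exact: (proj1 g_loc).
by apply: measurable_indic; exact: measurable_cube_completed.
Qed.

Lemma cube_weight_ge0 x : 0 <= cube_weight x.
Proof. by rewrite mulr_ge0. Qed.

Lemma mu_g_indic (A : set 'rV[R]_n) :
  mu_g g A = (\int[mu]_x (g x * \1_A x)%:E)%E.
Proof.
rewrite /mu_g integral_mkcond; apply: eq_integral => x _.
rewrite patchE indicE; case: ifPn => _; rewrite ?mulr1 ?mulr0//.
by rewrite ger0_norm.
Qed.

Lemma cube_weight_bound : exists2 M : R, 0 <= M &
  (\int[mu]_x (cube_weight x)%:E <= M%:E)%E.
Proof.
have := proj2 g_loc _ (@compact_cube); rewrite -/(mu_g g (@cube R n)) mu_g_indic.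
set I := (\int[mu]_x _)%E => Ioo.
have I0 : (0 <= I)%E by apply: integral_ge0 => x _; rewrite lee_fin cube_weight_ge0.
exists (fine I); first exact: fine_ge0.
by rewrite fineK// ge0_fin_numE.
Qed.

Lemma growth_decay (eps : R) : 0 < eps -> sublevel_growth f g eps ->
  exists2 C : R, 0 < C & forall phi, admissible a g phi ->
    forall (l0 : R) (l : 'rV[R]_n),
    normc (osc_integral f phi l0 l) <= C * (1 + `|l0|) `^ (- Num.min eps v.+1%:R^-1)
      * (if eps == v.+1%:R^-1 then ln (2 + `|l0|) else 1).
Proof.
move=> eps0 [B B0 HB]; have [C C0 HC] := osc_integral_coef_decay.
have [M M0 HM] := cube_weight_bound.
have k0 : 0 < v.+1%:R^-1 :> R by rewrite invr_gt0 ltr0n.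
have [D D0 HD] := layer_cake_decay mu (ltW B0) M0 eps0 k0.
exists (C * D); first exact: mulr_gt0.
move=> phi adm l0 l; rewrite -[C * D * _]mulrA -[C * _ * _]mulrA.
apply: (HC phi l0 l 1) => //; first by rewrite mem_head.
apply: (le_trans _ (HD _ f measurable_cube_weight f_meas cube_weight_ge0 HM _ _ (normr_ge0 _))).
  rewrite le_eqVlt; apply/orP; left; apply/eqP; apply: eq_integral => x _.
  by rewrite /decay_weight /phase_coef eqxx normrM.
move=> t t0; apply: le_trans (HB t t0).
rewrite mu_g_indic le_eqVlt; apply/orP; left; apply/eqP; apply: eq_integral => x _.
congr (_%:E); rewrite -mulrA; congr (_ * _).
rewrite indicI; congr (_ * (nat_of_bool _)%:R).
by apply/idP/idP => [h|]; [rewrite mem_set|rewrite inE].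
Qed.

End exponents.

(** * Decay in the linear phase *)

Section linear_form_decay.
Context {R : realType} (n : nat) (a : 'I_n -> R).
Local Notation X := (lebesgue_rV_type R n).
Local Notation mu := (lebesgue_rV R n).
Hypothesis a_gt0 : forall i, 0 < a i.
Hypothesis a_neq1 : forall i, a i != 1.
Local Notation lin_coef := (lin_coef a).

(* [h = L / l_i] is normalized to have sublevel sets of size [O(t)]; the junk
   choice [h = 1] handles [l_i = 0]. *)
Lemma cube_lin_decay (e : R) : 0 < e -> exists2 D : R, 0 < D &
  forall (l : 'rV[R]_n) i,
  (\int[mu]_x (\1_(@cube R n) x * (1 + `|lin_coef l (a i)^-1 x|) `^ (- e))%:E <=
   (D * (1 + `|l 0%R i|) `^ (- Num.min 1 e)
      * (if 1%R == e then ln (2 + `|l 0%R i|) else 1))%:E)%E.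
Proof.
move=> e0; have B0 : 0 <= 2 ^+ n :> R by rewrite exprn_ge0.
(* After normalization the sublevel sets grow linearly, so the growth exponent is 1; both the growth
   constant and the total mass are [2^n], whatever [l] is. *)
have [D D0 HD] := layer_cake_decay mu B0 B0 ltr01 e0.
exists D => // l i; set L := lin_coef l (a i)^-1.
pose h x : R := if l 0 i == 0 then 1 else L x / l 0 i.
have mL : lebesgue_measurable L by exact: measurable_lin_coef.
have mh : lebesgue_measurable h.
  rewrite /h; case: eqP => _; first exact: measurable_cst.
  by apply: measurable_funM; [exact: mL|exact: measurable_cst].
have mw : lebesgue_measurable (\1_(@cube R n) : 'rV[R]_n -> R).
  by apply: measurable_indic; exact: measurable_cube_completed.
have mint (c : 'rV[R]_n -> R) : lebesgue_measurable c ->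
    measurable_fun (setT : set X) (fun x => (\1_(@cube R n) x * (1 + `|c x|) `^ (- e))%:E).
  move=> mc; apply/measurable_EFinP; apply: measurable_funM; first exact: mw.
  exact: measurable_decay.
have w0 (x : 'rV[R]_n) : 0 <= \1_(@cube R n) x :> R by [].
have wM : (\int[mu]_x (\1_(@cube R n) x)%:E <= (2 ^+ n)%:E)%E.
  rewrite integral_indic; [|exact: measurableT|exact: measurable_cube_completed].
  by rewrite setIT; exact: lebesgue_rV_cube.
have wt (t : R) : 0 < t ->
    (\int[mu]_x (\1_(@cube R n) x * (`|h x| < t)%R%:R)%:E <= (2 ^+ n * t `^ 1)%:E)%E.
  move=> t0; rewrite powRr1 ?(ltW t0)//.
  have mt : measurable [set x : X | (`|h x| < t)%R] by exact: measurable_norm_lt.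
  rewrite (_ : (\int[mu]_x _)%E = mu (@cube R n `&` [set x | (`|h x| < t)%R])); last first.
    have mA : measurable (@cube R n `&` [set x | (`|h x| < t)%R] : set X).
      by apply: measurableI => //; exact: measurable_cube_completed.
    transitivity (\int[mu]_x (\1_(@cube R n `&` [set x | (`|h x| < t)%R]) x)%:E)%E; last first.
      by rewrite integral_indic; [rewrite setIT|exact: measurableT|exact: mA].
    apply: eq_integral => x _; rewrite indicI; congr ((_ * (nat_of_bool _)%:R)%:E).
    by apply/idP/idP => [H|]; [rewrite mem_set|rewrite inE].
  (* For [h = 1] the sublevel set is empty when [t <= 1] and the whole cube when [t > 1]; both fit
     the linear bound. *)
  have [li|li] := eqVneq (l 0 i) 0.
    have [t1|t1] := ltP 1 t.
      apply: (@le_trans _ _ (mu (@cube R n))).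
        apply: le_measure; rewrite ?inE; last exact: subIsetl.
          by apply: measurableI => //; exact: measurable_cube_completed.
        exact: measurable_cube_completed.
      by apply: (le_trans (@lebesgue_rV_cube R n)); rewrite lee_fin ler_peMr// ltW.
    rewrite (_ : _ `&` _ = set0) ?measure0 ?lee_fin ?mulr_ge0 ?(ltW t0)//.
    apply/seteqP; split => // x [_ /=].
    by rewrite /h li eqxx normr1 ltNge t1.
  rewrite (_ : [set x | (`|h x| < t)%R] = [set x | (`|L x| < t * `|l 0%R i|)%R]); last first.
    apply/seteqP; split => x /=; rewrite /h (negbTE li) normrM normfV ltr_pdivrMr ?normr_gt0//.
  have := @lin_coef_sublevel R n a l i (t * `|l 0 i|) li.
  rewrite mulfK ?normr_eq0//; apply.
  by rewrite mulr_ge0 ?(ltW t0).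
apply: le_trans (HD _ h mw mh w0 wM wt `|l 0 i| (normr_ge0 _)).
have mc' : lebesgue_measurable (fun x => `|l 0 i| * `|h x|).
  by apply: measurable_funM; [exact: measurable_cst|exact: (measurableT_comp (@normr_measurable R setT) mh)].
apply: ge0_le_integral; first exact: measurableT.
- by move=> x _; rewrite lee_fin mulr_ge0 ?powR_ge0.
- exact: mint.
- have := mint _ mc'; under eq_fun do rewrite ger0_norm ?mulr_ge0//; exact.
- move=> x _; rewrite lee_fin; apply: ler_wpM2l => //; apply: powRN_le.
  + by rewrite ltr_pwDl// mulr_ge0.
  + rewrite lerD2l /h; case: eqP => [->|/eqP li]; first by rewrite normr0 mul0r.
    by rewrite normrM normfV mulrCA mulfV ?mulr1// normr_eq0.
  + exact: ltW.
Qed.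

Context (g : 'rV[R]_n -> R).
Hypothesis g_ge0 : forall x, 0 <= g x.
Hypothesis g_loc : locally_integrable_rV g.
Local Notation cube_weight := (fun x => g x * \1_(@cube R n) x).
Local Notation cube_decay k l i :=
  (fun x => \1_(@cube R n) x * (1 + `|lin_coef l (a i)^-1 x|) `^ (- k)).

Lemma decay_weight_split k l i x : decay_weight g k (lin_coef l (a i)^-1) x =
  cube_weight x * cube_decay k l i x.
Proof.
rewrite /decay_weight indicE.
by case: (_ \in _); rewrite ?mulr1 ?mul1r ?mulr0 ?mul0r.
Qed.

Lemma measurable_cube_decay k l i : lebesgue_measurable (cube_decay k l i).
Proof.
apply: measurable_funM; first by apply: measurable_indic; exact: measurable_cube_completed.
by apply: measurable_decay; exact: measurable_lin_coef.
Qed.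

(** In the L^q norm the decay factor has exponent [k * q]. The q-th root turns [min 1 (k * q)] into
    [min (1/q) k], and in the critical case [k * q = 1] it turns the logarithm into its k-th
    power. *)
Lemma hoelder_lin_decay (r q k : R) : 0 < r -> 0 < q -> r^-1 + q^-1 = 1 -> 0 < k ->
  Lp_cube r%:E g -> exists2 C : R, 0 < C & forall l i,
  (\int[mu]_x (decay_weight g k (lin_coef l (a i)^-1) x)%:E <=
   (C * (1 + `|l 0%R i|) `^ (- Num.min q^-1 k)
      * (if q == k^-1%R then ln (2 + `|l 0%R i|) `^ k else 1))%:E)%E.
Proof.
move=> r0 q0 rq k0 [mg gfin].
have kq0 : 0 < k * q by exact: mulr_gt0.
have [D D0 HD] := cube_lin_decay kq0.
rewrite /finite_norm in gfin; set NG := (Lnorm _ _ _) in gfin.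
have NG0 : (0 <= NG)%E by exact: Lnorm_ge0.
pose G := fine NG; have G0 : 0 <= G by exact: fine_ge0.
have GE : NG = G%:E by rewrite fineK// ge0_fin_numE.
exists ((G + 1) * D `^ q^-1); first by rewrite mulr_gt0 ?powR_gt0//; lra.
move=> l i; set lam := `|l 0 i|; have lam0 : 0 <= lam by exact: normr_ge0.
pose lg : R := if 1 == k * q then ln (2 + lam) else 1.
pose Z : R := D * (1 + lam) `^ (- Num.min 1 (k * q)) * lg.
have ln0 : 0 <= ln (2 + lam) by rewrite ln_ge0//; lra.
have lg0 : 0 <= lg by rewrite /lg; case: ifP.
have Z0 : 0 <= Z by rewrite !mulr_ge0 ?powR_ge0// ltW.
have mc : lebesgue_measurable (cube_decay k l i) by exact: measurable_cube_decay.
have c0 x : 0 <= cube_decay k l i x by rewrite mulr_ge0 ?powR_ge0.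
have H := hoelder mu mg mc r0 q0 rq; rewrite -/NG GE in H.
apply: (@le_trans _ _ (Lnorm mu 1 (EFin \o (cube_weight \* cube_decay k l i)%R))).
  rewrite Lnorm1 le_eqVlt; apply/orP; left; apply/eqP; apply: eq_integral => x _.
  have := mulr_ge0 (mulr_ge0 (g_ge0 x) (ler0n R (x \in @cube R n))) (c0 x).
  by rewrite decay_weight_split/= indicE => /ger0_norm ->.
apply: (le_trans H).
have NZ : (Lnorm mu q%:E (EFin \o cube_decay k l i) <= (Z `^ q^-1)%:E)%E.
  rewrite unlock; set J := (\int[mu]_x _)%E.
  have J0 : (0 <= J)%E by apply: integral_ge0 => x _; exact: poweR_ge0.
  have JZ : (J <= Z%:E)%E.
    apply: le_trans (HD l i); rewrite le_eqVlt; apply/orP; left; apply/eqP.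
    apply: eq_integral => x _; rewrite /= ger0_norm//; congr (_%:E).
    rewrite powRM ?powR_ge0// -powRrM mulNr; congr (_ * _).
    by rewrite indicE; case: (_ \in _); rewrite ?powR1// powR0// gt_eqF.
  move: J0 JZ; case: J => [j| |]//; rewrite !lee_fin => j0 jZ.
  apply: ge0_ler_powR; rewrite ?nnegrE ?invr_ge0 ?(ltW q0)//.
apply: (@le_trans _ _ ((G + 1)%:E * (Z `^ q^-1)%:E)%E).
  apply: lee_pmul => //; first exact: Lnorm_ge0.
  by rewrite lee_fin; lra.
rewrite -EFinM lee_fin -!mulrA ler_wpM2l//; first by lra.
rewrite /Z !powRM ?mulr_ge0 ?powR_ge0 ?(ltW D0)// -mulrA ler_wpM2l ?powR_ge0//.
rewrite -powRrM; apply: ler_pM; rewrite ?powR_ge0//.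
  rewrite le_eqVlt; apply/orP; left; apply/eqP; congr (_ `^ _).
  rewrite mulNr; congr (- _).
  have E : k * q / q = k by rewrite mulfK ?gt_eqF.
  have [h|h] := leP 1 (k * q); have [h'|h'] := leP q^-1 k; rewrite ?E ?mul1r//.
    by move: h'; rewrite -(ltr_pM2r q0) mulVf ?gt_eqF// ltNge h.
  by move: h'; rewrite -(ler_pM2r q0) mulVf ?gt_eqF// leNgt h.
rewrite /lg; have -> : (q == k^-1) = (1 == k * q).
  apply/eqP/eqP => [->|kq]; first by rewrite mulfV ?gt_eqF.
  by apply: (mulfI (lt0r_neq0 k0)); rewrite -kq mulfV ?gt_eqF.
case: eqP => [kq|_]; last by rewrite powR1.
rewrite le_eqVlt; apply/orP; left; apply/eqP; congr (_ `^ _).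
by apply: (mulIf (lt0r_neq0 q0)); rewrite mulVf ?gt_eqF// -kq.
Qed.

Lemma bounded_lin_decay (S k : R) : 0 <= S -> 0 < k ->
  {ae mu, forall x : X, cube_weight x <= S} -> exists2 C : R, 0 < C & forall l i,
  (\int[mu]_x (decay_weight g k (lin_coef l (a i)^-1) x)%:E <=
   (C * (1 + `|l 0%R i|) `^ (- Num.min 1 k)
      * (if 1%R == k then ln (2 + `|l 0%R i|) else 1))%:E)%E.
Proof.
move=> S0 k0 wS; have [D D0 HD] := cube_lin_decay k0.
exists ((S + 1) * D); first by rewrite mulr_gt0//; lra.
move=> l i; have mc : lebesgue_measurable (cube_decay k l i) by exact: measurable_cube_decay.
have c0 x : 0 <= cube_decay k l i x by rewrite mulr_ge0 ?powR_ge0.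
have mL : lebesgue_measurable (lin_coef l (a i)^-1) by exact: measurable_lin_coef.
apply: (@le_trans _ _ ((S + 1)%:E * \int[mu]_x (cube_decay k l i x)%:E)%E); last first.
  rewrite -!mulrA [leRHS]EFinM; apply: lee_wpmul2l; first by rewrite lee_fin; lra.
  by rewrite !mulrA; exact: HD.
rewrite -ge0_integralZl; last first.
- by rewrite lee_fin; lra.
- by move=> x _; rewrite lee_fin.
- exact/measurable_EFinP.
- exact: measurableT.
apply: ae_ge0_le_integral; first exact: measurableT.
- by move=> x _; rewrite lee_fin decay_weight_ge0.
- by apply/measurable_EFinP; exact: (measurable_decay_weight (proj1 g_loc)).
- by move=> x _; rewrite -EFinM lee_fin mulr_ge0//; lra.
- apply/measurable_EFinP; apply: measurable_funM; [exact: measurable_cst|exact: mc].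
case: wS => N [mN N0 HN]; exists N; split => // x /= Hx; apply: HN => /= wx; apply: Hx => _.
rewrite -EFinM lee_fin decay_weight_split ler_wpM2r//; lra.
Qed.

Lemma Lp_lin_decay (p : \bar R) (k : R) : (1 <= p)%E -> Lp_cube p g -> 0 < k ->
  exists2 C : R, 0 < C & forall l i,
  (\int[mu]_x (decay_weight g k (lin_coef l (a i)^-1) x)%:E <=
   (C * (1 + `|l 0%R i|) `^ (- Num.min (fine ((hoelder_conjugate p)^-1)%E) k)
      * (if hoelder_conjugate p == (k^-1)%:E then ln (2 + `|l 0%R i|) `^ k else 1))%:E)%E.
Proof.
move=> p1 gp k0; case: p p1 gp => [r| |] p1 gp; last by [].
- move: p1; rewrite lee_fin le_eqVlt => /predU1P[r1|r1].
    (* For [p = 1] the exponent is [min 0 k = 0], and the mass of [g] on the cube is enough. *)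
    have [M M0 HM] := cube_weight_bound g_ge0 g_loc.
    exists (M + 1); first lra.
    move=> l i; rewrite -r1 hoelder_conjugate1/= (min_l (ltW k0)) oppr0 powRr0 !mulr1.
    have mL : lebesgue_measurable (lin_coef l (a i)^-1) by exact: measurable_lin_coef.
    apply: (@le_trans _ _ (\int[mu]_x (cube_weight x)%:E)%E); last first.
      by apply: (le_trans HM); rewrite lee_fin; lra.
    apply: ge0_le_integral; first exact: measurableT.
    + by move=> x _; rewrite lee_fin decay_weight_ge0.
    + by apply/measurable_EFinP; exact: (measurable_decay_weight (proj1 g_loc)).
    + by apply/measurable_EFinP; exact: (measurable_cube_weight g_loc).
    + move=> x _; rewrite lee_fin /decay_weight ler_piMr ?mulr_ge0//.
      by apply: le_trans (powRN_le ltr01 _ (ltW k0)) _; rewrite ?lerDl// powR1.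
  have r0 : 0 < r by lra.
  have rm : 0 < r - 1 by lra.
  pose q := r / (r - 1); have q0 : 0 < q by exact: divr_gt0.
  have hq : hoelder_conjugate r%:E = q%:E.
    by rewrite /hoelder_conjugate/= eqe gt_eqF// inver subr_eq0 gt_eqF.
  have rq : r^-1 + q^-1 = 1 by rewrite /q; field; lra.
  have [C C0 HC] := hoelder_lin_decay r0 q0 rq k0 gp.
  exists C => // l i; rewrite hq inver gt_eqF//= eqe; exact: HC.
have [S S0 HS] : exists2 S : R, 0 <= S & {ae mu, forall x : X, cube_weight x <= S}.
  case: gp => mg; rewrite /finite_norm unlock; case: ifPn => [_ goo|mu0 _].
    have [S [S0 HS]] : exists S : R, 0 <= S /\
        (ess_sup mu (abse \o (EFin \o cube_weight)) <= S%:E)%E.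
      move: goo; case: (ess_sup _ _) => [s _| |_]//.
        by exists `|s|; rewrite lee_fin ler_norm.
      by exists 0; rewrite leNye.
    exists S => //; have := ess_sup_ge mu (abse \o (EFin \o cube_weight)).
    case=> N [mN N0 HN]; exists N; split => // x /= Hx; apply: HN => /= wx; apply: Hx.
    have := le_trans wx HS; rewrite lee_fin; apply: le_trans; exact: ler_norm.
  (* The norm for [p = +oo] is 0 by convention when the whole space is null; every property then
     holds almost everywhere. *)
  exists 0 => //; exists setT; split => //.
  by apply/eqP; rewrite eq_le measure_ge0 andbT leNgt.
have [C C0 HC] := bounded_lin_decay S0 k0 HS.
exists C => // l i; rewrite hoelder_conjugatey inve1 /=.
apply: (le_trans (HC l i)); rewrite lee_fin.
have -> : (1%E == (k^-1)%:E :> \bar R) = (1 == k).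
  by rewrite eqe eq_sym invr_eq1 eq_sym.
case: eqP => // k1; rewrite -k1 powRr1// ln_ge0//.
by have := normr_ge0 (l 0 i); lra.
Qed.

End linear_form_decay.

(** * Decay in the magnitude of lambda' *)

Section norm_decay.
Context {R : realType} (n : nat) (a : 'I_n -> R) (rho : R) (f g : 'rV[R]_n -> R).
Local Notation mu := (lebesgue_rV R n).
Hypothesis n_ge1 : (1 <= n)%N.
Hypothesis a_gt0 : forall i, 0 < a i.
Hypothesis a_neq1 : forall i, a i != 1.
Hypothesis f_meas : lebesgue_measurable f.
Hypothesis f_hom : mixed_homogeneous a f.
Hypothesis g_ge0 : forall x, 0 <= g x.
Hypothesis g_loc : locally_integrable_rV g.
Hypothesis g_hom : mixed_homogeneous_away0 a rho g.
Local Notation v := (distinct_values a).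

Lemma coord_le_enorm (l : 'rV[R]_n) i : `|l 0 i| <= enorm l.
Proof.
rewrite /enorm -sqrtr_sqr ler_wsqrtr// (bigD1 i)//= lerDl sumr_ge0// => j _.
exact: sqr_ge0.
Qed.

Lemma enorm_le_max (l : 'rV[R]_n) : exists i, enorm l <= n%:R * `|l 0 i|.
Proof.
have i0 : 'I_n by case: (n) n_ge1 => // k _; exact: ord0.
have [i _ imax] := @arg_maxP _ _ _ i0 xpredT (fun i => `|l 0 i|) isT.
exists i; rewrite /enorm -[leRHS]ger0_norm ?mulr_ge0// -sqrtr_sqr ler_wsqrtr//.
apply: (@le_trans _ _ (\sum_(j < n) `|l 0 i| ^+ 2)).
  apply: ler_sum => j _; rewrite -(real_normK (num_real (l 0 j))).
  by rewrite lerXn2r ?nnegrE//; exact: imax.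
rewrite sumr_const card_ord -[leLHS]mulr_natl exprMn ler_wpM2r ?sqr_ge0//.
by rewrite expr2 ler_peMr// ler1n.
Qed.

Lemma fine_conjugate_ge0 (p : \bar R) : (1 <= p)%E ->
  0 <= fine ((hoelder_conjugate p)^-1)%E.
Proof.
move=> /hoelder_conj_ge1; case: hoelder_conjugate => [r| |]//=.
rewrite lee_fin => r1; rewrite inver gt_eqF/=; last exact: lt_le_trans r1.
by rewrite invr_ge0 (le_trans _ r1).
Qed.

Lemma coord_decay_le (D m k : R) (b : bool) (l : 'rV[R]_n) i : 0 <= D ->
  0 <= m <= 1 -> 0 <= k -> enorm l <= n%:R * `|l 0 i| ->
  D * (1 + `|l 0 i|) `^ (- m) * (if b then ln (2 + `|l 0 i|) `^ k else 1) <=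
  D * n%:R * (1 + enorm l) `^ (- m) * (if b then ln (2 + enorm l) `^ k else 1).
Proof.
move=> D0 m01 k0 hi.
have e0 : 0 <= enorm l by exact: sqrtr_ge0.
have n1 : 1 <= n%:R :> R by rewrite ler1n.
apply: ler_pM; rewrite ?mulr_ge0 ?powR_ge0//; first by case: b; rewrite ?powR_ge0.
  rewrite -mulrA ler_wpM2l//; apply: powR_shift_le => //.
  by rewrite mulrDr mulr1 lerD.
case: b => //; have ci := coord_le_enorm l i.
have c0 : 0 <= `|l 0 i| by [].
have l1 : 0 <= ln (2 + `|l 0 i|) by rewrite ln_ge0//; lra.
have l2 : ln (2 + `|l 0 i|) <= ln (2 + enorm l) by rewrite ler_ln ?posrE; lra.
by apply: ge0_ler_powR; rewrite // nnegrE (le_trans l1).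
Qed.

(** The coefficient kept is the one at the exponent of a coordinate with [|l_i|] maximal, hence
    comparable to the norm of [l]. It may collect other coordinates with the same exponent, but its
    sublevel bound involves [l_i] only. *)
Lemma Lp_decay (p : \bar R) : (1 <= p)%E -> Lp_cube p g ->
  exists2 C : R, 0 < C & forall phi, admissible a g phi ->
    forall (l0 : R) (l : 'rV[R]_n),
    normc (osc_integral f phi l0 l) <=
    C * (1 + enorm l) `^ (- Num.min (fine ((hoelder_conjugate p)^-1)%E) v.+1%:R^-1)
      * (if hoelder_conjugate p == (v.+1%:R)%:E then ln (2 + enorm l) `^ v.+1%:R^-1 else 1).
Proof.
move=> p1 gp.
have k0 : 0 < v.+1%:R^-1 :> R by rewrite invr_gt0 ltr0n.
have [C C0 HC] := osc_integral_coef_decay a_gt0 a_neq1 n_ge1 f_meas f_hom g_ge0 g_loc g_hom.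
have [D D0 HD] := Lp_lin_decay a g_ge0 g_loc p1 gp k0.
exists (C * D * n%:R); first by rewrite !mulr_gt0// ltr0n.
move=> phi adm l0 l; have [i hi] := enorm_le_max l.
apply: le_trans (coord_decay_le _ _ _ _ hi); last 3 first.
- by rewrite mulr_ge0 ?ltW.
- rewrite le_min fine_conjugate_ge0// ltW//= ge_min.
  by rewrite invf_le1 ?ltr0n// ler1n orbT.
- exact: ltW.
rewrite -[C * D * _]mulrA -[C * _ * _]mulrA; apply: (HC phi l0 l (a i)^-1) => //.
  by rewrite inE mem_exponents orbT.
have := HD l i; rewrite invrK; apply: le_trans.
rewrite le_eqVlt; apply/orP; left; apply/eqP; apply: eq_integral => x _.
by rewrite /phase_coef /decay_weight invr_eq1 (negbTE (a_neq1 i)).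
Qed.

Lemma Lp_decay0 (p : \bar R) : (1 <= p)%E -> Lp_cube p g ->
  exists2 C : R, 0 < C & forall phi, admissible a g phi ->
    forall (l : 'rV[R]_n),
    normc (osc_integral f phi 0 l) <=
    C * (1 + enorm l) `^ (- Num.min (fine ((hoelder_conjugate p)^-1)%E) v%:R^-1)
      * (if hoelder_conjugate p == (v%:R)%:E then ln (2 + enorm l) `^ v%:R^-1 else 1).
Proof.
move=> p1 gp; have v0 : (0 < v)%N by exact: distinct_values_gt0.
have k0 : 0 < v%:R^-1 :> R by rewrite invr_gt0 ltr0n.
have i0 : 'I_n by case: (n) n_ge1 => // k _; exact: ord0.
have [D D0 HD] := Lp_lin_decay a g_ge0 g_loc p1 gp k0.
have [C C0 HC] := osc_integral0_lin_decay a_gt0 n_ge1 f_meas g_ge0 g_loc g_hom.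
exists (C * D * n%:R); first by rewrite !mulr_gt0// ltr0n.
move=> phi adm l; have [i hi] := enorm_le_max l.
apply: le_trans (coord_decay_le _ _ _ _ hi); last 3 first.
- by rewrite mulr_ge0 ?ltW.
- rewrite le_min fine_conjugate_ge0// ltW//= ge_min.
  by rewrite invf_le1 ?ltr0n// ler1n v0 orbT.
- exact: ltW.
rewrite -[C * D * _]mulrA -[C * _ * _]mulrA; apply: (HC i) => //.
by have := HD l i; rewrite invrK.
Qed.

End norm_decay.

(** * The converse *)

Section positive_part_square.
Context {R : realType}.

(** The positive part has a corner at 0, its square does not: the difference quotient is within
    [|h|] of the claimed derivative. *)
Lemma is_derive_pos_sqr (u : R) :
  is_derive u 1 (fun u : R => Num.max u 0 ^+ 2) (2 * Num.max u 0).
Proof.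
have H : h^-1 * (Num.max (h + u) 0 ^+ 2 - Num.max u 0 ^+ 2) @[h --> (0 : R)^'] --> 2 * Num.max u 0.
  apply/cvgrPdist_le => e e0; near=> h.
  have h0 : h != 0 by near: h; exact: nbhs_dnbhs_neq.
  have he : `|h| <= e.
    near: h; apply: dnbhs0_le.
    exact: e0.
  apply: le_trans he.
  have -> : 2 * Num.max u 0 - h^-1 * (Num.max (h + u) 0 ^+ 2 - Num.max u 0 ^+ 2) =
    (2 * Num.max u 0 * h - (Num.max (h + u) 0 ^+ 2 - Num.max u 0 ^+ 2)) / h by field.
  rewrite normrM normfV ler_pdivrMr ?normr_gt0// -normrM -expr2 ler_norml.
  rewrite ger0_norm ?sqr_ge0//.
  by have [p|p] := leP (h + u) 0; have [q|q] := leP u 0; apply/andP; split; nra.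
have E : (fun h : R => h^-1 *: (((fun u : R => Num.max u 0 ^+ 2) \o shift u) (h *: (1:R)) - Num.max u 0 ^+ 2)) =
  (fun h => h^-1 * (Num.max (h + u) 0 ^+ 2 - Num.max u 0 ^+ 2)).
  by apply/funext => h; rewrite /= /GRing.scale/= mulr1.
apply: DeriveDef; first by rewrite /derivable E; apply/cvg_ex; exists (2 * Num.max u 0); exact: H.
by rewrite /derive E; apply: cvg_lim => //; exact: H.
Unshelve. all: by end_near. Qed.

Lemma pos_part_continuous : continuous (fun u : R => Num.max u 0).
Proof.
by move=> u; apply: continuous_max; [exact: cvg_id|exact: cvg_cst].
Qed.

End positive_part_square.

(** * An admissible function built from g *)

Section bump.
Context {R : realType} (n : nat) (a : 'I_n -> R) (rho : R) (g : 'rV[R]_n -> R).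
Local Notation X := (lebesgue_rV_type R n).
Local Notation mu := (lebesgue_rV R n).
Hypothesis n_ge1 : (1 <= n)%N.
Hypothesis a_gt0 : forall i, 0 < a i.
Hypothesis g_ge0 : forall x, 0 <= g x.
Hypothesis g_loc : locally_integrable_rV g.
Hypothesis g_hom : mixed_homogeneous_away0 a rho g.
Implicit Type x : 'rV[R]_n.

(** The outer square makes the cut-off C1 across the unit sphere, as admissibility requires along
    orbits. *)
Definition bump_profile x : R := Num.max (1 - \sum_i x 0 i ^+ 2) 0 ^+ 2.

(* With this factor the Euler derivative of [bump_norm * g * (1 - |x|^2)_+^2] is
   at most [g]: homogeneity turns the derivative of [g] into [rho * g]. *)
Definition bump_norm : R := (1 + `|rho| + 4 * hom_dim a)^-1.

Definition bump_amplitude x : R := bump_norm * (g x * bump_profile x).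

Lemma hom_dim_ge0 : 0 <= hom_dim a.
Proof. by apply: sumr_ge0 => i _; rewrite invr_ge0 ltW. Qed.

Lemma bump_norm_gt0 : 0 < bump_norm.
Proof.
by rewrite invr_gt0; have := hom_dim_ge0; have := normr_ge0 rho; lra.
Qed.

Lemma bump_norm_le1 : bump_norm <= 1.
Proof.
have := hom_dim_ge0; have := normr_ge0 rho => r0 q0.
by rewrite invf_le1; lra.
Qed.

Lemma sqr_sum_ge0 x : 0 <= \sum_i x 0 i ^+ 2.
Proof. by apply: sumr_ge0 => i _; exact: sqr_ge0. Qed.

Lemma bump_ge0 x : 0 <= bump_profile x.
Proof. exact: sqr_ge0. Qed.

Lemma bump_le1 x : bump_profile x <= 1.
Proof.
rewrite /bump_profile -[leRHS](expr1n _ 2) lerXn2r ?nnegrE//; first by rewrite le_max lexx orbT.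
by rewrite ge_max ler01 andbT; have := sqr_sum_ge0 x; lra.
Qed.

Lemma bump_support x : ~ @cube R n x \/ 1 < enorm x -> bump_profile x = 0.
Proof.
move=> H; rewrite /bump_profile max_r ?expr0n// subr_le0.
have {H} : 1 < enorm x.
  by case: H => // /(@flow_cube_enorm _ _ a a_gt0 0 _ (lexx _)); rewrite flow0.
by move=> e1; rewrite -(sqr_sqrtr (sqr_sum_ge0 x)) expr_ge1 ?sqrtr_ge0// ltW.
Qed.

Lemma bump_amplitude_ge0 x : 0 <= bump_amplitude x.
Proof. apply: mulr_ge0; [exact: ltW bump_norm_gt0|exact: mulr_ge0 (g_ge0 x) (bump_ge0 x)]. Qed.

Lemma bump_amplitude_le x : bump_amplitude x <= g x * \1_(@cube R n) x.
Proof.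
rewrite /bump_amplitude indicE; have [xc|xc] := boolP (x \in @cube R n).
  rewrite mulr1; apply: le_trans (_ : 1 * (g x * bump_profile x) <= _).
    by rewrite ler_wpM2r ?bump_norm_le1// mulr_ge0 ?bump_ge0.
  by rewrite mul1r ler_piMr ?bump_le1.
rewrite bump_support ?mulr0//; left => h; move/negP: xc; apply.
by rewrite inE.
Qed.

Lemma measurable_bump_amplitude : lebesgue_measurable bump_amplitude.
Proof.
apply: measurable_funM; first exact: measurable_cst.
apply: measurable_funM; first exact: (proj1 g_loc).
apply: completion_measurable_funT.
apply: measurable_funX; apply: measurable_maxr => //.
apply: measurable_funB => //; apply: measurable_sum => i.
by apply: measurable_funX; exact: measurable_coord_rV.
Qed.

Lemma integrable_bump_amplitude :
  mu.-integrable setT (EFin \o (bump_amplitude : X -> R)).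
Proof.
apply/integrableP; split; first exact/measurable_EFinP/measurable_bump_amplitude.
have [M M0 HM] := cube_weight_bound g_ge0 g_loc.
apply: (@le_lt_trans _ _ M%:E); last exact: ltry.
apply: le_trans HM; apply: ge0_le_integral; first exact: measurableT.
- by move=> x _; exact: abse_ge0.
- apply: measurableT_comp; first exact: abse_measurable.
  exact/measurable_EFinP/measurable_bump_amplitude.
- exact/measurable_EFinP/(measurable_cube_weight g_loc).
- move=> x _; rewrite /= ger0_norm ?bump_amplitude_ge0// lee_fin.
  exact: bump_amplitude_le.
Qed.

Definition orbit_sqr x (t : R) : R := 1 - \sum_i (t `^ (a i)^-1 * x 0 i) ^+ 2.

Definition orbit_sqr' x (t : R) : R :=
  - \sum_i 2 * ((t `^ (a i)^-1 * x 0 i) * ((a i)^-1 * t `^ ((a i)^-1 - 1) * x 0 i)).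

Lemma is_derive_orbit_sqr x (t : R) : 0 < t ->
  is_derive t 1 (orbit_sqr x) (orbit_sqr' x t).
Proof.
move=> t0.
have h i : is_derive t 1 (fun t => t `^ (a i)^-1 * x 0 i) ((a i)^-1 * t `^ ((a i)^-1 - 1) * x 0 i).
  apply: is_derive_eq (is_derive_mulf (is_derive1_powR (a i)^-1 t0) (is_derive_cst (x 0 i) t 1)) _.
  by rewrite mulr0 addr0.
have hS : is_derive t 1 (fun t => \sum_i (t `^ (a i)^-1 * x 0 i) ^+ 2)
    (\sum_i 2 * ((t `^ (a i)^-1 * x 0 i) * ((a i)^-1 * t `^ ((a i)^-1 - 1) * x 0 i))).
  apply: (@is_derive_sumf _ _ _ (fun i t => (t `^ (a i)^-1 * x 0 i) ^+ 2)
    (fun i t => 2 * ((t `^ (a i)^-1 * x 0 i) * ((a i)^-1 * t `^ ((a i)^-1 - 1) * x 0 i)))) => i _.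
  rewrite (_ : (fun t => _) = fun t => (t `^ (a i)^-1 * x 0 i) * (t `^ (a i)^-1 * x 0 i)).
    by apply: is_derive_eq (is_derive_mulf (h i) (h i)) _; ring.
  by apply/funext => u; rewrite expr2.
apply: is_derive_eq (is_derive_subf (is_derive_cst (1 : R) t 1) hS) _.
exact: sub0r.
Qed.

(** Homogeneity replaces [g] on the orbit by [t^rho * g x], so [g] itself is never differentiated.
    The match with the bump is used for [t > 0] only. *)
Definition orbit_bump x (t : R) : R :=
  bump_norm * g x * (t `^ rho * Num.max (orbit_sqr x t) 0 ^+ 2).

Definition orbit_bump' x (t : R) : R :=
  bump_norm * g x * (rho * t `^ (rho - 1) * Num.max (orbit_sqr x t) 0 ^+ 2 +
    t `^ rho * (2 * Num.max (orbit_sqr x t) 0 * orbit_sqr' x t)).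

Lemma bump_orbitE x (t : R) : 0 < t -> x != 0 ->
  bump_amplitude (dilation a t x) = orbit_bump x t.
Proof.
move=> t0 x0; rewrite /bump_amplitude g_hom// /bump_profile /orbit_bump /orbit_sqr.
under eq_bigr do rewrite mxE.
by ring.
Qed.

Lemma is_derive_orbit_bump x (t : R) : 0 < t ->
  is_derive t 1 (orbit_bump x) (orbit_bump' x t).
Proof.
move=> t0; apply: is_derive_mulfl; apply: is_derive_mulf; first exact: is_derive1_powR.
exact: (@is_derive1_comp _ _ _ t _ _ (is_derive_pos_sqr _) (is_derive_orbit_sqr x t0)).
Qed.

Lemma orbit_bump'_continuous x (t : R) : 0 < t -> {for t, continuous (orbit_bump' x)}.
Proof.
move=> t0.
have cP (p : R) : {for t, continuous (fun u : R => u `^ p)}.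
  exact: is_derive_continuous (is_derive1_powR p t0).
have cS : {for t, continuous (fun u => Num.max (orbit_sqr x u) 0)}.
  apply: (@continuous_comp _ _ _ (orbit_sqr x) (fun u : R => Num.max u 0)).
    exact: is_derive_continuous (is_derive_orbit_sqr x t0).
  exact: pos_part_continuous.
have cC (k : R) : {for t, continuous (fun _ : R => k)} by exact: cvg_cst.
have cS' : {for t, continuous (orbit_sqr' x)}.
  rewrite (_ : orbit_sqr' x = fun t => - \sum_(i <- index_enum 'I_n)
      2 * ((t `^ (a i)^-1 * x 0 i) * ((a i)^-1 * t `^ ((a i)^-1 - 1) * x 0 i)))//.
  elim: (index_enum _) => [|i r IH].
    rewrite (_ : (fun t => _) = fun=> 0); first exact: cC.
    by apply/funext => u; rewrite big_nil oppr0.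
  rewrite (_ : (fun t => _) = fun t => - (2 * ((t `^ (a i)^-1 * x 0 i) * ((a i)^-1 * t `^ ((a i)^-1 - 1) * x 0 i)))
      + - \sum_(i <- r) 2 * ((t `^ (a i)^-1 * x 0 i) * ((a i)^-1 * t `^ ((a i)^-1 - 1) * x 0 i))).
    apply: continuousD => //; apply: continuousN; apply: continuousM => //.
    apply: continuousM; first by apply: continuousM.
    by apply: continuousM => //; apply: continuousM.
  by apply/funext => u; rewrite big_cons opprD.
apply: continuousM; first exact: cC.
apply: continuousD.
  apply: continuousM; first by apply: continuousM.
  rewrite (_ : (fun u => _ ^+ 2) = fun u => Num.max (orbit_sqr x u) 0 * Num.max (orbit_sqr x u) 0).
    exact: continuousM.
  by apply/funext => u; rewrite expr2.
apply: continuousM => //; apply: continuousM => //.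
by apply: continuousM.
Qed.

(** Where the positive part is nonzero, [|x|^2 <= 1], so the derivative of the squared norm along
    the orbit is at most [2 Q]. The product rule then gives at most [|rho| + 4 Q], which [bump_norm]
    compensates. *)
Lemma orbit_bump'_le x : `|orbit_bump' x 1| <= g x.
Proof.
rewrite /orbit_bump' !powR1 !mulr1 mul1r.
have E : orbit_sqr x 1 = 1 - \sum_i x 0 i ^+ 2.
  by rewrite /orbit_sqr; congr (_ - _); apply: eq_bigr => i _; rewrite powR1 mul1r.
set M := Num.max _ 0; have M0 : 0 <= M by rewrite le_max lexx orbT.
have M1 : M <= 1.
  by rewrite /M E ge_max ler01 andbT; have := sqr_sum_ge0 x; lra.
have h : `|M * orbit_sqr' x 1| <= 2 * hom_dim a.
  have [->|Mn0] := eqVneq M 0; first by rewrite mul0r normr0 mulr_ge0 ?hom_dim_ge0.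
  have S1 : \sum_i x 0 i ^+ 2 <= 1.
    rewrite leNgt; apply/negP => S1; move: Mn0; rewrite /M E max_r ?eqxx//; lra.
  rewrite normrM (ger0_norm M0) -[leRHS]mul1r; apply: ler_pM => //.
  rewrite /orbit_sqr' normrN; apply: le_trans (ler_norm_sum _ _ _) _.
  rewrite /hom_dim mulr_sumr; apply: ler_sum => i _.
  rewrite !powR1 mul1r mulr1.
  have -> : 2 * (x 0 i * ((a i)^-1 * x 0 i)) = 2 * (a i)^-1 * (x 0 i ^+ 2) by ring.
  have ai0 : 0 <= (a i)^-1 by rewrite invr_ge0 ltW.
  rewrite ger0_norm; last by apply: mulr_ge0; [exact: mulr_ge0|exact: sqr_ge0].
  rewrite ler_piMr ?mulr_ge0//; apply: le_trans S1.
  by rewrite (bigD1 i)//= lerDl; apply: sumr_ge0 => j _; exact: sqr_ge0.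
have -> : bump_norm * g x * (rho * M ^+ 2 + 2 * M * orbit_sqr' x 1) =
  g x * (bump_norm * (rho * M ^+ 2 + 2 * (M * orbit_sqr' x 1))) by ring.
rewrite normrM (ger0_norm (g_ge0 x)) ler_piMr//.
rewrite normrM (ger0_norm (ltW bump_norm_gt0)) /bump_norm mulrC ler_pdivrMr ?mul1r; last first.
  by have := hom_dim_ge0; have := normr_ge0 rho; lra.
apply: le_trans (ler_normD _ _) _.
have h1 : `|rho * M ^+ 2| <= `|rho|.
  by rewrite normrM ler_piMr// ger0_norm ?sqr_ge0// expr_le1.
have h2 : `|2 * (M * orbit_sqr' x 1)| <= 4 * hom_dim a.
  by rewrite normrM ger0_norm//; lra.
lra.
Qed.

Lemma bump_near x (t : R) : 0 < t -> x != 0 ->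
  \forall u \near t, orbit_bump x u = bump_amplitude (dilation a u x).
Proof.
move=> t0 x0; near=> u; rewrite bump_orbitE//.
near: u; exact: lt_nbhsr.
Unshelve. all: by end_near. Qed.

Lemma bump_orbit_C1 x : x != 0 ->
  C1_pos (fun t => bump_amplitude (dilation a t x)).
Proof.
move=> x0 t t0.
have H (u : R) : 0 < u ->
    is_derive u 1 (fun t => bump_amplitude (dilation a t x)) (orbit_bump' x u).
  by move=> u0; apply: near_eq_is_derive (is_derive_orbit_bump x u0); exact: bump_near.
split; first by case: (H t t0).
have E : \forall u \near t, orbit_bump' x u = derive1 (fun t => bump_amplitude (dilation a t x)) u.
  near=> u; have u0 : 0 < u by near: u; exact: lt_nbhsr.
  by rewrite derive1E; case: (H u u0) => _ ->.
have E' := nbhs_singleton E.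
rewrite /= in E'.
suff : derive1 (fun t => bump_amplitude (dilation a t x)) @ t -->
    derive1 (fun t => bump_amplitude (dilation a t x)) t by [].
rewrite -E'.
apply: cvg_trans (near_eq_cvg E) _.
exact: orbit_bump'_continuous.
Unshelve. all: by end_near. Qed.

Lemma bump_orbit_derive x : x != 0 ->
  derive1 (fun t => bump_amplitude (dilation a t x)) 1 = orbit_bump' x 1.
Proof.
move=> x0; rewrite derive1E.
have := near_eq_is_derive (bump_near ltr01 x0) (is_derive_orbit_bump x ltr01).
by case.
Qed.

Definition bump_function x : R[i] := (bump_amplitude x +i* 0)%C.

Lemma bump_admissible : admissible a g bump_function.
Proof.
have nb x : normc (bump_function x) = bump_amplitude x.
  by rewrite /= expr0n addr0 sqrtr_sqr ger0_norm// bump_amplitude_ge0.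
have C0 (t : R) : is_derive t 1 (fun _ : R => 0 : R) 0 by exact: is_derive_cst.
split.
- split; first exact: integrable_bump_amplitude.
  by rewrite /=; exact: integrable0.
- by move=> x x1; rewrite /bump_function /bump_amplitude bump_support ?mulr0//; right.
- move=> x x0; split; first exact: bump_orbit_C1.
  move=> t t0; split; first by case: (C0 t).
  rewrite (_ : derive1 _ = fun=> 0); first exact: cvg_cst.
  by apply/funext => u; rewrite derive1E; case: (C0 u).
- move=> x x0; rewrite nb; apply: (le_trans (bump_amplitude_le x)).
  by rewrite indicE; case: (_ \in _); rewrite ?mulr1 ?mulr0.
- move=> x x0; rewrite /euler_deriv (_ : derive1 (orbit_im _ _ _) 1 = 0).
    rewrite /= expr0n addr0 sqrtr_sqr.
    have -> : derive1 (orbit_re a bump_function x) 1 = orbit_bump' x 1.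
      exact: bump_orbit_derive.
    exact: orbit_bump'_le.
  by rewrite derive1E; case: (C0 1).
Qed.

End bump.

(** * Cosine sums of Fejer type *)

Section fejer.
Context {R : realType}.
Implicit Types (u theta eta : R).

Lemma normr_sin_le u : `|sin u| <= `|u|.
Proof.
wlog u0 : u / 0 <= u.
  move=> H; have [h|h] := leP 0 u; first exact: H.
  by rewrite -normrN -sinN -[leRHS]normrN H// oppr_ge0 ltW.
have := @is_derive_norm_le_cst R sin cos 1 0 u u0.
move=> /(_ (fun s _ => is_derive_sin s)); rewrite sin0 !subr0 mul1r.
rewrite (ger0_norm u0); apply => s _.
by rewrite ler_norml cos_geN1 cos_le1.
Qed.

Lemma cos_ge_half u : `|u| <= 1 -> 2^-1 <= cos u.
Proof.
move=> u1; have -> : u = u / 2 + u / 2 by field.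
rewrite cosD -!expr2 cos2sin2.
have : sin (u / 2) ^+ 2 <= 4^-1; last by lra.
rewrite -real_normK ?num_real//; apply: (@le_trans _ _ (2^-1 ^+ 2)); last by lra.
rewrite lerXn2r ?nnegrE//; apply: le_trans (normr_sin_le _) _.
by rewrite normrM (@ger0_norm _ 2^-1)//; lra.
Qed.

Lemma fejer_sum N theta :
  (\sum_(j < N) cos (j%:R * theta)) ^+ 2 + (\sum_(j < N) sin (j%:R * theta)) ^+ 2 =
  \sum_(j < N) \sum_(k < N) cos ((j%:R - k%:R) * theta).
Proof.
rewrite !expr2 !mulr_suml -big_split/=; apply: eq_bigr => j _.
rewrite !mulr_sumr -big_split/=; apply: eq_bigr => k _.
by rewrite mulrBl cosB.
Qed.

Lemma fejer_ge N theta : `|theta| * N%:R <= 1 ->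
  N%:R ^+ 2 / 4 <= \sum_(j < N) \sum_(k < N) cos ((j%:R - k%:R) * theta).
Proof.
move=> h; rewrite -fejer_sum; apply: ler_wpDr; first exact: sqr_ge0.
have S : N%:R / 2 <= \sum_(j < N) cos (j%:R * theta).
  have -> : N%:R / 2 = \sum_(j < N) 2^-1 :> R.
    by rewrite sumr_const card_ord mulr_natl.
  apply: ler_sum => j _; apply: cos_ge_half; rewrite normrM mulrC.
  apply: le_trans h; rewrite ler_wpM2l// normr_nat ler_nat.
  exact: ltnW.
have -> : N%:R ^+ 2 / 4 = (N%:R / 2) ^+ 2 :> R by field.
by rewrite lerXn2r// nnegrE ?divr_ge0// (le_trans _ S)// divr_ge0.
Qed.

Lemma fejer_ge0 N theta :
  0 <= \sum_(j < N) \sum_(k < N) cos ((j%:R - k%:R) * theta).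
Proof. by rewrite -fejer_sum addr_ge0// sqr_ge0. Qed.

(** Comparison with the integral of [s^(-eta)] over [0,N], which is finite because [eta < 1]. *)
Lemma sum_powRN_le eta N : 0 < eta -> eta < 1 ->
  \sum_(m < N) (1 + m%:R) `^ (- eta) <= N%:R `^ (1 - eta) / (1 - eta).
Proof.
move=> e0 e1; have e10 : 0 < 1 - eta by lra.
case: N => [|N]; first by rewrite big_ord0 divr_ge0 ?powR_ge0// ltW.
elim: N => [|N IH].
  rewrite big_ord1 addr0 !powR1 mul1r -[leLHS]invr1 lef_pV2 ?posrE//; lra.
rewrite big_ord_recr/=; apply: le_trans (lerD IH (lexx _)) _.
rewrite -lerBrDl -mulrBl ler_pdivlMr//.
set A : R := N.+1%:R; have A0 : 0 < A by rewrite ltr0n.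
have -> : N.+2%:R = A + 1 :> R by rewrite /A natr1.
(* On [[A, A + 1]] the derivative of [F] is [(1 - eta) * (s^(-eta) - (1 + A)^(-eta))], which is
   nonnegative; [F A <= F (A + 1)] is the induction step. *)
pose F (s : R) := s `^ (1 - eta) - (1 - eta) * (1 + A) `^ (- eta) * s.
have : F A <= F (A + 1).
  apply: (@is_derive_ge0_le R F (fun s => (1 - eta) * s `^ (1 - eta - 1) - (1 - eta) * (1 + A) `^ (- eta))).
  - by lra.
  - move=> s /andP[sA _]; have s0 : 0 < s by exact: lt_le_trans sA.
    apply: is_derive_subf; first exact: is_derive1_powR.
    by apply: is_derive_eq (is_derive_mulfl _ (is_derive_idf s)) _; exact: mulr1.
  - move=> s /andP[sA sA1]; have s0 : 0 < s by exact: lt_le_trans sA.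
    have -> : 1 - eta - 1 = - eta by ring.
    rewrite -mulrBr mulr_ge0 ?(ltW e10)// subr_ge0; apply: powRN_le => //; last exact: ltW.
    by rewrite addrC.
rewrite /F [X in _ -> X <= _]mulrC.
by set c := (1 - eta) * (1 + A) `^ (- eta); lra.
Qed.

(** With truncated subtraction [(j - k) + (k - j)] is the distance of [j] and [k], and each distance
    occurs at most twice in a row. *)
Lemma toeplitz_row_le (w : nat -> R) N (j : 'I_N) : (forall m, 0 <= w m) ->
  \sum_(k < N) w ((j - k) + (k - j))%N <= 2 * \sum_(m < N) w m.
Proof.
move=> w0; have jN := ltn_ord j.
rewrite -(big_mkord xpredT (fun k => w ((j - k) + (k - j))%N)) -(big_mkord xpredT w).
rewrite (@big_cat_nat _ _ _ j)//=; last exact: ltnW.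
rewrite mulr_natl mulr2n; apply: lerD.
  rewrite big_nat_rev/= add0n.
  rewrite (eq_big_nat _ _ (F2 := fun k => w k.+1)); last first.
    move=> k /andP[_ kj]; congr w; lia.
  rewrite -(big_add1 _ _ 0 j.+1 xpredT w).
  rewrite [leRHS](@big_cat_nat _ _ _ 1)//=; last by case: (N) j jN.
  rewrite big_nat1; apply: ler_wpDl => //.
  rewrite [leRHS](@big_cat_nat _ _ _ j.+1)//=.
  by rewrite lerDl sumr_ge0.
rewrite -{1}[nat_of_ord j]add0n big_addn.
rewrite (eq_big_nat _ _ (F2 := w)); last first.
  by move=> k /andP[_ kj]; congr w; lia.
rewrite [leRHS](@big_cat_nat _ _ _ (N - j))//= ?leq_subr//.
by rewrite lerDl sumr_ge0.
Qed.

End fejer.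

(** * From decay to the growth of sublevel sets *)

Section converse.
Context {R : realType} (n : nat) (a : 'I_n -> R) (rho : R) (f g : 'rV[R]_n -> R).
Local Notation X := (lebesgue_rV_type R n).
Local Notation mu := (lebesgue_rV R n).
Hypothesis n_ge1 : (1 <= n)%N.
Hypothesis a_gt0 : forall i, 0 < a i.
Hypothesis f_meas : lebesgue_measurable f.
Hypothesis f_hom : mixed_homogeneous a f.
Hypothesis g_ge0 : forall x, 0 <= g x.
Hypothesis g_loc : locally_integrable_rV g.
Hypothesis g_hom : mixed_homogeneous_away0 a rho g.
Implicit Type x : 'rV[R]_n.
Local Notation phi0 := (bump_amplitude a rho g).

Definition uniform_decay (eta C : R) : Prop := forall phi, admissible a g phi ->
  forall (l0 : R) (l : 'rV[R]_n),
  normc (osc_integral f phi l0 l) <= C * (1 + `|l0|) `^ (- eta).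

Lemma integrable_cos_bump (c : R) :
  mu.-integrable setT (EFin \o ((fun x => cos (c * f x) * phi0 x) : X -> R)).
Proof.
apply: (@le_integrable _ _ _ _ _ _ _ (EFin \o (phi0 : X -> R))); first exact: measurableT.
- apply/measurable_EFinP; apply: measurable_funM.
    apply: measurableT_comp; first by apply: continuous_measurable_fun; exact: continuous_cos.
    by apply: measurable_funM; [exact: measurable_cst|exact: f_meas].
  exact: measurable_bump_amplitude.
- move=> x _; rewrite /= lee_fin normrM ler_piMl//.
  by rewrite ler_norml cos_geN1 cos_le1.
- exact: integrable_bump_amplitude.
Qed.

Lemma cos_bump_le (eta C c : R) : uniform_decay eta C ->
  (\int[mu]_x (cos (c * f x) * phi0 x)%:E <= (C * (1 + `|c|) `^ (- eta))%:E)%E.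
Proof.
move=> H; rewrite -[leLHS]fineK; last exact: integrable_fin_num (integrable_cos_bump c).
rewrite lee_fin.
have := H _ (bump_admissible a_gt0 g_ge0 g_loc g_hom) c 0; apply: le_trans.
apply: le_trans (Re_le_normc _); apply: le_trans (ler_norm _).
rewrite /osc_integral /cintegral /= /Rintegral le_eqVlt; apply/orP; left; apply/eqP.
congr fine; apply: eq_integral => x _; congr EFin; rewrite /=.
rewrite mulr0 subr0 big1 ?addr0// => i _.
by rewrite mxE mul0r.
Qed.

Lemma norm_natB (j k : nat) : `|j%:R - k%:R : R| = ((j - k) + (k - j))%N%:R.
Proof.
have [jk|kj] := leqP j k.
  by rewrite distrC -natrB// normr_nat; congr _%:R; lia.
by rewrite -natrB 1?ltnW// normr_nat; congr _%:R; lia.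
Qed.

Lemma fejer_bump_le (eta C : R) N : 0 < eta -> eta < 1 -> 0 < C -> uniform_decay eta C ->
  (\int[mu]_x ((\sum_(j < N) \sum_(k < N) cos ((j%:R - k%:R) * f x)) * phi0 x)%:E
   <= (N%:R * (2 * C * (N%:R `^ (1 - eta) / (1 - eta))))%:E)%E.
Proof.
move=> e0 e1 C0 H.
have -> : (\int[mu]_x ((\sum_(j < N) \sum_(k < N) cos ((j%:R - k%:R) * f x)) * phi0 x)%:E =
    \sum_(j < N) \sum_(k < N) \int[mu]_x (cos ((j%:R - k%:R) * f x) * phi0 x)%:E)%E.
  have I j : mu.-integrable setT (fun x : X =>
      (\sum_(k < N) (cos ((j%:R - k%:R) * f x) * phi0 x)%:E)%E).
    by apply: integrable_sum; [exact: measurableT|move=> k _; exact: integrable_cos_bump].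
  under [RHS]eq_bigr => j _.
    rewrite -(@integral_sum _ _ _ _ _ measurableT _
      (fun (k : 'I_N) (x : X) => (cos ((j%:R - k%:R) * f x) * phi0 x)%:E)); last first.
      by move=> k; exact: integrable_cos_bump.
    over.
  rewrite -(@integral_sum _ _ _ _ _ measurableT _
      (fun (j : 'I_N) (x : X) => (\sum_(k < N) (cos ((j%:R - k%:R) * f x) * phi0 x)%:E)%E)); last first.
    by move=> j; exact: I.
  apply: eq_integral => x _; rewrite mulr_suml -sumEFin; apply: eq_bigr => j _.
  by rewrite mulr_suml -sumEFin.
apply: (@le_trans _ _ (\sum_(j < N) (2 * C * (N%:R `^ (1 - eta) / (1 - eta)))%:E)%E); last first.
  by rewrite sumEFin lee_fin sumr_const card_ord -[leLHS]mulr_natl.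
apply: lee_sum => j _.
pose w (m : nat) : R := C * (1 + m%:R) `^ (- eta).
apply: (@le_trans _ _ (\sum_(k < N) (w ((j - k) + (k - j))%N)%:E)%E).
  apply: lee_sum => k _; rewrite /w -norm_natB.
  exact: cos_bump_le.
rewrite sumEFin lee_fin; apply: (le_trans (toeplitz_row_le j _)).
  by move=> m; rewrite mulr_ge0 ?powR_ge0// ltW.
rewrite /w -mulr_sumr -mulrA; apply: ler_wpM2l => //; apply: ler_wpM2l; first exact: ltW.
exact: sum_powRN_le.
Qed.

(** The kernel is nonnegative everywhere and at least [N^2 / 4] where [|f| < 1/N]. Dividing the
    upper bound, of order [N * N^(1 - eta)], by this leaves [N^(-eta)]; the 8 is 4 times the 2 of
    the row sums. *)
Lemma bump_sublevel_le (eta C : R) N : 0 < eta -> eta < 1 -> 0 < C -> (0 < N)%N ->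
  uniform_decay eta C ->
  (\int[mu]_x (phi0 x * \1_[set x | (`|f x| < N%:R^-1)%R] x)%:E
   <= (8 * C / (1 - eta) * N%:R `^ (- eta))%:E)%E.
Proof.
move=> e0 e1 C0 N0 H; have e10 : 0 < 1 - eta by lra.
have N0' : 0 < N%:R :> R by rewrite ltr0n.
have mS : measurable ([set x | (`|f x| < N%:R^-1)%R] : set X) by exact: measurable_norm_lt.
have m1 : measurable_fun setT ((fun x => phi0 x * \1_[set x | (`|f x| < N%:R^-1)%R] x) : X -> R).
  apply: measurable_funM; first exact: measurable_bump_amplitude.
  exact: measurable_indic.
have p0 := bump_amplitude_ge0 rho a_gt0 g_ge0.
have -> : (8 * C / (1 - eta) * N%:R `^ (- eta))%:E =
    ((4 / N%:R ^+ 2)%:E * (N%:R * (2 * C * (N%:R `^ (1 - eta) / (1 - eta))))%:E)%E.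
  rewrite -EFinM; congr EFin; rewrite powRD ?gt_eqF ?implybT// powRr1 ?ltW//.
  by field; rewrite !gt_eqF.
apply: (@le_trans _ _ ((4 / N%:R ^+ 2)%:E *
  \int[mu]_x ((\sum_(j < N) \sum_(k < N) cos ((j%:R - k%:R) * f x)) * phi0 x)%:E)%E); last first.
  by apply: lee_wpmul2l; [rewrite lee_fin divr_ge0|exact: fejer_bump_le].
have mK : measurable_fun setT
    ((fun x => (\sum_(j < N) \sum_(k < N) cos ((j%:R - k%:R) * f x)) * phi0 x) : X -> R).
  apply: measurable_funM; last exact: measurable_bump_amplitude.
  apply: measurable_sum => j; apply: measurable_sum => k.
  apply: measurableT_comp; first by apply: continuous_measurable_fun; exact: continuous_cos.
  by apply: measurable_funM; [exact: measurable_cst|exact: f_meas].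
have K0 x : 0 <= (\sum_(j < N) \sum_(k < N) cos ((j%:R - k%:R) * f x)) * phi0 x.
  by rewrite mulr_ge0 ?fejer_ge0.
rewrite -ge0_integralZl_EFin; first last.
- by rewrite divr_ge0.
- exact/measurable_EFinP.
- by move=> x _; rewrite lee_fin.
- exact: measurableT.
apply: ge0_le_integral; first exact: measurableT.
- by move=> x _; rewrite lee_fin mulr_ge0.
- exact/measurable_EFinP.
- by apply/measurable_EFinP; apply: measurable_funM; [exact: measurable_cst|exact: mK].
move=> x _; rewrite -EFinM lee_fin indicE; have [xS|xS] := boolP (x \in _); last first.
  by rewrite mulr0 mulr_ge0// divr_ge0.
rewrite mulr1 mulrA ler_peMl//.
apply: (@le_trans _ _ (4 / N%:R ^+ 2 * (N%:R ^+ 2 / 4))).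
  by rewrite [leRHS](_ : _ = 1)//; field; rewrite gt_eqF.
apply: ler_wpM2l; first by rewrite divr_ge0.
apply: fejer_ge.
move: xS; rewrite inE /= => h.
by rewrite -ler_pdivlMr// mul1r ltW.
Qed.

(** The time [s] is at least [a i * ln (2 n)] for every [i], so [|x_i| <= 1/(2n)] and
    [|x|^2 <= 1/4]; the profile is then at least [9/16]. *)
Lemma flow_cube_bump : exists2 s : R, 0 <= s & forall x, @cube R n (flow a s x) -> 2^-1 <= bump_profile x.
Proof.
have n1 : 1 <= n%:R :> R by rewrite ler1n.
have L0 : 0 <= ln (2 * n%:R : R) by rewrite ln_ge0//; lra.
exists (ln (2 * n%:R) * \sum_i a i).
  by apply: mulr_ge0 => //; apply: sumr_ge0 => i _; exact: ltW.
move=> x xc.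
have xi i : x 0 i ^+ 2 <= (2 * n%:R)^-1 ^+ 2.
  have := xc i; rewrite mxE => h.
  set e := expR _ in h.
  have en : 2 * n%:R <= e.
    rewrite -[leLHS]lnK ?posrE; last by lra.
    rewrite ler_expR mulrCA.
    rewrite -[leLHS]mulr1; apply: ler_wpM2l => //.
    rewrite mulrC ler_pdivlMr// mul1r (bigD1 i)//= lerDl.
    by apply: sumr_ge0 => j _; exact: ltW.
  have e0 : 0 < e by exact: expR_gt0.
  rewrite -real_normK ?num_real// lerXn2r ?nnegrE ?invr_ge0 ?mulr_ge0//.
  apply: (@le_trans _ _ e^-1); last by rewrite lef_pV2 ?posrE//; lra.
  rewrite -[leRHS]mul1r ler_pdivlMr// -{1}(ger0_norm (ltW e0)) -normrM mulrC ler_norml.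
  by case/andP: h => h1 h2; rewrite h1 h2.
have S : \sum_i x 0 i ^+ 2 <= 4^-1.
  apply: (@le_trans _ _ (\sum_(i < n) (2 * n%:R)^-1 ^+ 2)); first exact: ler_sum.
  rewrite sumr_const card_ord -[leLHS]mulr_natl.
  rewrite (_ : n%:R * _ = 4^-1 * n%:R^-1); last by field; rewrite gt_eqF//; lra.
  by rewrite ler_piMr// invf_le1//; lra.
have S0 := sqr_sum_ge0 x.
rewrite /bump_profile max_l; last by lra.
by nra.
Qed.

(** The flow at a fixed time [s >= 0] carries the region where the profile is at least 1/2 over the
    whole cube. Since [f (flow s x) = e^s * f x], the condition [|f| < t] passes back to [x], while
    [g] and the volume change by constants. *)
Lemma cube_sublevel_le_bump : exists2 K : R, 0 < K & forall t : R, 0 < t ->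
  (mu_g g (@cube R n `&` [set x | (`|f x| < t)%R]) <=
   K%:E * \int[mu]_x (phi0 x * \1_[set x | (`|f x| < t)%R] x)%:E)%E.
Proof.
have [s s0 Hs] := flow_cube_bump.
have b0 := bump_norm_gt0 rho a_gt0.
have p0 := bump_amplitude_ge0 rho a_gt0 g_ge0.
pose c := expR (rho * s) * 2 / bump_norm a rho.
have c0 : 0 < c by rewrite divr_gt0// mulr_gt0// expR_gt0.
exists (expR (hom_dim a * s) * c); first by rewrite mulr_gt0// expR_gt0.
move=> t t0; rewrite mu_g_indic//.
have mS : measurable ([set x | (`|f x| < t)%R] : set X) by exact: measurable_norm_lt.
have mA : measurable (@cube R n `&` [set x | (`|f x| < t)%R] : set X).
  by apply: measurableI => //; exact: measurable_cube_completed.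
have mW : measurable_fun setT ((fun x => phi0 x * \1_[set x | (`|f x| < t)%R] x) : X -> R).
  apply: measurable_funM; first exact: measurable_bump_amplitude.
  exact: measurable_indic.
rewrite EFinM -muleA.
rewrite -ge0_integralZl_EFin; first last.
- exact: ltW.
- exact/measurable_EFinP.
- by move=> x _; rewrite lee_fin mulr_ge0.
- exact: measurableT.
apply: (ge0_integral_flow_le n_ge1 (F := fun x => g x * \1_(@cube R n `&` [set x | (`|f x| < t)%R]) x)
  (W := fun x => c * (phi0 x * \1_[set x | (`|f x| < t)%R] x))).
- apply: measurable_funM; first exact: (proj1 g_loc).
  exact: measurable_indic.
- by move=> x; rewrite mulr_ge0.
- by apply: measurable_funM; [exact: measurable_cst|exact: mW].
- by move=> x; rewrite mulr_ge0 ?(ltW c0)// mulr_ge0.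
move=> x x0; rewrite !indicE.
have [h|_] := boolP (flow a s x \in _); last first.
  by rewrite mulr0 mulr_ge0 ?(ltW c0)// mulr_ge0.
move: h; rewrite inE => -[/Hs hb /= hf].
rewrite mem_set/=; last first.
  apply: le_lt_trans hf; rewrite -dilation_expR f_hom ?expR_gt0// normrM ler_peMl//.
  by rewrite ger0_norm ?expR_ge0// -expR0 ler_expR.
rewrite !mulr1 (flow_hom g_hom)// /c /bump_amplitude.
have -> : expR (rho * s) * 2 / bump_norm a rho * (bump_norm a rho * (g x * bump_profile x)) =
   expR (rho * s) * g x * (2 * bump_profile x) by field; rewrite gt_eqF.
by rewrite ler_peMr ?mulr_ge0 ?expR_ge0//; lra.
Qed.

Lemma cube_sublevel_le_bound (t : R) :
  (mu_g g (@cube R n `&` [set x | (`|f x| < t)%R]) <= \int[mu]_x (g x * \1_(@cube R n) x)%:E)%E.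
Proof.
rewrite mu_g_indic//; apply: ge0_le_integral; first exact: measurableT.
- by move=> x _; rewrite lee_fin mulr_ge0.
- apply/measurable_EFinP; apply: measurable_funM; first exact: (proj1 g_loc).
  apply: measurable_indic; apply: measurableI; first exact: measurable_cube_completed.
  exact: measurable_norm_lt.
- exact/measurable_EFinP/(measurable_cube_weight g_loc).
- move=> x _; rewrite lee_fin ler_wpM2l//.
  rewrite !indicE; have [|//] := boolP (x \in _ `&` _).
  by rewrite inE => -[h _]; rewrite mem_set.
Qed.

Lemma decay_growth (eta C eps : R) : 0 < eta -> eta < 1 -> 0 < C -> uniform_decay eta C ->
  0 <= eps -> eps < eta -> sublevel_growth f g eps.
Proof.
move=> e0 e1 C0 H eps0 epseta; have e10 : 0 < 1 - eta by lra.
have [K K0 HK] := cube_sublevel_le_bump.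
have [M M0 HM] := cube_weight_bound g_ge0 g_loc.
set D := 8 * C / (1 - eta); have D0 : 0 < D by rewrite divr_gt0// mulr_gt0.
have KD0 : 0 < K * D by exact: mulr_gt0.
exists (M + K * D * 2); first by apply: ltr_wpDl => //; exact: mulr_gt0.
move=> t t0; have [t1|t1] := leP 1 t.
  apply: (@le_trans _ _ M%:E).
    by apply: le_trans HM; exact: cube_sublevel_le_bound.
  rewrite lee_fin -[leLHS]mulr1; apply: ler_pM => //.
    by rewrite lerDl mulr_ge0// ltW.
  by rewrite -(powRr0 t) ler_powR.
(* This [N] satisfies [t <= 1/N <= 2 t], so the sublevel set at [t] lies in the one at [1/N], and
   [N^(-eta) <= (2 t)^eta <= 2 * t^eps] because [t < 1]. *)
pose N := Num.truncn t^-1.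
have tV1 : 1 <= t^-1 by rewrite invf_ge1// ltW.
have /andP[Nt tN] : N%:R <= t^-1 < N.+1%:R by apply: truncn_itv; lra.
have N0 : (0 < N)%N by rewrite /N truncn_gt0.
have N1 : 1 <= N%:R :> R by rewrite ler1n.
have tNV : t <= N%:R^-1 by rewrite -[leLHS]invrK lef_pV2 ?posrE//; lra.
have Nt2 : 1 <= 2 * t * N%:R.
  have -> : 2 * t * N%:R = (2 * N%:R) / t^-1 by rewrite invrK; ring.
  by rewrite ler_pdivlMr ?invr_gt0// mul1r; move: tN; rewrite -natr1; lra.
apply: (le_trans (HK t t0)).
apply: (@le_trans _ _ (K%:E * (D * N%:R `^ (- eta))%:E)%E).
  apply: lee_wpmul2l; first by rewrite lee_fin ltW.
  apply: le_trans (bump_sublevel_le e0 e1 C0 N0 H).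
  have mW r : measurable_fun setT ((fun x => phi0 x * \1_[set x | (`|f x| < r)%R] x) : X -> R).
    apply: measurable_funM; first exact: measurable_bump_amplitude.
    by apply: measurable_indic; exact: measurable_norm_lt.
  have p0 := bump_amplitude_ge0 rho a_gt0 g_ge0.
  apply: ge0_le_integral; first exact: measurableT.
  - by move=> x _; rewrite lee_fin mulr_ge0.
  - exact/measurable_EFinP.
  - exact/measurable_EFinP.
  - move=> x _; rewrite lee_fin ler_wpM2l//.
    rewrite !indicE; have [|//] := boolP (x \in [set x | (`|f x| < t)%R]).
    rewrite inE /= => h; rewrite mem_set//=.
    exact: lt_le_trans tNV.
rewrite -EFinM lee_fin mulrDl ler_wpDl ?mulr_ge0 ?powR_ge0//.
rewrite mulrA -[leRHS]mulrA ler_wpM2l ?(ltW KD0)//.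
apply: (@le_trans _ _ ((2 * t) `^ eta)).
  rewrite powRN -[leLHS]mul1r ler_pdivrMr ?powR_gt0 ?ltr0n// -powRM ?ler0n//; last by lra.
  rewrite -[leLHS](congr1 (fun h => h eta) (powR1 R)).
  by apply: ge0_ler_powR; rewrite ?nnegrE//; lra.
rewrite powRM; [|lra|lra]; apply: ler_pM; rewrite ?powR_ge0//.
  by apply: ler1_powR; lra.
by apply: ger_powR; rewrite ?t0; lra.
Qed.

End converse.

(** * Sharpness of the exponent *)

Section sharpness.
Context {R : realType} (n : nat) (a : 'I_n -> R) (rho : R) (f g : 'rV[R]_n -> R).
Hypothesis n_ge1 : (1 <= n)%N.
Hypothesis a_gt0 : forall i, 0 < a i.
Hypothesis f_meas : lebesgue_measurable f.
Hypothesis f_hom : mixed_homogeneous a f.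
Hypothesis g_ge0 : forall x, 0 <= g x.
Hypothesis g_loc : locally_integrable_rV g.
Hypothesis g_hom : mixed_homogeneous_away0 a rho g.

Lemma sublevel_growth0 : sublevel_growth f g 0.
Proof.
have [M M0 HM] := cube_weight_bound g_ge0 g_loc.
exists (M + 1); first by lra.
move=> t t0; rewrite powRr0 mulr1.
apply: (le_trans (cube_sublevel_le_bound f_meas g_ge0 g_loc t)).
apply: (le_trans HM); rewrite lee_fin; lra.
Qed.

Lemma growth_sup_sharp (eta C : R) :
  (growth_sup f g < 1)%E -> (growth_sup f g < eta%:E)%E -> 0 < C ->
  ~ uniform_decay a f g eta C.
Proof.
move=> sup1 supeta C0 H.
have sup0 : (0 <= growth_sup f g)%E.
  by apply: ereal_sup_ubound; exists 0 => //; split => //; exact: sublevel_growth0.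
have supE : growth_sup f g = (fine (growth_sup f g))%:E.
  by rewrite fineK// ge0_fin_numE//; exact: lt_trans sup1 (ltry _).
move: supE sup0 sup1 supeta; set d := fine _ => supE.
rewrite supE !lee_fin !lte_fin => d0 d1 deta.
(* The converse requires a rate below 1, while [eta] may be larger. Lowering the rate weakens the
   assumed estimate, so [eta] is replaced by [e1], still above [d]; the midpoint of [d] and [e1] is
   then a growth exponent beyond the supremum. *)
pose e1 := Num.min eta ((d + 1) / 2).
have [e1eta e1d] : e1 <= eta /\ e1 <= (d + 1) / 2 by split; rewrite ge_min lexx ?orbT.
have de1 : d < e1 by rewrite lt_min deta; lra.
have H1 : uniform_decay a f g e1 C.
  move=> phi adm l0 l; apply: (le_trans (H phi adm l0 l)).
  rewrite ler_wpM2l ?(ltW C0)// ler_powR ?lerN2//.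
  by rewrite lerDl.
have e2e1 : (d + e1) / 2 < e1 by lra.
have e11 : e1 < 1 by lra.
have G : sublevel_growth f g ((d + e1) / 2).
  apply: (decay_growth n_ge1 a_gt0 f_meas f_hom g_ge0 g_loc g_hom _ _ C0 H1) => //; lra.
have : (((d + e1) / 2)%:E <= growth_sup f g)%E.
  by apply: ereal_sup_ubound; exists ((d + e1) / 2) => //; split => //; lra.
by rewrite supE lee_fin; lra.
Qed.

End sharpness.

Theorem theorem1p1 (R : realType) (n : nat) (a : 'I_n -> R) (rho : R)
    (f g : 'rV[R]_n -> R)
    (n_ge1 : (1 <= n)%N)
    (a_gt0 : forall i, 0 < a i) (a_neq1 : forall i, a i != 1)
    (f_meas : lebesgue_measurable f) (f_hom : mixed_homogeneous a f)
    (g_ge0 : forall x, 0 <= g x) (g_loc : locally_integrable_rV g)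
    (g_hom : mixed_homogeneous_away0 a rho g) :
  let v := distinct_values a in
  let vinv : R := v%:R^-1 in
  let v1inv : R := v.+1%:R^-1 in
  (* (a), direct part *)
  (forall eps : R, 0 < eps -> sublevel_growth f g eps ->
    (eps != v1inv ->
      exists2 C : R, 0 < C & forall phi, admissible a g phi ->
        forall (l0 : R) (l : 'rV[R]_n),
        normc (osc_integral f phi l0 l)
          <= C * (1 + `|l0|) `^ (- Num.min eps v1inv)) /\
    (eps = v1inv ->
      exists2 C : R, 0 < C & forall phi, admissible a g phi ->
        forall (l0 : R) (l : 'rV[R]_n),
        normc (osc_integral f phi l0 l)
          <= C * (1 + `|l0|) `^ (- Num.min eps v1inv) * ln (2 + `|l0|))) /\
  (* (a), converse *)
  (forall eta : R, 0 < eta -> eta < 1 ->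
    (exists2 C : R, 0 < C & forall phi, admissible a g phi ->
      forall (l0 : R) (l : 'rV[R]_n),
      normc (osc_integral f phi l0 l) <= C * (1 + `|l0|) `^ (- eta)) ->
    forall eps : R, 0 < eps -> eps < eta -> sublevel_growth f g eps) /\
  (* (a), sharpness *)
  ((growth_sup f g <= v1inv%:E)%E ->
    forall eta : R, (growth_sup f g < eta%:E)%E ->
    ~ exists2 C : R, 0 < C & forall phi, admissible a g phi ->
        forall (l0 : R) (l : 'rV[R]_n),
        normc (osc_integral f phi l0 l) <= C * (1 + `|l0|) `^ (- eta)) /\
  (* (b) *)
  (forall p : \bar R, (1 <= p)%E -> Lp_cube p g ->
    let p' := hoelder_conjugate p in
    let p'inv : R := fine (p'^-1)%E in
    (p' != (v.+1%:R)%:E ->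
      exists2 C : R, 0 < C & forall phi, admissible a g phi ->
        forall (l0 : R) (l : 'rV[R]_n),
        normc (osc_integral f phi l0 l)
          <= C * (1 + enorm l) `^ (- Num.min p'inv v1inv)) /\
    (p' = (v.+1%:R)%:E ->
      exists2 C : R, 0 < C & forall phi, admissible a g phi ->
        forall (l0 : R) (l : 'rV[R]_n),
        normc (osc_integral f phi l0 l)
          <= C * (1 + enorm l) `^ (- Num.min p'inv v1inv)
               * ln (2 + enorm l) `^ v1inv)) /\
  (* (c) *)
  (forall p : \bar R, (1 <= p)%E -> Lp_cube p g ->
    let p' := hoelder_conjugate p in
    let p'inv : R := fine (p'^-1)%E in
    (p' != (v%:R)%:E ->
      exists2 C : R, 0 < C & forall phi, admissible a g phi ->
        forall l : 'rV[R]_n,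
        normc (osc_integral f phi 0 l)
          <= C * (1 + enorm l) `^ (- Num.min p'inv vinv)) /\
    (p' = (v%:R)%:E ->
      exists2 C : R, 0 < C & forall phi, admissible a g phi ->
        forall l : 'rV[R]_n,
        normc (osc_integral f phi 0 l)
          <= C * (1 + enorm l) `^ (- Num.min p'inv vinv)
               * ln (2 + enorm l) `^ vinv)).
Proof.
move=> v vinv v1inv; split; last split; last split; last split.
- move=> eps eps0 H.
  have [C C0 HC] := growth_decay a_gt0 a_neq1 n_ge1 f_meas f_hom g_ge0 g_loc g_hom eps0 H.
  split => [/negbTE e|/eqP e]; exists C => // phi adm l0 l.
    by have := HC phi adm l0 l; rewrite e mulr1.
  by have := HC phi adm l0 l; rewrite e.
- move=> eta eta0 eta1 [C C0 HC] eps eps0 epseta.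
  exact: (decay_growth n_ge1 a_gt0 f_meas f_hom g_ge0 g_loc g_hom eta0 eta1 C0 HC (ltW eps0)).
- move=> sup_le eta sup_lt [C C0 HC].
  apply: (growth_sup_sharp n_ge1 a_gt0 f_meas f_hom g_ge0 g_loc g_hom _ sup_lt C0 HC).
  (* There is at least one exponent, so [1/(v+1)] is below 1 and the supremum lies in the range of
     the converse. *)
  apply: le_lt_trans sup_le _; rewrite lte_fin invf_lt1 ?ltr0n// ltr1n.
  exact: distinct_values_gt0.
- move=> p p1 gp p' p'inv.
  have [C C0 HC] := Lp_decay n_ge1 a_gt0 a_neq1 f_meas f_hom g_ge0 g_loc g_hom p1 gp.
  split => [/negbTE e|/eqP e]; exists C => // phi adm l0 l.
    by have := HC phi adm l0 l; rewrite e mulr1.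
  by have := HC phi adm l0 l; rewrite e.
- move=> p p1 gp p' p'inv.
  have [C C0 HC] := Lp_decay0 n_ge1 a_gt0 f_meas g_ge0 g_loc g_hom p1 gp.
  split => [/negbTE e|/eqP e]; exists C => // phi adm l.
    by have := HC phi adm l; rewrite e mulr1.
  by have := HC phi adm l; rewrite e.
Qed.
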